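(* Given an $n$-vertex graph, represented by its adjacency matrix, with edge density $\gamma=\gamma(n)$ such that $\max\{\gamma^{-1},(1-\gamma)^{-1}\}=n^{o(1)}$, there is a randomized algorithm running in time $O\!\left(\frac{n\lg n}{h_2(\gamma)}\right)=n^{1+o(1)}$ that, with high probability, returns a biclique $K_{t,t}$ contained in the graph with $t=(1-o(1))\frac{\gamma\lg n}{h_2(\gamma)}$. Furthermore, if one is allowed to query the degree of a vertex in $O(1)$ time, the algorithm can be made deterministic.
   Context: All graphs are finite, simple and undirected; $\lg$ is the base-2 logarithm; $h_2(x)=-x\lg x-(1-x)\lg(1-x)$ is the binary entropy function. The edge density of an $n$-vertex graph $G$ is $|E(G)|/\binom n2$. ''Returns a biclique $K_{t,t}$'' means outputting the two sides (disjoint vertex sets of size $t$ each) of a complete bipartite, not necessarily induced, subgraph of the input graph. Asymptotics are as $n\to\infty$, and ''with high probability'' means with probability tending to $1$ as $n\to\infty$. The graph is given by its adjacency matrix, so the adjacency of a pair of vertices can be queried in $O(1)$ time. *)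

(* Defs.v *)
From HB Require Import structures.
From mathcomp Require Import all_boot all_order all_algebra.
From mathcomp Require Import all_classical all_reals all_analysis.
Set Implicit Arguments.
Unset Strict Implicit.
Unset Printing Implicit Defensive.
Import Order.TTheory GRing.Theory Num.Theory.
Import numFieldNormedType.Exports.

Record sgraph (n : nat) := SGraph {
  adj : rel 'I_n;
  adj_sym : symmetric adj;
  adj_irr : irreflexive adj
}.

Section Graphs.
Variables (n : nat) (G : sgraph n).

Definition edges : {set 'I_n * 'I_n} :=
  [set uv : 'I_n * 'I_n | (uv.1 < uv.2)%N && adj G uv.1 uv.2].

Definition degree (u : 'I_n) : nat := #|[pred v | adj G u v]|.

(* Not necessarily induced: nothing is required inside A or inside B. *)
Definition biclique (t : nat) (A B : {set 'I_n}) : bool :=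
  [&& #|A| == t, #|B| == t, [disjoint A & B] &
      [forall a in A, forall b in B, adj G a b]].

(* The oracles as seen by a machine that manipulates integers; integers that
   are not names of vertices get the answer 0. *)
Definition adj_query (u v : nat) : nat :=
  if (insub u, insub v) is (Some u', Some v') then adj G u' v' else false.

Definition degree_query (u : nat) : nat :=
  if insub u is Some u' then degree u' else 0.

End Graphs.

(* A word RAM. On an n-vertex graph all integers live in [0, n ^ k) for a
   constant k, i.e. words have O(lg n) bits. There are registers (a program
   mentions finitely many, named by natural numbers) and a random-access memory
   of words, addressed through registers. Each step of the machine costs 1. *)
Inductive arith := OpAdd | OpSub | OpMul | OpDiv | OpLt.

Inductive cmd :=
  | Const of nat & nat              (* x := c *)
  | Arith of arith & nat & nat & nat (* x := y op z *)
  | Read of nat & nat               (* x := ram[y] *)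
  | Write of nat & nat              (* ram[x] := y *)
  | Adj of nat & nat & nat          (* x := 1 if y and z are adjacent, else 0 *)
  | Deg of nat & nat                (* x := degree of y *)
  | Rand of nat                     (* x := uniformly random word *)
  | Seq of cmd & cmd
  | If of nat & cmd & cmd           (* a register is true when nonzero *)
  | While of nat & cmd.

Fixpoint uses_deg (c : cmd) : bool :=
  match c with
  | Deg _ _ => true
  | Seq c1 c2 | If _ c1 c2 => uses_deg c1 || uses_deg c2
  | While _ c1 => uses_deg c1
  | _ => false
  end.

Fixpoint uses_rand (c : cmd) : bool :=
  match c with
  | Rand _ => true
  | Seq c1 c2 | If _ c1 c2 => uses_rand c1 || uses_rand c2
  | While _ c1 => uses_rand c1
  | _ => false
  end.

Record state := State {
  reg : nat -> nat;
  ram : nat -> nat;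
  pos : nat (* number of random words consumed so far *)
}.

Definition upd (f : nat -> nat) (x v : nat) : nat -> nat :=
  fun y => if y == x then v else f y.

(* Subtraction is truncated at 0, and division by 0 gives 0. *)
Definition arith_eval (o : arith) (a b : nat) : nat :=
  match o with
  | OpAdd => a + b
  | OpSub => a - b
  | OpMul => a * b
  | OpDiv => a %/ b
  | OpLt => a < b
  end.

(* A configuration is the stack of the commands still to be run, and a state. *)
Definition config : Type := seq cmd * state.

Section Machine.
Variables (n : nat) (G : sgraph n).
Variable W : nat. (* words are the integers in [0, W) *)
Variable tape : seq nat. (* the random words, in order of consumption *)

Definition set_reg (s : state) (x v : nat) : state :=
  State (upd (reg s) x (v %% W)) (ram s) (pos s).

Definition step (cf : config) : config :=
  let: (stack, s) := cf in
  let r := reg s in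
  match stack with
  | [::] => cf
  | c :: K =>
    match c with
    | Const x a => (K, set_reg s x a)
    | Arith o x y z => (K, set_reg s x (arith_eval o (r y) (r z)))
    | Read x y => (K, set_reg s x (ram s (r y)))
    | Write x y => (K, State r (upd (ram s) (r x) (r y)) (pos s))
    | Adj x y z => (K, set_reg s x (adj_query G (r y) (r z)))
    | Deg x y => (K, set_reg s x (degree_query G (r y)))
    | Rand x =>
        let s' := set_reg s x (nth 0 tape (pos s)) in
        (K, State (reg s') (ram s') (pos s).+1)
    | Seq c1 c2 => (c1 :: c2 :: K, s)
    | If x c1 c2 => ((if r x != 0 then c1 else c2) :: K, s)
    | While x c1 => (if r x != 0 then c1 :: c :: K else K, s)
    end
  end.

(* Everything is initially 0, except register 0, which contains n. *)
Definition init (p : cmd) : config :=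
  ([:: p], State (upd (fun=> 0) 0 (n %% W)) (fun=> 0) 0).

Definition run (p : cmd) (T : nat) : config := iter T step (init p).

Definition halts_within (p : cmd) (T : nat) : bool := nilp (run p T).1.

(* A halted machine returns t = register 0, and the two sides listed in
   ram[0], ..., ram[t-1] and in ram[t], ..., ram[2t-1]. Below, #|A| = t forces
   the t listed words to be pairwise distinct vertices. *)
Definition out_size (cf : config) : nat := reg cf.2 0.

Definition listed (m : nat -> nat) (a t : nat) : {set 'I_n} :=
  [set v : 'I_n | (v : nat) \in [seq m i | i <- iota a t]].

Definition returns_biclique (cf : config) : bool :=
  let t := out_size cf in
  nilp cf.1 &&
  biclique G t (listed (ram cf.2) 0 t) (listed (ram cf.2) t t).

End Machine.

Local Open Scope classical_set_scope.
Local Open Scope ring_scope.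

Section Analysis.
Variable R : realType.

Definition lg (x : R) : R := ln x / ln 2.

Definition h2 (x : R) : R := - x * lg x - (1 - x) * lg (1 - x).

Definition density (n : nat) (G : sgraph n) : R :=
  #|edges G|%:R / 'C(n, 2)%:R.

(* f(n) = n^(a + o(1)) *)
Definition n_pow (a : R) (f : nat -> R) : Prop :=
  exists e : nat -> R, e @ \oo --> a /\
    \forall n \near \oo, f n = n%:R `^ e n.

(* Since 0^-1 = 0 here, the finiteness of 1/gamma and 1/(1-gamma) has to be
   asked for. *)
Definition density_condition (gamma : nat -> R) : Prop :=
  (\forall n \near \oo, 0 < gamma n < 1) /\
  n_pow 0 (fun n => Num.max (gamma n)^-1 (1 - gamma n)^-1).

Definition time_scale (gamma : nat -> R) (n : nat) : R :=
  n%:R * lg n%:R / h2 (gamma n).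

Definition biclique_scale (gamma : nat -> R) (n : nat) : R :=
  gamma n * lg n%:R / h2 (gamma n).

(* The machine halts with a biclique K_{t,t}, (1 - e) X <= t <= (1 + e) X. *)
Definition good_output (n : nat) (G : sgraph n) (X e : R) (cf : config) : bool :=
  returns_biclique G cf && (`|(out_size cf)%:R - X| <= e * X).

Definition tape_words (W T : nat) (w : T.-tuple 'I_W) : seq nat :=
  [seq nat_of_ord i | i <- w].

(* Probability of E over T independent uniform words; T of them are enough for
   T steps of a machine. *)
Definition Pr (W T : nat) (E : pred (seq nat)) : R :=
  #|[pred w : T.-tuple 'I_W | E (tape_words w)]|%:R / #|{: T.-tuple 'I_W}|%:R.

End Analysis.

(* Main.v *)
Require Import Defs.
From HB Require Import structures.
From mathcomp Require Import all_boot all_order all_algebra.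
From mathcomp Require Import all_classical all_reals all_analysis.
From mathcomp Require Import zify ring lra.
Set Implicit Arguments.
Unset Strict Implicit.
Unset Printing Implicit Defensive.
Import Order.TTheory GRing.Theory Num.Theory.
Import numFieldNormedType.Exports.

(** Fix l vertices, the rows, whose degrees add up to at least (t+1) n. By
    averaging, at least n/l of the vertices have t or more neighbours among the
    rows (many_good_columns); call these columns good. Scan the rows and keep a
    list of live columns, at first good columns only. A row is taken if it is
    adjacent to at least a fraction t/l of the live columns, and then its
    non-neighbours die; otherwise it is discarded and its neighbours die. A
    taken row leaves a fraction of at least t/l of the live columns and a
    discarded one more than 1 - t/l (greedy_invariant). While fewer than t rows
    are taken, every live column is adjacent to exactly the taken ones among
    the rows scanned so far; as a good column has t neighbours among the rows,
    the scan cannot end before t rows are taken (greedy_correct). So a fraction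
    of at least (t/l)^t (1-t/l)^(l-t) = 2^(-l h2(t/l)) of the good columns
    survives, and all of them are adjacent to the t taken rows. If t columns
    survive this is a biclique (returned_biclique); its sides are disjoint
    because adjacency is irreflexive.

    It remains to choose l and t, given an estimate al of the density gamma.
    Level m of a search proposes l = m^3 / (al (1-al)) and t = al l - m^2. Then
    t/l differs from al by about al (1-al) / m, which is small compared with al
    and with 1-al at the same time, and by Gibbs' inequality h2(t/l) is h2(al)
    up to a factor 1 + O(1/m); the error of al itself is at most of order
    n^(-1/4). On the other hand m^2 exceeds by far the fluctuations, of order
    m^(3/2), of the total degree of l random rows divided by n, so this
    quotient is usually at least t+1. The search takes the last level up to
    which an integer approximation from below of (n / l^4) 2^(-l h2(t/l)), the
    weight, has not become 0. Consecutive levels are so close that l = (1+o(1))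
    lg n / h2(gamma) and t = (1+o(1)) gamma lg n / h2(gamma) (search_estimate);
    this uses that 1/(gamma (1-gamma)) is n^(o(1)) (near_density), which also
    makes the level m tend to infinity (search_level).

    The deterministic program computes al = 2 |E| / n^2 from the degrees, uses
    as rows l vertices of degree at least (t+1) n / l, which exist thanks to
    the margin m^2 (dense_rows_exist), and all n vertices as columns. It runs
    for O(n l) steps, which is O(n lg n / h2(gamma)). The randomised program
    estimates al from n random pairs, draws l random rows, and draws a column
    at random from each of n/l blocks of l consecutive vertices. Since testing
    a column costs O(l), all of this takes O(n) steps on every tape. The
    polynomial factor l^4 in the weight pays for two factors l: only n/l
    columns are sampled, and possibly no more than a fraction of order 1/l of
    them is good. Chebyshev's inequality bounds the probability of a wrong
    density (bad_density), of rows with too small a total degree (bad_rows) and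
    of too few good columns (bad_columns); repeated rows are excluded by
    counting (bad_collisions).

    All estimates are proved for a fixed relative error e and all large n
    (near_accurate); diagonal_sequence then produces errors that tend to 0. *)

(** * Reasoning about machine programs *)

Definition is_atomic (c : cmd) : bool :=
  match c with Seq _ _ | If _ _ _ | While _ _ => false | _ => true end.

Fixpoint written (c : cmd) : seq nat :=
  match c with
  | Const x _ | Arith _ x _ _ | Read x _ | Adj x _ _ | Deg x _ | Rand x => [:: x]
  | Write _ _ => [::]
  | Seq c1 c2 | If _ c1 c2 => written c1 ++ written c2
  | While _ c1 => written c1
  end.

Fixpoint uses_write (c : cmd) : bool :=
  match c with
  | Write _ _ => true
  | Seq c1 c2 | If _ c1 c2 => uses_write c1 || uses_write c2
  | While _ c1 => uses_write c1
  | _ => false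
  end.

Definition put (s : state) (x v : nat) : state :=
  State (upd (reg s) x v) (ram s) (pos s).

Section Logic.
Variables (n : nat) (G : sgraph n) (W : nat) (tape : seq nat).
Local Notation stp := (step G W tape).

(** Big-step semantics with the exact number of steps of the machine, which
    does not depend on the rest of the stack (big_step_sound). *)
Inductive big_step : cmd -> state -> nat -> state -> Prop :=
| BigAtom c s : is_atomic c -> big_step c s 1 (stp ([:: c], s)).2
| BigSeq c1 c2 s k1 s1 k2 s2 :
    big_step c1 s k1 s1 -> big_step c2 s1 k2 s2 -> big_step (Seq c1 c2) s (k1 + k2).+1 s2
| BigIf x c1 c2 s k s' :
    big_step (if reg s x != 0 then c1 else c2) s k s' -> big_step (If x c1 c2) s k.+1 s'
| BigWhile0 x c s : reg s x = 0 -> big_step (While x c) s 1 s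
| BigWhileS x c s k1 s1 k2 s2 : reg s x != 0 ->
    big_step c s k1 s1 -> big_step (While x c) s1 k2 s2 ->
    big_step (While x c) s (k1 + k2).+1 s2.

Lemma big_step_sound c s k s' : big_step c s k s' ->
  forall K, iter k stp (c :: K, s) = (K, s').
Proof.
elim=> {c s k s'}.
- by move=> [] // *.
- move=> c1 c2 s k1 s1 k2 s2 _ IH1 _ IH2 K.
  by rewrite iterSr /= addnC iterD IH1 IH2.
- by move=> x c1 c2 s k s' _ IH K; rewrite iterSr /= IH.
- by move=> x c s x0 K; rewrite /= x0.
- move=> x c s k1 s1 k2 s2 x0 _ IH1 _ IH2 K.
  by rewrite iterSr /= x0 addnC iterD IH1 IH2.
Qed.

(** The states may differ arbitrarily outside the registers: what happens to
    the memory and to the tape is tracked separately. *)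
Definition same_but (xs : seq nat) (s s' : state) : Prop :=
  forall r, r \notin xs -> reg s' r = reg s r.

(** Registers that a command does not mention as targets keep their values, and
    likewise for the tape and the memory. Loop invariants can thus be
    restricted to what the loop changes. *)
Lemma big_step_frame c s k s' : big_step c s k s' ->
  [/\ same_but (written c) s s',
      ~~ uses_rand c -> pos s' = pos s &
      ~~ uses_write c -> ram s' = ram s].
Proof.
elim=> {c s k s'}.
- case=> //= *; split=> // r; rewrite /= /upd !inE /= => /negbTE-> //.
- move=> c1 c2 s k1 s1 k2 s2 _ [f1 p1 m1] _ [f2 p2 m2]; split=> /=.
  + by move=> r; rewrite mem_cat negb_or => /andP[r1 r2]; rewrite f2 // f1.
  + by rewrite negb_or => /andP[r1 r2]; rewrite p2 // p1.
  + by rewrite negb_or => /andP[r1 r2]; rewrite m2 // m1.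
- move=> x c1 c2 s k s' _ [f1 p1 m1]; split=> /=.
  + move=> r; rewrite mem_cat negb_or => /andP[r1 r2]; apply: f1.
    by case: ifP.
  + by rewrite negb_or => /andP[r1 r2]; apply: p1; case: ifP.
  + by rewrite negb_or => /andP[r1 r2]; apply: m1; case: ifP.
- by [].
- move=> x c s k1 s1 k2 s2 _ _ [f1 p1 m1] _ [f2 p2 m2]; split=> /=.
  + by move=> r rx; rewrite f2 // f1.
  + by move=> r; rewrite p2 // p1.
  + by move=> r; rewrite m2 // m1.
Qed.

(** Total correctness: the program stops within k steps in a state that
    satisfies Q. *)
Definition runs (c : cmd) (s : state) (k : nat) (Q : state -> Prop) : Prop :=
  exists s' k', [/\ k' <= k, big_step c s k' s' & Q s'].

Lemma runs_weaken c s k k' Q : runs c s k Q -> k <= k' -> runs c s k' Q.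
Proof. by move=> [s' [i [ik b q]]] kk; exists s', i; split=> //; lia. Qed.

Lemma runs_post c s k (Q Q' : state -> Prop) :
  runs c s k Q -> (forall s', Q s' -> Q' s') -> runs c s k Q'.
Proof. by move=> [s' [i [ik b q]]] qq; exists s', i; split=> //; exact: qq. Qed.

Lemma runs_frame c s k Q : runs c s k Q ->
  runs c s k (fun s' => [/\ Q s', same_but (written c) s s',
      ~~ uses_rand c -> pos s' = pos s & ~~ uses_write c -> ram s' = ram s]).
Proof.
move=> [s' [i [ik b q]]]; exists s', i; split=> //.
by have [? ? ?] := big_step_frame b.
Qed.

Lemma runs_seq c1 c2 s k1 k2 Q :
  runs c1 s k1 (fun s1 => runs c2 s1 k2 Q) -> runs (Seq c1 c2) s (k1 + k2).+1 Q.
Proof.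
move=> [s1 [i1 [ik1 b1 [s2 [i2 [ik2 b2 q]]]]]].
by exists s2, (i1 + i2).+1; split=> //; [lia|exact: BigSeq b1 b2].
Qed.

Lemma runs_if x c1 c2 s k1 k2 Q :
  (reg s x != 0 -> runs c1 s k1 Q) -> (reg s x = 0 -> runs c2 s k2 Q) ->
  runs (If x c1 c2) s (k1 + k2).+1 Q.
Proof.
move=> h1 h2; have [x0|x0] := eqVneq (reg s x) 0.
- have [s' [i [ik b q]]] := h2 x0; exists s', i.+1; split=> //; first by lia.
  by apply: BigIf; rewrite x0.
- have [s' [i [ik b q]]] := h1 x0; exists s', i.+1; split=> //; first by lia.
  by apply: BigIf; rewrite x0.
Qed.

Lemma runs_const x a s (Q : state -> Prop) :
  a < W -> Q (put s x a) -> runs (Const x a) s 1 Q.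
Proof.
move=> aW q; exists (put s x a), 1; split=> //.
have <- : (stp ([:: Const x a], s)).2 = put s x a by rewrite /= /set_reg modn_small.
exact: BigAtom.
Qed.

Lemma runs_arith v o x y z s (Q : state -> Prop) :
  arith_eval o (reg s y) (reg s z) = v -> v < W -> Q (put s x v) ->
  runs (Arith o x y z) s 1 Q.
Proof.
move=> ev vW q; exists (put s x v), 1; split=> //.
have <- : (stp ([:: Arith o x y z], s)).2 = put s x v by rewrite /= /set_reg ev modn_small.
exact: BigAtom.
Qed.

Lemma runs_read v x y s (Q : state -> Prop) :
  ram s (reg s y) = v -> v < W -> Q (put s x v) -> runs (Read x y) s 1 Q.
Proof.
move=> ev vW q; exists (put s x v), 1; split=> //.
have <- : (stp ([:: Read x y], s)).2 = put s x v by rewrite /= /set_reg ev modn_small.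
exact: BigAtom.
Qed.

Lemma runs_adj v x y z s (Q : state -> Prop) :
  adj_query G (reg s y) (reg s z) = v -> v < W -> Q (put s x v) ->
  runs (Adj x y z) s 1 Q.
Proof.
move=> ev vW q; exists (put s x v), 1; split=> //.
have <- : (stp ([:: Adj x y z], s)).2 = put s x v by rewrite /= /set_reg ev modn_small.
exact: BigAtom.
Qed.

Lemma runs_deg v x y s (Q : state -> Prop) :
  degree_query G (reg s y) = v -> v < W -> Q (put s x v) ->
  runs (Deg x y) s 1 Q.
Proof.
move=> ev vW q; exists (put s x v), 1; split=> //.
have <- : (stp ([:: Deg x y], s)).2 = put s x v by rewrite /= /set_reg ev modn_small.
exact: BigAtom.
Qed.

Lemma runs_rand v x s (Q : state -> Prop) :
  nth 0 tape (pos s) = v -> v < W ->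
  Q (State (upd (reg s) x v) (ram s) (pos s).+1) -> runs (Rand x) s 1 Q.
Proof.
move=> ev vW q; exists (State (upd (reg s) x v) (ram s) (pos s).+1), 1; split=> //.
have <- : (stp ([:: Rand x], s)).2 =
  State (upd (reg s) x v) (ram s) (pos s).+1 by rewrite /= /set_reg ev modn_small.
exact: BigAtom.
Qed.

Lemma runs_write a v x y s (Q : state -> Prop) :
  reg s x = a -> reg s y = v ->
  Q (State (reg s) (upd (ram s) a v) (pos s)) -> runs (Write x y) s 1 Q.
Proof.
move=> <- <- q; eexists _, 1; split; [by []|exact: BigAtom|exact: q].
Qed.

(** The first argument of the invariant bounds the number of iterations still
    to come. It need not be exact: the loop may stop early. *)
Lemma runs_while x c s r kb (I : nat -> state -> Prop) (Q : state -> Prop) :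
  I r s ->
  (forall r' s', I r' s' -> reg s' x = 0 -> Q s') ->
  (forall r' s', I r' s' -> reg s' x != 0 ->
     exists2 r1, r' = r1.+1 & runs c s' kb (I r1)) ->
  runs (While x c) s (r * kb.+1).+1 Q.
Proof.
move=> + h0 hS; elim: r s => [|r IH] s Is.
  have [x0|x0] := eqVneq (reg s x) 0.
    by exists s, 1; split=> //; [exact: BigWhile0|exact: h0 Is x0].
  by have [r1] := hS _ _ Is x0.
have [x0|x0] := eqVneq (reg s x) 0.
  by exists s, 1; split=> //; [exact: BigWhile0|exact: h0 Is x0].
have [r1 [<-] [s1 [k1 [kk1 b1 I1]]]] := hS _ _ Is x0.
have [s2 [k2 [kk2 b2 q]]] := IH _ I1.
exists s2, (k1 + k2).+1; split=> //; last exact: BigWhileS x0 b1 b2.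
lia.
Qed.

End Logic.

(** Register 1 must hold the constant 1. All loops share register 2 for their
    conditions; this is harmless for nested loops because the condition is
    recomputed at the end of each iteration. *)
Definition For (i bnd : nat) (body : cmd) : cmd :=
  Seq (Const i 0) (Seq (Arith OpLt 2 i bnd)
    (While 2 (Seq body (Seq (Arith OpAdd i i 1) (Arith OpLt 2 i bnd))))).

(** The effect of the bookkeeping of a loop between two iterations. Invariants
    of loops must be insensitive to it, for both values b of the condition. *)
Definition bump (s : state) (i v b : nat) : state :=
  State (upd (upd (reg s) i v) 2 b) (ram s) (pos s).

Section ForLoop.
Variables (n : nat) (G : sgraph n) (W : nat) (tape : seq nat).
Local Notation runs := (runs G W tape).

(** The body must preserve the counter, the bound and the constant 1; its
    obligation comes with the frame conditions relative to the initial state of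
    the whole loop. *)
Lemma runs_for i bnd body s N kb (I : nat -> state -> Prop) (Q : state -> Prop) :
  reg s bnd = N -> N < W -> 1 < W -> reg s 1 = 1 ->
  i \notin [:: 1; 2] -> bnd \notin [:: i; 2] ->
  [&& i \notin written body, 1 \notin written body & bnd \notin written body] ->
  (forall b, I 0 (bump s i 0 b)) ->
  (forall j s', j < N -> I j s' -> reg s' i = j -> reg s' 1 = 1 ->
     same_but (i :: 2 :: written body) s s' ->
     (~~ uses_rand body -> pos s' = pos s) ->
     (~~ uses_write body -> ram s' = ram s) ->
     runs body s' kb (fun s1 => forall b, I j.+1 (bump s1 i j.+1 b))) ->
  (forall s', I N s' ->
     same_but (i :: 2 :: written body) s s' ->
     (~~ uses_rand body -> pos s' = pos s) ->
     (~~ uses_write body -> ram s' = ram s) -> Q s') ->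
  runs (For i bnd body) s (N * (kb + 5) + 5) Q.
Proof.
move=> rb NW W1 r1 + + /and3P[ib ob bb] I0 IS IQ.
rewrite !inE => /norP[/negbTE i1 /negbTE i2] /norP[/negbTE bi /negbTE b2].
have bool_lt (b : bool) : b < W by case: b; lia.
pose J r s' := exists j, [/\ r = N - j, j <= N, I j s',
  [/\ reg s' i = j, reg s' 1 = 1, reg s' bnd = N & reg s' 2 = (j < N)] &
  [/\ same_but (i :: 2 :: written body) s s',
     ~~ uses_rand body -> pos s' = pos s & ~~ uses_write body -> ram s' = ram s]].
apply: (@runs_weaken _ _ _ _ _ _ (1 + (1 + (N * (kb + 4).+1).+1).+1).+1); last by lia.
apply: runs_seq; apply: runs_const; first by lia.
apply: runs_seq; apply: (@runs_arith _ _ _ _ (0 < N)) => //.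
  by rewrite /= /upd eqxx bi rb.
apply: (@runs_while _ _ _ _ _ _ _ _ _ J).
- exists 0; split=> //; first by rewrite subn0.
  + exact: I0.
  + by cbn [reg put ram pos]; rewrite /upd !eqxx i2 (eq_sym 1 i) i1 bi b2.
  + split=> // r; cbn [reg put]; rewrite !inE /upd => /norP[q1] /norP[q2 _].
    by rewrite (negbTE q1) (negbTE q2).
- move=> r s' [j [_ jN Ij [_ _ _ ->] [f p m]]] /eqP; rewrite eqb0 -leqNgt => Nj.
  by apply: IQ => //; rewrite (_ : N = j) //; lia.
- move=> r s' [j [-> jN Ij [ri r1' rb' ->] [f p m]]]; rewrite eqb0 negbK => ltjN.
  exists (N - j.+1); first by lia.
  apply: (@runs_weaken _ _ _ _ _ _ (kb + (1 + 1).+1).+1); last by lia.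
  apply: runs_seq.
  apply: runs_post (runs_frame (IS j s' ltjN Ij ri r1' f p m)) _ => s1 [I1 f1 p1 m1].
  apply: runs_seq; apply: (@runs_arith _ _ _ _ (j.+1)).
  + by rewrite /= f1 // f1 // ri r1' addn1.
  + by lia.
  + apply: (@runs_arith _ _ _ _ (j.+1 < N)) => //.
      by rewrite /= /upd eqxx bi f1 // rb'.
    exists j.+1; split=> //.
    * exact: I1.
    * by cbn [reg put ram pos]; rewrite /upd !eqxx i2 (eq_sym 1 i) i1 bi b2 /= !f1.
    * split=> //.
      - move=> r3 rn; have := rn; cbn [reg put]; rewrite !inE /upd.
        move=> /norP[q1] /norP[q2 q3].
        by rewrite (negbTE q1) (negbTE q2) f1 // f.
      - by move=> ur; rewrite /= p1 // p.
      - by move=> ur; rewrite /= m1 // m.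
Qed.

End ForLoop.

(** * The programs *)

(** Registers. 0: n, and finally t; 1: the constant 1; 2: loop conditions; 3
    and 4: numerator and denominator of the estimate of the density; 5: level
    of the search; 6 and 7: l and t; 8 and 9: loop counters; 10, 11 and 13: l,
    t and l - t at the level under examination; 12: its weight; 14, 15, 16 and
    28: scratch and addresses; 17: never written, hence 0, for use in copies;
    18: number of columns; 19: number of live columns; 20: number of rows
    selected or taken so far; 21: current row; 22: number of its live
    neighbours; 23: whether it is discarded; 24: write position of the filter;
    25: current column; 26: an adjacency; 27: number of neighbours of the
    current column among the rows; 29: 2n. Registers 18 and 19 also serve as
    scratch in the estimation of the density.

    Memory. The rows are stored from address n on and the columns from address
    2n on. The taken rows are written from address 0 on, at the place of the
    first side of the output. *)
Arguments upd _ _ _ _ /.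

Notation "c1 ;; c2" := (Seq c1 c2) (at level 90, right associativity).

Definition skip : cmd := Const 14 0.

(** Register 12 is multiplied by r/l once for each of the r iterations, where l
    is in register 10. *)
Definition scale (r : nat) : cmd :=
  For 9 r (Arith OpMul 12 12 r ;; Arith OpDiv 12 12 10).

(** With al = a/b, the level m proposes l = m^3 / (al (1-al)) and t = al l -
    m^2, rounded. The first quotients of register 12 already tell whether l^4
    is at most n; the loops are entered in this case only, so that they are
    short. A level of weight 0 leaves registers 6 and 7 as the previous level
    set them. *)
Definition search_body : cmd :=
  Arith OpMul 14 5 5 ;; Arith OpMul 15 14 5 ;;
  Arith OpMul 15 15 4 ;; Arith OpMul 15 15 4 ;;
  Arith OpSub 16 4 3 ;; Arith OpMul 16 3 16 ;;
  Arith OpDiv 10 15 16 ;;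
  Arith OpMul 11 10 3 ;; Arith OpDiv 11 11 4 ;; Arith OpSub 11 11 14 ;;
  Arith OpSub 13 10 11 ;;
  Arith OpDiv 12 0 10 ;; Arith OpDiv 12 12 10 ;;
  Arith OpDiv 12 12 10 ;; Arith OpDiv 12 12 10 ;;
  If 12 (scale 11 ;; scale 13) skip ;;
  If 12 (Arith OpAdd 6 10 17 ;; Arith OpAdd 7 11 17 ;; Arith OpAdd 5 5 1) skip.

Definition search : cmd := Const 5 2 ;; Const 12 1 ;; While 12 search_body.

Definition size_of (a b m : nat) : nat := (m * m * m * b * b) %/ (a * (b - a)).

Definition side_of (a b m : nat) : nat := size_of a b m * a %/ b - m * m.

(** An approximation from below of (n / l^4) 2^(-l h2(t/l)) by successive
    integer divisions. The factor l^4 pays for the restriction to good columns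
    and for the sampling of columns. *)
Definition weight (n l t : nat) : nat :=
  iter (l - t) (fun x => x * (l - t) %/ l)
    (iter t (fun x => x * t %/ l) (n %/ l %/ l %/ l %/ l)).

Definition feasible (n a b m : nat) : bool :=
  0 < weight n (size_of a b m) (side_of a b m).

Lemma iter_scale0 k r l : iter k (fun x => x * r %/ l) 0 = 0.
Proof. by elim: k => //= k ->; rewrite div0n. Qed.

Lemma iter_scale_le k r l x : r <= l -> iter k (fun x => x * r %/ l) x <= x.
Proof.
move=> rl; elim: k => //= k IH; have [->|l0] := posnP l; first by rewrite divn0.
apply: leq_trans IH; rewrite -[leqRHS](mulnK _ l0).
by apply: leq_div2r; apply: leq_mul.
Qed.

Lemma size_of_ge a b m : 0 < size_of a b m -> m <= size_of a b m.
Proof.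
rewrite /size_of; have [->|d0] := posnP (a * (b - a)); first by rewrite divn0.
move=> _; rewrite leq_divRL //.
case: m => [|m]; first by rewrite mul0n.
have -> : m.+1 * m.+1 * m.+1 * b * b = m.+1 * (m.+1 * m.+1 * (b * b)) by lia.
rewrite leq_mul2l /=.
by apply: (@leq_trans (b * b)); [apply: leq_mul; lia|exact: leq_pmull].
Qed.

(** The weight starts from n / l^4 and never increases. *)
Lemma feasible_size n a b m : feasible n a b m ->
  0 < size_of a b m /\ size_of a b m ^ 4 <= n.
Proof.
rewrite /feasible /weight -!divnMA; set l := size_of a b m; set x := n %/ _.
case: (posnP x) => [->|x0]; first by rewrite !iter_scale0.
move=> _; have l0 : 0 < l by move: x0; rewrite /x; case: (l) => //; rewrite !muln0 divn0.
split=> //; move: x0; rewrite /x divn_gt0 ?muln_gt0 ?l0 //.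
Qed.

(** The two lowest digits in base n of a uniform word of n^10 values are
    independent and uniform, so one word provides a uniform pair of vertices.
    The pair may be degenerate; it then counts as non-adjacent. *)
Definition sampled_density : cmd :=
  Arith OpAdd 4 0 17 ;; Const 3 0 ;;
  For 8 0 (Rand 14 ;; Arith OpDiv 15 14 0 ;;
    Arith OpMul 16 15 0 ;; Arith OpSub 16 14 16 ;;
    Arith OpDiv 18 15 0 ;; Arith OpMul 18 18 0 ;; Arith OpSub 18 15 18 ;;
    Adj 19 16 18 ;; Arith OpAdd 3 3 19).

Definition exact_density : cmd :=
  Arith OpMul 4 0 0 ;; Const 3 0 ;; For 8 0 (Deg 14 8 ;; Arith OpAdd 3 3 14).

(** The rows may collide; this is a bad event that is unlikely because l^2 is
    small compared with n. *)
Definition random_rows : cmd :=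
  For 8 6 (Rand 14 ;; Arith OpDiv 15 14 0 ;; Arith OpMul 15 15 0 ;;
    Arith OpSub 15 14 15 ;; Arith OpAdd 28 0 8 ;; Write 28 15).

(** All vertices of degree at least (t+1) n / l are stored; only the first l of
    them will be used. *)
Definition dense_rows : cmd :=
  Arith OpAdd 14 7 1 ;; Arith OpMul 14 14 0 ;; Const 20 0 ;;
  For 8 0 (Deg 15 8 ;; Arith OpMul 15 15 6 ;; Arith OpLt 15 15 14 ;;
    If 15 (Const 16 0)
      (Arith OpAdd 28 0 20 ;; Write 28 8 ;; Arith OpAdd 20 20 1)).

(** One random vertex in each block of l consecutive vertices: the columns are
    then automatically distinct. *)
Definition random_columns : cmd :=
  Arith OpDiv 18 0 6 ;;
  For 9 18 (Rand 14 ;; Arith OpDiv 15 14 6 ;; Arith OpMul 15 15 6 ;;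
    Arith OpSub 15 14 15 ;; Arith OpMul 16 9 6 ;; Arith OpAdd 15 15 16 ;;
    Arith OpAdd 28 29 9 ;; Write 28 15).

Definition all_columns : cmd :=
  Arith OpAdd 18 0 17 ;; For 9 18 (Arith OpAdd 28 29 9 ;; Write 28 9).

(** Only the columns with at least t neighbours among the rows are kept. The
    filter works in place, which is safe because the write position never
    overtakes the read position. *)
Definition prefilter : cmd :=
  Const 19 0 ;;
  For 9 18 (Arith OpAdd 28 29 9 ;; Read 25 28 ;; Const 27 0 ;;
    For 8 6 (Arith OpAdd 28 0 8 ;; Read 21 28 ;; Adj 26 21 25 ;;
      Arith OpAdd 27 27 26) ;;
    Arith OpLt 14 27 7 ;;
    If 14 skip (Arith OpAdd 28 29 19 ;; Write 28 25 ;; Arith OpAdd 19 19 1)).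

(** A column stays alive if its adjacency with the row differs from the reject
    flag in register 23. The test of this is written |x - y| = (x - y) + (y -
    x) with truncated subtractions. *)
Definition greedy_body : cmd :=
  Arith OpAdd 28 0 8 ;; Read 21 28 ;; Const 22 0 ;;
  For 9 19 (Arith OpAdd 28 29 9 ;; Read 25 28 ;; Adj 26 21 25 ;;
    Arith OpAdd 22 22 26) ;;
  Arith OpMul 14 22 6 ;; Arith OpMul 15 19 7 ;; Arith OpLt 23 14 15 ;;
  If 23 skip (Write 20 21 ;; Arith OpAdd 20 20 1) ;;
  Const 24 0 ;;
  For 9 19 (Arith OpAdd 28 29 9 ;; Read 25 28 ;; Adj 26 21 25 ;;
    Arith OpSub 14 26 23 ;; Arith OpSub 15 23 26 ;; Arith OpAdd 14 14 15 ;;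
    If 14 (Arith OpAdd 28 29 24 ;; Write 28 25 ;; Arith OpAdd 24 24 1) skip) ;;
  Arith OpAdd 19 24 17.

Definition greedy : cmd :=
  Const 20 0 ;;
  For 8 6 (Arith OpLt 14 20 7 ;; If 14 greedy_body skip).

Definition output : cmd :=
  For 9 7 (Arith OpAdd 28 29 9 ;; Read 25 28 ;; Arith OpAdd 28 7 9 ;;
    Write 28 25) ;;
  Arith OpAdd 0 7 17.

Definition prologue : cmd := Const 1 1 ;; Arith OpAdd 29 0 0.

Definition extraction : cmd := prefilter ;; greedy ;; output.

Definition randomized_program : cmd :=
  prologue ;; sampled_density ;; search ;; random_rows ;; random_columns ;; extraction.

Definition deterministic_program : cmd :=
  prologue ;; exact_density ;; search ;; dense_rows ;; all_columns ;; extraction.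

(** * Results and running times of the programs *)

Definition words (tape : seq nat) (p k : nat) : seq nat :=
  mkseq (fun i => nth 0 tape (p + i)) k.

Lemma wordsS tape p k : words tape p k.+1 = rcons (words tape p k) (nth 0 tape (p + k)).
Proof. by rewrite /words /mkseq -addn1 iotaD map_cat cats1. Qed.

Lemma iota0S j : iota 0 j.+1 = rcons (iota 0 j) j.
Proof. by rewrite -addn1 iotaD cats1. Qed.

Definition stored (f : nat -> nat) (base : nat) (L : seq nat) : Prop :=
  forall i, i < size L -> f (base + i) = nth 0 L i.

Lemma stored0 f base : stored f base [::].
Proof. by []. Qed.

Lemma stored_rcons f base L v : stored f base L ->
  stored (upd f (base + size L) v) base (rcons L v).
Proof.
move=> fL i; rewrite size_rcons ltnS leq_eqVlt => /orP[/eqP->|iL].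
  by rewrite nth_rcons ltnn eqxx /= eqxx.
by rewrite nth_rcons iL /= eqn_add2l ltn_eqF // fL.
Qed.

(** The state of an in-place filter after j elements: the kept elements come
    first, the unread ones are still in place, and what lies below the list is
    untouched. *)
Definition filtering (P : pred nat) (f0 : nat -> nat) (base : nat) (L : seq nat)
    (j : nat) (f : nat -> nat) : Prop :=
  [/\ stored f base (seq.filter P (take j L)),
   forall i, j <= i < size L -> f (base + i) = nth 0 L i &
   forall x, x < base -> f x = f0 x].

Lemma filtering_start (P : pred nat) f base L : stored f base L -> filtering P f base L 0 f.
Proof. by move=> st; rewrite /filtering take0; split. Qed.

Lemma size_filter_take (P : pred nat) L j : size (seq.filter P (take j L)) <= j.
Proof.
by rewrite size_filter (leq_trans (count_size _ _)) // size_take geq_minl.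
Qed.

Lemma filtering_keep (P : pred nat) f0 base L j f : j < size L -> P (nth 0 L j) ->
  filtering P f0 base L j f ->
  filtering P f0 base L j.+1
    (upd f (base + size (seq.filter P (take j L))) (nth 0 L j)).
Proof.
move=> jL Pj [st rest low]; split.
- by rewrite (take_nth 0) // filter_rcons Pj; apply: stored_rcons.
- move=> i /andP[ji iL] /=; rewrite eqn_add2l gtn_eqF ?rest ?iL ?(ltnW ji) //.
  by apply: leq_trans ji; rewrite ltnS size_filter_take.
- by move=> x xb /=; rewrite ltn_eqF ?low // (leq_trans xb) ?leq_addr.
Qed.

Lemma filtering_drop (P : pred nat) f0 base L j f : j < size L -> ~~ P (nth 0 L j) ->
  filtering P f0 base L j f -> filtering P f0 base L j.+1 f.
Proof.
move=> jL /negbTE Pj [st rest low]; split=> //.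
- by rewrite (take_nth 0) // filter_rcons Pj.
- by move=> i /andP[ji iL]; apply: rest; rewrite iL ltnW.
Qed.

Section Specs.
Variables (n : nat) (G : sgraph n) (W : nat) (tape : seq nat).
Hypothesis n2 : 2 <= n.
Hypothesis nW : n ^ 9 < W.
Local Notation runs := (runs G W tape).

(** No overflow: apart from random words and their quotients and remainders,
    all numbers that the programs handle are at most n^9. *)
Lemma word_lt x i : x <= n ^ i -> i <= 9 -> x < W.
Proof.
move=> xn i9; apply: leq_ltn_trans nW; apply: leq_trans xn _.
by rewrite leq_pexp2l //; lia.
Qed.

Lemma word_lt1 x : x <= n -> x < W.
Proof. by move=> xn; apply: (@word_lt _ 1); rewrite ?expn1. Qed.

Lemma word_lt2 x : x <= n * n -> x < W.
Proof. by move=> xn; apply: (@word_lt _ 2); rewrite ?expnS ?expn0 ?muln1. Qed.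

Lemma word_ltb (b : bool) : b < W.
Proof. by apply: word_lt1; case: b; lia. Qed.

Lemma runs_scale r s l c x (Q : state -> Prop) :
  r \in [:: 11; 13] -> reg s r = c -> reg s 1 = 1 -> reg s 10 = l ->
  reg s 12 = x -> c <= l -> l <= n -> x <= n ->
  (forall s', same_but [:: 9; 2; 12; 12] s s' ->
     reg s' 12 = iter c (fun x => x * c %/ l) x -> Q s') ->
  runs (scale r) s (c * 8 + 5) Q.
Proof.
move=> rr rc r1 rl rx cl ln xn HQ.
have W1 : 1 < W by apply: word_lt1; lia.
pose X k := iter k (fun x => x * c %/ l) x.
have Xn k : X k <= n by apply: leq_trans xn; apply: iter_scale_le.
move: rr; rewrite !inE => /orP[] /eqP Er; subst r.
all: eapply runs_weaken; [eapply (@runs_for _ _ _ _ 9 _ _ s c 3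
   (fun j s' => reg s' 12 = X j)) => // |by lia].
all: try by apply: word_lt1; lia.
all: try by move=> s' I9 fr _ _; apply: HQ => //.
all: move=> j s' jc I9 _ _ fr _ _.
all: eapply runs_weaken; [eapply runs_seq|].
all: try (eapply (@runs_arith _ _ _ _ (X j * c)); 
  [by rewrite /= I9 fr // rc|by apply: word_lt2; apply: leq_mul => //; lia|]).
all: try (eapply (@runs_arith _ _ _ _ (X j.+1)); 
  [by rewrite /= fr // rl|exact: (word_lt1 (Xn _))|by move=> b]).
all: by [].
Qed.

Lemma runs_search_body s a b m q : reg s 0 = n -> reg s 1 = 1 -> reg s 17 = 0 ->
  reg s 3 = a -> reg s 4 = b -> reg s 5 = m -> a <= b -> b <= n * n -> m <= n ->
  q * q <= n -> (forall l, l ^ 4 <= n -> l <= q) ->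
  runs search_body s (8 * q + 60) (fun s' =>
    [/\ reg s' 12 = weight n (size_of a b m) (side_of a b m),
     feasible n a b m -> [/\ reg s' 5 = m.+1, reg s' 6 = size_of a b m
       & reg s' 7 = side_of a b m] &
     ~~ feasible n a b m -> [/\ reg s' 5 = m, reg s' 6 = reg s 6
       & reg s' 7 = reg s 7]]).
Proof.
move=> r0 r1 r17 r3 r4 r5 ab bn mn qn lq.
have W1 : 1 < W by apply: word_lt1; lia.
have bn2 : b <= n ^ 2 by rewrite expnS expn1.
have m3 : m * m * m <= n ^ 3 by rewrite !expnS expn0 muln1 -mulnA !leq_mul.
have m4 : m * m * m * b <= n ^ 5 by rewrite (expnD n 3 2) leq_mul.
have m5 : m * m * m * b * b <= n ^ 7 by rewrite (expnD n 5 2) leq_mul.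
set l := size_of a b m; set t := side_of a b m.
have ln7 : l <= n ^ 7 by apply: leq_trans m5; apply: leq_div.
have la : l * a <= n ^ 9 by rewrite (expnD n 7 2) leq_mul //; lia.
have tl : t <= l.
  rewrite /t /side_of -/l; apply: leq_trans (leq_subr _ _) _.
  have [->|b0] := posnP b; first by rewrite divn0.
  by rewrite -[leqRHS](mulnK _ b0) leq_div2r // leq_mul.
rewrite /search_body.
eapply runs_weaken.
  eapply runs_seq; eapply (@runs_arith _ _ _ _ (m * m)).
    by rewrite /= r5.
    by apply: word_lt2; apply: leq_mul.
  eapply runs_seq; eapply (@runs_arith _ _ _ _ (m * m * m)).
    by rewrite /= r5.
    exact: word_lt m3 _.
  eapply runs_seq; eapply (@runs_arith _ _ _ _ (m * m * m * b)).
    by rewrite /= r4.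
    exact: word_lt m4 _.
  eapply runs_seq; eapply (@runs_arith _ _ _ _ (m * m * m * b * b)).
    by rewrite /= r4.
    exact: word_lt m5 _.
  eapply runs_seq; eapply (@runs_arith _ _ _ _ (b - a)).
    by rewrite /= r4 r3.
    by apply: word_lt2; lia.
  eapply runs_seq; eapply (@runs_arith _ _ _ _ (a * (b - a))).
    by rewrite /= r3.
    by apply: (@word_lt _ 4) => //; rewrite (expnD n 2 2) leq_mul //; lia.
  eapply runs_seq; eapply (@runs_arith _ _ _ _ l).
    by [].
    exact: word_lt ln7 _.
  eapply runs_seq; eapply (@runs_arith _ _ _ _ (l * a)).
    by rewrite /= r3.
    exact: word_lt la _.
  eapply runs_seq; eapply (@runs_arith _ _ _ _ (l * a %/ b)).
    by rewrite /= r4.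
    by apply: word_lt (leq_trans (leq_div _ _) la) _.
  eapply runs_seq; eapply (@runs_arith _ _ _ _ t).
    by [].
    by apply: word_lt (leq_trans tl ln7) _.
  eapply runs_seq; eapply (@runs_arith _ _ _ _ (l - t)).
    by [].
    by apply: word_lt (leq_trans (leq_subr _ _) ln7) _.
  eapply runs_seq; eapply (@runs_arith _ _ _ _ (n %/ l)).
    by rewrite /= r0.
    by apply: word_lt1; apply: leq_div.
  eapply runs_seq; eapply (@runs_arith _ _ _ _ (n %/ l %/ l)).
    by [].
    by rewrite -divnMA; apply: word_lt1; apply: leq_div.
  eapply runs_seq; eapply (@runs_arith _ _ _ _ (n %/ l %/ l %/ l)).
    by [].
    by rewrite -!divnMA; apply: word_lt1; apply: leq_div.
  eapply runs_seq; eapply (@runs_arith _ _ _ _ (n %/ l %/ l %/ l %/ l)).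
    by [].
    by rewrite -!divnMA; apply: word_lt1; apply: leq_div.
  set s1 := put _ 12 _.
  eapply runs_seq; eapply (@runs_post _ _ _ _ _ _ _ (fun s2 =>
     same_but [:: 9; 2; 12; 14] s1 s2 /\ reg s2 12 = weight n l t)).
    have x1 : reg s1 12 = n %/ l %/ l %/ l %/ l by [].
    eapply runs_if with (k1 := 8 * q + 11) (k2 := 1) => x0; last first.
      apply: runs_const; first by lia.
      split; first by move=> r; rewrite !inE => /norP[_ /norP[_ /norP[_ /negbTE re]]];
        rewrite /= /upd re.
      rewrite /= /upd [RHS]/weight -x1 x0.
      by rewrite !iter_scale0.
    have l4 : l ^ 4 <= n.
      move: x0; rewrite x1 -!divnMA -lt0n; case: (posnP l) => [->|l0].
        by rewrite !muln0 divn0.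
      by rewrite divn_gt0 ?muln_gt0 ?l0 // !expnS expn0 muln1 !mulnA.
    have lq1 := lq _ l4.
    have ln : l <= n.
      apply: leq_trans l4; case: (posnP l) => [-> //|l0].
      by rewrite -{1}(expn1 l) leq_pexp2l.
    eapply runs_weaken.
      eapply runs_seq; eapply (@runs_scale 11 _ l t (n %/ l %/ l %/ l %/ l)) => //.
        by rewrite -!divnMA leq_div.
      move=> s2 f2 v2; eapply (@runs_scale 13 _ l (l - t)).
      1: by [].
      1: by rewrite f2.
      1: by rewrite f2.
      1: by rewrite f2.
      1: exact: v2.
      1: exact: leq_subr.
      1: by [].
      1: by apply: leq_trans (iter_scale_le _ _ tl) _; rewrite -!divnMA leq_div.
      move=> s3 f3 v3; split; last by rewrite v3.
      move=> r; rewrite !inE !negb_or => /and4P[h1 h2 h3 h4].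
      by rewrite f3 ?f2 // !inE !negb_or h1 h2 h3.
    by move: lq1 tl; clear; lia.
  move=> s2 [f2 v2].
  eapply runs_if => x0; last first.
    apply: runs_const; first by lia.
    have nf : feasible n a b m = false by rewrite /feasible -/l -/t -v2 x0.
    split; rewrite ?nf //.
    by rewrite /= /upd /= !f2.
  have ff : feasible n a b m = true by rewrite /feasible -/l -/t -v2 lt0n.
  eapply runs_seq; eapply (@runs_arith _ _ _ _ l).
    by rewrite /= !f2 //= /s1 /= /upd /= r17 addn0.
    by apply: word_lt ln7 _.
  eapply runs_seq; eapply (@runs_arith _ _ _ _ t).
    by rewrite /= /upd /= !f2 //= /s1 /= /upd /= r17 addn0.
    by apply: word_lt (leq_trans tl ln7) _.
  eapply (@runs_arith _ _ _ _ m.+1).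
    by rewrite /= /upd /= !f2 //= /s1 /= /upd /= r5 r1 addn1.
    by apply: (@word_lt _ 2) => //; rewrite expnS expn1; nia.
  by split; rewrite ?ff.
by lia.
Qed.

(** The search starts at level 2. The value m = 1 encodes that already this
    level fails, in which case registers 6 and 7 still hold 0. *)
Definition found (a b m l t : nat) : Prop :=
  [/\ 0 < m, forall i, 2 <= i <= m -> feasible n a b i, ~~ feasible n a b m.+1 &
   if m == 1 then l = 0 /\ t = 0 else l = size_of a b m /\ t = side_of a b m].

(** An integer square root of n bounds both l and the number of levels, since a
    feasible level has l^4 <= n and m <= l. *)
Lemma sqrt_bound : exists2 q, q * q <= n & forall l, l ^ 4 <= n -> l <= q.
Proof.
have ex : exists q, q * q <= n by exists 0.
have ub q : q * q <= n -> q <= n.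
  by case: q => // q h; apply: leq_trans h; rewrite leq_pmulr.
exists (ex_maxn ex ub); case: ex_maxnP => q hq qmax // l l4.
case: l l4 => // l l4; apply: qmax; apply: leq_trans l4.
by rewrite mulnn leq_pexp2l.
Qed.

(** There are at most sqrt n levels, and each costs O(sqrt n) steps, hence the
    linear bound. *)
Lemma runs_search s a b : reg s 0 = n -> reg s 1 = 1 -> reg s 17 = 0 ->
  reg s 3 = a -> reg s 4 = b -> reg s 6 = 0 -> reg s 7 = 0 ->
  a <= b -> b <= n * n ->
  runs search s (150 * n)
    (fun s' => exists m, found a b m (reg s' 6) (reg s' 7)).
Proof.
move=> r0 r1 r17 r3 r4 r6 r7 ab bn.
have W1 : 2 < W by apply: (@word_lt _ 2) => //; rewrite expnS expn1; nia.
have [q qn lq] := sqrt_bound.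
have q1 : 0 < q by apply: (lq 1); lia.
have qn1 : q < n by case: q q1 qn {lq} => // -[|q] // _; clear -n2; nia.
eapply runs_weaken.
  eapply runs_seq; eapply runs_const; first by [].
  eapply runs_seq; eapply runs_const; first by clear -W1; lia.
  eapply (@runs_while _ _ _ _ 12 _ _ q (8 * q + 60) (fun r s' => exists m,
    [/\ r = q.+1 - m \/ reg s' 12 = 0,
     [/\ reg s' 0 = n, reg s' 1 = 1, reg s' 17 = 0, reg s' 3 = a & reg s' 4 = b],
     [/\ 0 < m, forall i, 2 <= i <= m -> feasible n a b i,
       m <= q & reg s' 5 = m.+1],
     reg s' 12 = 0 -> ~~ feasible n a b m.+1 &
     if m == 1 then reg s' 6 = 0 /\ reg s' 7 = 0
     else reg s' 6 = size_of a b m /\ reg s' 7 = side_of a b m])).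
  - exists 1; split=> //; first by left; rewrite subn1.
    by split=> // i /andP[i2 i1]; have := leq_trans i2 i1.
  - move=> r' s' [m [_ _ [m0 fm mq _] nf lt]] x0; exists m; split=> //; exact: nf.
  - move=> r' s' [m [rm [s0 s1 s17 s3 s4] [m0 fm mq s5] nf lt]] x0.
    case: rm => [rm|x1]; last by rewrite x1 in x0.
    exists (q - m); first by rewrite rm subSn.
    have mn : m.+1 <= n by apply: leq_ltn_trans mq qn1.
    have := runs_search_body s0 s1 s17 s3 s4 s5 ab bn mn qn lq.
    move=> /runs_frame h; apply: runs_post h _ => s2 [[v2 ff nff] fr _ _].
    case: (boolP (feasible n a b m.+1)) => fm1.
      have [e5 e6 e7] := ff fm1; have [l0 l4] := feasible_size fm1.
      exists m.+1; split; first by left; rewrite subSS.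
      + by rewrite !fr.
      + split=> //.
        * move=> i /andP[i2]; rewrite leq_eqVlt => /orP[/eqP->//|im].
          by apply: fm; rewrite i2 -ltnS.
        * by apply: leq_trans (size_of_ge l0) _; apply: lq.
      + by move=> x2; move: fm1; rewrite /feasible -v2 x2.
      + by rewrite eqSS gtn_eqF.
    have [e5 e6 e7] := nff fm1.
    exists m; split=> //.
    + by right; rewrite v2; apply/eqP; rewrite -leqn0 leqNgt.
    + by rewrite !fr.
    + by rewrite e6 e7.
by move: qn q1 qn1; clear; nia.
Qed.

Hypothesis tW : forall i, nth 0 tape i < W.

Definition pair_adj (w : nat) : nat := adj_query G (w %% n) (w %/ n %% n).

Lemma adj_query_le1 u v : adj_query G u v <= 1.
Proof. by rewrite /adj_query; case: insub => // ?; case: insub => // ?; case: adj. Qed.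

Lemma sub_mod x d : x - x %/ d * d = x %% d.
Proof. by rewrite {1}(divn_eq x d) addnC addnK. Qed.

Lemma sumn_le1 (f : nat -> nat) L : (forall w, f w <= 1) -> sumn (map f L) <= size L.
Proof. by move=> f1; elim: L => //= w L IH; rewrite -add1n leq_add. Qed.

Lemma size_words p k : size (words tape p k) = k.
Proof. by rewrite size_mkseq. Qed.

Lemma runs_sampled_density s :
  reg s 0 = n -> reg s 1 = 1 -> reg s 17 = 0 ->
  runs sampled_density s (30 * n) (fun s' =>
    [/\ reg s' 3 = sumn (map pair_adj (words tape (pos s) n)),
     reg s' 4 = n & pos s' = pos s + n]).
Proof.
move=> r0 r1 r17; rewrite /sampled_density.
have W1 : 1 < W by apply: word_lt1; lia.
eapply runs_weaken.
  eapply runs_seq; eapply (@runs_arith _ _ _ _ n).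
    by rewrite /= r0 r17 addn0.
    by apply: word_lt1.
  eapply runs_seq; eapply runs_const; first by clear -W1; lia.
  eapply (@runs_for _ _ _ _ 8 _ _ _ n 17 (fun j s' =>
    reg s' 3 = sumn (map pair_adj (words tape (pos s) j)) /\
    pos s' = pos s + j)) => //.
  - by apply: word_lt1.
  - by move=> b; rewrite /= addn0.
  - move=> j s' jn [s3 ps] _ _ fr _ _.
    have s0 : reg s' 0 = n by rewrite fr //= r0.
    set w := nth 0 tape (pos s + j).
    have a1 := adj_query_le1 (w %% n) (w %/ n %% n).
    eapply runs_weaken.
      eapply runs_seq; eapply (@runs_rand _ _ _ _ w); [by rewrite ps|exact: tW|].
      eapply runs_seq; eapply (@runs_arith _ _ _ _ (w %/ n)).
        by rewrite /= s0.
        by apply: leq_ltn_trans (tW _); apply: leq_div.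
      eapply runs_seq; eapply (@runs_arith _ _ _ _ (w %/ n * n)).
        by rewrite /= s0.
        by apply: leq_ltn_trans (tW _); apply: leq_trunc_div.
      eapply runs_seq; eapply (@runs_arith _ _ _ _ (w %% n)).
        by rewrite /= sub_mod.
        by apply: leq_ltn_trans (tW _); apply: leq_mod.
      eapply runs_seq; eapply (@runs_arith _ _ _ _ (w %/ n %/ n)).
        by rewrite /= s0.
        by rewrite -divnMA; apply: leq_ltn_trans (tW _); apply: leq_div.
      eapply runs_seq; eapply (@runs_arith _ _ _ _ (w %/ n %/ n * n)).
        by rewrite /= s0.
        apply: leq_ltn_trans (tW _); apply: leq_trans (leq_trunc_div _ _) _.
        exact: leq_div.
      eapply runs_seq; eapply (@runs_arith _ _ _ _ (w %/ n %% n)).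
        by rewrite /= sub_mod.
        apply: leq_ltn_trans (tW _); apply: leq_trans (leq_mod _ _) _.
        exact: leq_div.
      eapply runs_seq; eapply (@runs_adj _ _ _ _ (pair_adj w)).
        by [].
        exact: leq_ltn_trans a1 W1.
      eapply (@runs_arith _ _ _ _ (sumn (map pair_adj (words tape (pos s) j.+1)))).
        by rewrite wordsS map_rcons sumn_rcons /= s3.
        apply: word_lt1; apply: leq_trans (sumn_le1 _ _) _.
          by move=> ?; apply: adj_query_le1.
        by rewrite size_words.
      by split=> //=; rewrite ps addnS.
    by [].
  - by move=> s' [s3 ps] fr _ _; split=> //; rewrite fr //= r0.
by clear -n2; lia.
Qed.

Lemma degree_query_le u : degree_query G u <= n.
Proof.
rewrite /degree_query; case: insub => // v.
by rewrite /degree (leq_trans (max_card _)) // card_ord.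
Qed.

Definition degree_sum : nat := sumn (map (degree_query G) (iota 0 n)).

Lemma sumn_le (f : nat -> nat) L c :
  (forall w, f w <= c) -> sumn (map f L) <= size L * c.
Proof. by move=> f1; elim: L => //= w L IH; rewrite mulSn leq_add. Qed.

Lemma runs_exact_density s :
  reg s 0 = n -> reg s 1 = 1 -> reg s 17 = 0 ->
  runs exact_density s (30 * n) (fun s' => reg s' 3 = degree_sum /\ reg s' 4 = n * n).
Proof.
move=> r0 r1 r17; rewrite /exact_density.
have W1 : 1 < W by apply: word_lt1; lia.
eapply runs_weaken.
  eapply runs_seq; eapply (@runs_arith _ _ _ _ (n * n)).
    by rewrite /= r0.
    by apply: word_lt2.
  eapply runs_seq; eapply runs_const; first by clear -W1; lia.
  eapply (@runs_for _ _ _ _ 8 _ _ _ n 3 (fun j s' =>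
    reg s' 3 = sumn (map (degree_query G) (iota 0 j)))) => //.
  - by apply: word_lt1.
  - move=> j s' jn s3 s8 _ fr _ _.
    eapply runs_weaken.
      eapply runs_seq; eapply (@runs_deg _ _ _ _ (degree_query G j)).
        by rewrite s8.
        by apply: word_lt1; apply: degree_query_le.
      eapply (@runs_arith _ _ _ _ (sumn (map (degree_query G) (iota 0 j.+1)))).
        by rewrite iota0S map_rcons sumn_rcons /= s3.
        apply: word_lt2; apply: leq_trans (sumn_le _ degree_query_le) _.
        by rewrite size_iota leq_mul.
      by [].
    by [].
  - by move=> s' s3 fr _ _; split=> //; rewrite fr //= r0.
by clear -n2; lia.
Qed.

Lemma runs_random_rows s l : reg s 0 = n -> reg s 1 = 1 -> reg s 6 = l -> l <= n ->
  runs random_rows s (30 * n) (fun s' =>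
    stored (ram s') n [seq w %% n | w <- words tape (pos s) l] /\
    pos s' = pos s + l).
Proof.
move=> r0 r1 r6 ln; rewrite /random_rows.
have W1 : 1 < W by apply: word_lt1; lia.
eapply runs_weaken.
  eapply (@runs_for _ _ _ _ 8 _ _ _ l 11 (fun j s' =>
    stored (ram s') n [seq w %% n | w <- words tape (pos s) j] /\
    pos s' = pos s + j)) => //.
  - by apply: word_lt1.
  - by move=> b; rewrite /= addn0; split=> //; apply: stored0.
  - move=> j s' jl [st ps] s8 _ fr _ _.
    have s0 : reg s' 0 = n by rewrite fr //= r0.
    set w := nth 0 tape (pos s + j).
    eapply runs_weaken.
      eapply runs_seq; eapply (@runs_rand _ _ _ _ w); [by rewrite ps|exact: tW|].
      eapply runs_seq; eapply (@runs_arith _ _ _ _ (w %/ n)).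
        by rewrite /= s0.
        by apply: leq_ltn_trans (tW _); apply: leq_div.
      eapply runs_seq; eapply (@runs_arith _ _ _ _ (w %/ n * n)).
        by rewrite /= s0.
        by apply: leq_ltn_trans (tW _); apply: leq_trunc_div.
      eapply runs_seq; eapply (@runs_arith _ _ _ _ (w %% n)).
        by rewrite /= sub_mod.
        by apply: leq_ltn_trans (tW _); apply: leq_mod.
      eapply runs_seq; eapply (@runs_arith _ _ _ _ (n + j)).
        by rewrite /= s0 s8.
        by apply: word_lt2; clear -n2 jl ln; nia.
      eapply (@runs_write _ _ _ _ (n + j) (w %% n)) => //.
      move=> b; split; last by rewrite /= ps addnS.
      rewrite wordsS map_rcons.
      have -> : n + j = n + size [seq w0 %% n | w0 <- words tape (pos s) j].
        by rewrite size_map size_words.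
      exact: stored_rcons.
    by [].

by move: ln; clear -n2; lia.
Qed.

Definition is_dense (l t v : nat) : bool := t.+1 * n <= degree_query G v * l.

Lemma runs_dense_rows s l t : reg s 0 = n -> reg s 1 = 1 -> reg s 6 = l ->
  reg s 7 = t -> l <= n -> t < n ->
  runs dense_rows s (40 * n) (fun s' =>
    stored (ram s') n [seq v <- iota 0 n | is_dense l t v]).
Proof.
move=> r0 r1 r6 r7 ln tn; rewrite /dense_rows.
have W1 : 1 < W by apply: word_lt1; lia.
eapply runs_weaken.
  eapply runs_seq; eapply (@runs_arith _ _ _ _ t.+1).
    by rewrite /= r7 r1 addn1.
    by apply: word_lt1.
  eapply runs_seq; eapply (@runs_arith _ _ _ _ (t.+1 * n)).
    by rewrite /= r0.
    by apply: word_lt2; apply: leq_mul.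
  eapply runs_seq; eapply runs_const; first by clear -W1; lia.
  eapply (@runs_for _ _ _ _ 8 _ _ _ n 20 (fun j s' =>
    let L := [seq v <- iota 0 j | is_dense l t v] in
    stored (ram s') n L /\ reg s' 20 = size L)) => //.
  - by apply: word_lt1.
  - move=> j s' jn [st s20] s8 s1 fr _ _.
    have s0 : reg s' 0 = n by rewrite fr //= r0.
    have s6 : reg s' 6 = l by rewrite fr //= r6.
    have s14 : reg s' 14 = t.+1 * n by rewrite fr.
    have dn := degree_query_le j.
    rewrite iota0S filter_rcons.
    have sn : size [seq v <- iota 0 j | is_dense l t v] <= j.
      by rewrite size_filter (leq_trans (count_size _ _)) // size_iota.
    eapply runs_weaken.
      eapply runs_seq; eapply (@runs_deg _ _ _ _ (degree_query G j)).
        by rewrite s8.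
        by apply: word_lt1.
      eapply runs_seq; eapply (@runs_arith _ _ _ _ (degree_query G j * l)).
        by rewrite /= s6.
        by apply: word_lt2; apply: leq_mul.
      eapply runs_seq; eapply (@runs_arith _ _ _ _ (~~ is_dense l t j)).
        by rewrite /= s14 /is_dense -ltnNge.
        exact: word_ltb.
      eapply runs_if => /=; case: (boolP (is_dense l t j)) => // dj _.
        eapply runs_const; first by clear -W1; lia.
        by move=> b.
      eapply runs_seq; eapply (@runs_arith _ _ _ _ (n + reg s' 20)).
        by rewrite /= s0.
        by rewrite s20; apply: word_lt2; clear -n2 jn sn; nia.
      eapply runs_seq; eapply (@runs_write _ _ _ _ (n + reg s' 20) j) => //.
      eapply (@runs_arith _ _ _ _ (reg s' 20).+1).
        by rewrite /= s1 addn1.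
        by rewrite s20; apply: word_lt1; apply: leq_ltn_trans sn jn.
      move=> b /=; rewrite size_rcons s20.
      by split=> //; apply: stored_rcons.
    by [].

  - by move=> s' [].
by clear -n2; lia.
Qed.

Definition sampled_column (l j w : nat) : nat := w %% l + j * l.

Definition column_sample (l : nat) (ws : seq nat) : seq nat :=
  mkseq (fun j => sampled_column l j (nth 0 ws j)) (size ws).

Lemma column_sample_rcons l ws w : column_sample l (rcons ws w) =
  rcons (column_sample l ws) (sampled_column l (size ws) w).
Proof.
rewrite /column_sample size_rcons {1}/mkseq iota0S map_rcons.
rewrite nth_rcons ltnn eqxx; congr rcons.
by apply/eq_in_map => i; rewrite mem_iota nth_rcons => /andP[_ ->].
Qed.

Lemma runs_random_columns s l :
  reg s 0 = n -> reg s 1 = 1 -> reg s 6 = l -> reg s 29 = n + n ->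
  runs random_columns s (30 * n) (fun s' =>
    [/\ stored (ram s') (n + n) (column_sample l (words tape (pos s) (n %/ l))),
     forall x, x < n + n -> ram s' x = ram s x &
     reg s' 18 = n %/ l]).
Proof.
move=> r0 r1 r6 r29; rewrite /random_columns.
have W1 : 1 < W by apply: word_lt1; lia.
eapply runs_weaken.
  eapply runs_seq; eapply (@runs_arith _ _ _ _ (n %/ l)).
    by rewrite /= r0 r6.
    by apply: word_lt1; apply: leq_div.
  eapply (@runs_for _ _ _ _ 9 _ _ _ (n %/ l) 15 (fun j s' =>
    [/\ stored (ram s') (n + n) (column_sample l (words tape (pos s) j)),
     forall x, x < n + n -> ram s' x = ram s x & pos s' = pos s + j])) => //.
  - by apply: word_lt1; apply: leq_div.
  - by move=> b; rewrite /= addn0.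
  - move=> j s' jl [st lo ps] s9 _ fr _ _.
    have s6 : reg s' 6 = l by rewrite fr //= r6.
    have s29 : reg s' 29 = n + n by rewrite fr //= r29.
    set w := nth 0 tape (pos s + j).
    have l0 : 0 < l by case: (l) jl => //; rewrite divn0.
    have jln : j * l + l <= n.
      by rewrite -mulSnr (leq_trans _ (leq_trunc_div n l)) // leq_mul2r jl orbT.
    have wl : w %% l < l by rewrite ltn_mod.
    have jn : j < n by apply: leq_trans jl (leq_div _ _).
    eapply runs_weaken.
      eapply runs_seq; eapply (@runs_rand _ _ _ _ w); [by rewrite ps|exact: tW|].
      eapply runs_seq; eapply (@runs_arith _ _ _ _ (w %/ l)).
        by rewrite /= s6.
        by apply: leq_ltn_trans (tW _); apply: leq_div.
      eapply runs_seq; eapply (@runs_arith _ _ _ _ (w %/ l * l)).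
        by rewrite /= s6.
        by apply: leq_ltn_trans (tW _); apply: leq_trunc_div.
      eapply runs_seq; eapply (@runs_arith _ _ _ _ (w %% l)).
        by rewrite /= sub_mod.
        by apply: leq_ltn_trans (tW _); apply: leq_mod.
      eapply runs_seq; eapply (@runs_arith _ _ _ _ (j * l)).
        by rewrite /= s6 s9.
        by apply: word_lt1; apply: leq_trans jln; apply: leq_addr.
      eapply runs_seq; eapply (@runs_arith _ _ _ _ (sampled_column l j w)).
        by [].
        apply: word_lt1; apply: leq_trans jln; rewrite /sampled_column addnC.
        by rewrite leq_add2l ltnW.
      eapply runs_seq; eapply (@runs_arith _ _ _ _ (n + n + j)).
        by rewrite /= s29 s9.
        by apply: (word_lt (i := 3)) => //; rewrite !expnS expn0; clear -n2 jn; nia.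
      eapply (@runs_write _ _ _ _ (n + n + j) (sampled_column l j w)) => //.
      move=> b; split=> //=; last by rewrite ps addnS.
      - have -> : column_sample l (words tape (pos s) j.+1) =
          rcons (column_sample l (words tape (pos s) j)) (sampled_column l j w).
          by rewrite wordsS column_sample_rcons size_words.
        have {1}-> : j = size (column_sample l (words tape (pos s) j)).
          by rewrite size_mkseq size_words.
        exact: stored_rcons.
      - move=> x xn; case: eqP => [e|_]; last exact: lo.
        by exfalso; move: xn; rewrite e ltnNge leq_addr.
    by [].
  - move=> s' [st lo ps] fr _ _; split=> //.
    by rewrite fr.
by have := leq_div n l; move: n2; clear; lia.
Qed.

Lemma runs_all_columns s : reg s 0 = n -> reg s 1 = 1 -> reg s 17 = 0 ->
  reg s 29 = n + n ->
  runs all_columns s (30 * n) (fun s' =>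
    [/\ stored (ram s') (n + n) (iota 0 n),
     forall x, x < n + n -> ram s' x = ram s x & reg s' 18 = n]).
Proof.
move=> r0 r1 r17 r29; rewrite /all_columns.
have W1 : 1 < W by apply: word_lt1; lia.
eapply runs_weaken.
  eapply runs_seq; eapply (@runs_arith _ _ _ _ n).
    by rewrite /= r0 r17 addn0.
    by apply: word_lt1.
  eapply (@runs_for _ _ _ _ 9 _ _ _ n 3 (fun j s' =>
    stored (ram s') (n + n) (iota 0 j) /\
    forall x, x < n + n -> ram s' x = ram s x)) => //.
  - by apply: word_lt1.
  - move=> j s' jn [st lo] s9 _ fr _ _.
    have s29 : reg s' 29 = n + n by rewrite fr //= r29.
    rewrite iota0S; eapply runs_weaken.
      eapply runs_seq; eapply (@runs_arith _ _ _ _ (n + n + j)).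
        by rewrite /= s29 s9.
        by apply: (word_lt (i := 3)) => //; rewrite !expnS expn0; clear -n2 jn; nia.
      eapply (@runs_write _ _ _ _ (n + n + j) j) => //.
      move=> b; split=> /=.
      + have {1}-> : j = size (iota 0 j) by rewrite size_iota.
        exact: stored_rcons.
      + move=> x xn; case: eqP => [e|_]; last exact: lo.
        by exfalso; move: xn; rewrite e ltnNge leq_addr.
    by [].
  - by move=> s' [st lo] fr _ _; split=> //; rewrite fr.
by clear -n2; lia.
Qed.

Definition hits (R : seq nat) (v : nat) : nat := sumn [seq adj_query G u v | u <- R].

Lemma hits_le R v : hits R v <= size R.
Proof. by apply: sumn_le1 => u; apply: adj_query_le1. Qed.

Lemma runs_prefilter s l t (R C : seq nat) :
  reg s 0 = n -> reg s 1 = 1 -> reg s 6 = l -> reg s 7 = t -> reg s 29 = n + n ->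
  reg s 18 = size C -> size R = l -> l <= n -> size C <= n ->
  (forall i, nth 0 R i < n) -> (forall i, nth 0 C i < n) ->
  stored (ram s) n R -> stored (ram s) (n + n) C ->
  runs prefilter s (size C * (12 * l + 50) + 10) (fun s' =>
    let L := [seq v <- C | t <= hits R v] in
    [/\ stored (ram s') (n + n) L, reg s' 19 = size L &
     forall x, x < n + n -> ram s' x = ram s x]).
Proof.
move=> r0 r1 r6 r7 r29 r18 Rl ln Cn Rlt Clt stR stC; rewrite /prefilter.
have W1 : 1 < W by apply: word_lt1; lia.
have big3 j : j <= n -> n + n + j < W.
  move=> jn; apply: (word_lt (i := 3)) => //; rewrite !expnS expn0; clear -n2 jn; nia.
pose P v := t <= hits R v.
eapply runs_weaken.
  eapply runs_seq; eapply runs_const; first by clear -W1; lia.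
  eapply (@runs_for _ _ _ _ 9 _ _ _ (size C) (12 * l + 40) (fun j s' =>
    filtering P (ram s) (n + n) C j (ram s') /\
    reg s' 19 = size (seq.filter P (take j C)))) => //.
  - by apply: word_lt1.
  - by move=> b; split; [exact: filtering_start|rewrite take0].
  - move=> j s' jC [fi s19] s9 s1 fr _ _.
    have s0 : reg s' 0 = n by rewrite fr //= r0.
    have s6 : reg s' 6 = l by rewrite fr //= r6.
    have s7 : reg s' 7 = t by rewrite fr //= r7.
    have s29 : reg s' 29 = n + n by rewrite fr //= r29.
    have szj := size_filter_take P C j.
    have jn : j < n by apply: leq_trans jC Cn.
    set v := nth 0 C j.
    have [_ rest low] := fi.
    eapply runs_weaken.
      eapply runs_seq; eapply (@runs_arith _ _ _ _ (n + n + j)).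
        by rewrite /= s29 s9.
        by apply: big3; apply: ltnW.
      eapply runs_seq; eapply (@runs_read _ _ _ _ v).
        by rewrite /= rest // leqnn.
        by apply: word_lt1; apply: ltnW; apply: Clt.
      eapply runs_seq; eapply runs_const; first by clear -W1; lia.
      eapply runs_seq.
      eapply (@runs_for _ _ _ _ 8 _ _ _ l 7 (fun i s2 =>
         reg s2 27 = hits (take i R) v)) => //.
      + by apply: word_lt1.
      + by move=> b; rewrite take0.
      + move=> i s2 il s27 s8 s21 fr2 _ rm.
        have s20 : reg s2 0 = n by rewrite fr2.
        set u := nth 0 R i.
        eapply runs_weaken.
          eapply runs_seq; eapply (@runs_arith _ _ _ _ (n + i)).
            by rewrite /= s20 s8.
            by apply: word_lt2; clear -n2 il ln; nia.
          eapply runs_seq; eapply (@runs_read _ _ _ _ u).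
            rewrite /= rm //= low; first by rewrite stR ?Rl.
            by rewrite ltn_add2l (leq_trans il).
            by apply: word_lt1; apply: ltnW; apply: Rlt.
          eapply runs_seq; eapply (@runs_adj _ _ _ _ (adj_query G u v)).
            by rewrite /= fr2.
            by apply: leq_ltn_trans (adj_query_le1 _ _) W1.
          eapply (@runs_arith _ _ _ _ (hits (take i.+1 R) v)).
            by rewrite (take_nth 0) ?Rl // /hits map_rcons sumn_rcons /= s27.
            apply: word_lt1; apply: leq_trans (hits_le _ _) _.
            by rewrite size_take; case: ifP => // _; rewrite ?Rl // (leq_trans il).
          by [].
        by [].
      move=> s2 + fr2 _ rm; rewrite -{1}Rl take_size => s27.
      eapply runs_seq; eapply (@runs_arith _ _ _ _ (~~ P v)).
        by rewrite /= s27 fr2 //= s7 /P -ltnNge.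
        exact: word_ltb.
      eapply runs_if => /=; case: (boolP (P v)) => // Pv _.
        eapply runs_const; first by clear -W1; lia.
        move=> b /=; rewrite rm //=; split; first exact: filtering_drop.
        by rewrite fr2 //= s19 (take_nth 0) // filter_rcons -/v (negbTE Pv).
      eapply runs_seq; eapply (@runs_arith _ _ _ _ (n + n + reg s' 19)).
        by rewrite /= !fr2 //= s29.
        by rewrite s19; apply: big3; apply: leq_trans szj (ltnW jn).
      eapply runs_seq; eapply (@runs_write _ _ _ _ (n + n + reg s' 19) v) => //.
        by rewrite /= fr2.
      eapply (@runs_arith _ _ _ _ (reg s' 19).+1).
        by rewrite /= !fr2 //= s1 addn1.
        by rewrite s19; apply: word_lt1; apply: leq_ltn_trans szj jn.
      move=> b /=; rewrite rm //=; split.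
        by rewrite s19; apply: filtering_keep.
      by rewrite s19 (take_nth 0) // filter_rcons -/v Pv size_rcons.
    by clear; lia.
  - by move=> s' []; rewrite /filtering !take_size => -[st _ low].
by rewrite !mulnDr; clear; lia.
Qed.

(** First component: the rows taken so far; second component: the live columns.
    *)
Definition greedy_step (l t : nat) (TL : seq nat * seq nat) (u : nat) :=
  if size TL.1 < t then
    if size TL.2 * t <= sumn [seq adj_query G u v | v <- TL.2] * l
    then (rcons TL.1 u, [seq v <- TL.2 | adj_query G u v == 1])
    else (TL.1, [seq v <- TL.2 | adj_query G u v == 0])
  else TL.

Lemma runs_greedy_body s l t u i (T L : seq nat) N :
  reg s 0 = n -> reg s 1 = 1 -> reg s 17 = 0 -> reg s 6 = l -> reg s 7 = t ->
  reg s 29 = n + n -> reg s 8 = i -> reg s 19 = size L -> reg s 20 = size T ->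
  i < n -> ram s (n + i) = u -> u < n -> l <= n -> t <= n -> size T < t ->
  size L <= N -> N <= n -> (forall v, v \in L -> v < n) ->
  stored (ram s) 0 T -> stored (ram s) (n + n) L ->
  runs greedy_body s (N * 40 + 50) (fun s' =>
    let TL := greedy_step l t (T, L) u in
    [/\ stored (ram s') 0 TL.1, stored (ram s') (n + n) TL.2,
     reg s' 20 = size TL.1, reg s' 19 = size TL.2 &
     forall x, n <= x < n + n -> ram s' x = ram s x]).
Proof.
move=> r0 r1 r17 r6 r7 r29 r8 r19 r20 iln mu un ln tn Tt LN Nn Llt stT stL.
rewrite /greedy_body.
have W1 : 1 < W by apply: word_lt1; lia.
have big3 j : j <= n -> n + n + j < W.
  move=> jn; apply: (word_lt (i := 3)) => //; rewrite !expnS expn0; clear -n2 jn; nia.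
have Ln : size L <= n by apply: leq_trans Nn.
pose cnt j := sumn [seq adj_query G u v | v <- take j L].
have cntn j : cnt j <= n.
  apply: leq_trans (sumn_le1 _ (adj_query_le1 u)) _.
  by rewrite size_take; case: ifP => // /ltnW h; apply: leq_trans h Ln.
pose rej : bool := cnt (size L) * l < size L * t.
pose P v := adj_query G u v != rej.
eapply runs_weaken.
  eapply runs_seq; eapply (@runs_arith _ _ _ _ (n + i)).
    by rewrite /= r0 r8.
    by apply: word_lt2; clear -n2 iln; nia.
  eapply runs_seq; eapply (@runs_read _ _ _ _ u).
    by [].
    by apply: word_lt1; apply: ltnW.
  eapply runs_seq; eapply runs_const; first by clear -W1; lia.
  eapply runs_seq.
  eapply (@runs_for _ _ _ _ 9 _ _ _ (size L) 7 (fun j s' => reg s' 22 = cnt j)) => //.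
  - by apply: word_lt1.
  - by move=> b; rewrite /cnt take0.
  - move=> j s2 jL s22 s9 _ fr _ rm.
    have vn : nth 0 L j < n by apply: Llt; apply: mem_nth.
    eapply runs_weaken.
      eapply runs_seq; eapply (@runs_arith _ _ _ _ (n + n + j)).
        by rewrite /= fr //= r29 s9.
        by apply: big3; apply: leq_trans (ltnW jL) Ln.
      eapply runs_seq; eapply (@runs_read _ _ _ _ (nth 0 L j)).
        by rewrite /= rm //= stL.
        by apply: word_lt1; apply: ltnW.
      eapply runs_seq; eapply (@runs_adj _ _ _ _ (adj_query G u (nth 0 L j))).
        by rewrite /= fr.
        by apply: leq_ltn_trans (adj_query_le1 _ _) W1.
      eapply (@runs_arith _ _ _ _ (cnt j.+1)).
        by rewrite /cnt (take_nth 0) // map_rcons sumn_rcons /= s22.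
        by apply: word_lt1.
      by [].
    by [].
  move=> s2 s22 fr2 _ rm2.
  eapply runs_seq; eapply (@runs_arith _ _ _ _ (cnt (size L) * l)).
    by rewrite /= s22 fr2 //= r6.
    by apply: word_lt2; apply: leq_mul.
  eapply runs_seq; eapply (@runs_arith _ _ _ _ (size L * t)).
    by rewrite /= !fr2 //= r19 r7.
    by apply: word_lt2; apply: leq_mul.
  eapply runs_seq; eapply (@runs_arith _ _ _ _ rej).
    by [].
    exact: word_ltb.
  have tc : size T < n by apply: leq_trans Tt tn.
  eapply runs_seq; eapply (@runs_post _ _ _ _ _ _ _ (fun s3 =>
    [/\ stored (ram s3) 0 (greedy_step l t (T, L) u).1,
     reg s3 20 = size (greedy_step l t (T, L) u).1,
     forall x, n <= x -> ram s3 x = ram s x, reg s3 23 = rej &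
     [/\ reg s3 0 = n, reg s3 1 = 1, reg s3 17 = 0, reg s3 29 = n + n &
      reg s3 19 = size L /\ reg s3 21 = u]])).
    have gs : (greedy_step l t (T, L) u).1 = if rej then T else rcons T u.
      rewrite /greedy_step /= Tt -[L in map _ L]take_size -/(cnt _) /rej ltnNge.
      by case: leqP.
    rewrite gs; eapply runs_if => /=; case: (boolP rej) => // rj _.
      eapply runs_const; first by clear -W1; lia.
      by split=> //=; rewrite ?rm2 ?fr2 //=; split=> //=; rewrite ?fr2.
    eapply runs_seq; eapply (@runs_write _ _ _ _ (size T) u).
      by rewrite /= fr2.
      by rewrite /= fr2.
    eapply (@runs_arith _ _ _ _ (size T).+1).
      by rewrite /= !fr2 //= r20 r1 addn1.
      by apply: word_lt1.
    rewrite /= size_rcons; split=> //=.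
    - rewrite rm2 //; have {1}-> : size T = 0 + size T by [].
      exact: stored_rcons.
    - by move=> x xn; rewrite gtn_eqF ?rm2 // (leq_trans tc).
    - by split=> //; rewrite !fr2.
  move=> s3 [stT3 s20 hi s23 [s0 s1 s17 s29 [s19 s21]]].
  eapply runs_seq; eapply runs_const; first by clear -W1; lia.
  eapply runs_seq.
  have stL3 : stored (ram s3) (n + n) L.
    by move=> j jL; rewrite hi ?stL // -addnA leq_addr.
  eapply (@runs_for _ _ _ _ 9 _ _ _ (size L) 20 (fun j s' =>
    filtering P (ram s3) (n + n) L j (ram s') /\
    reg s' 24 = size (seq.filter P (take j L)))) => //.
  - by apply: word_lt1.
  - by move=> b; split; [exact: filtering_start|rewrite take0].
  - move=> j s4 jL [fi s24] s9 s41 fr _ _.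
    have vn : nth 0 L j < n by apply: Llt; apply: mem_nth.
    have jn : j < n by apply: leq_trans jL Ln.
    have szj := size_filter_take P L j.
    have [_ rest low] := fi.
    set v := nth 0 L j.
    have a1 := adj_query_le1 u v.
    have b1 : rej <= 1 by case: (rej).
    eapply runs_weaken.
      eapply runs_seq; eapply (@runs_arith _ _ _ _ (n + n + j)).
        by rewrite /= fr //= s29 s9.
        by apply: big3; apply: ltnW.
      eapply runs_seq; eapply (@runs_read _ _ _ _ v).
        by rewrite /= rest // leqnn.
        by apply: word_lt1; apply: ltnW.
      eapply runs_seq; eapply (@runs_adj _ _ _ _ (adj_query G u v)).
        by rewrite /= fr //= s21.
        by apply: leq_ltn_trans a1 W1.
      eapply runs_seq; eapply (@runs_arith _ _ _ _ (adj_query G u v - rej)).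
        by rewrite /= fr //= s23.
        by apply: leq_ltn_trans (leq_trans (leq_subr _ _) a1) W1.
      eapply runs_seq; eapply (@runs_arith _ _ _ _ (rej - adj_query G u v)).
        by rewrite /= fr //= s23.
        by apply: leq_ltn_trans (leq_trans (leq_subr _ _) b1) W1.
      eapply runs_seq; eapply (@runs_arith _ _ _ _ (P v)).
        rewrite /= /P; move: a1 b1; clear; case: (adj_query G u v) => [|[|//]] _;
        by case: (nat_of_bool rej) => [|[|//]].
        exact: word_ltb.
      eapply runs_if => /=; case: (boolP (P v)) => // Pv _.
        eapply runs_seq; eapply (@runs_arith _ _ _ _ (n + n + reg s4 24)).
          by rewrite /= fr //= s29.
          by rewrite s24; apply: big3; apply: leq_trans szj (ltnW jn).
        eapply runs_seq; eapply (@runs_write _ _ _ _ (n + n + reg s4 24) v) => //.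
        eapply (@runs_arith _ _ _ _ (reg s4 24).+1).
          by rewrite /= s41 addn1.
          by rewrite s24; apply: word_lt1; apply: leq_ltn_trans szj jn.
        move=> b /=; split.
          by rewrite s24; apply: filtering_keep.
        by rewrite s24 (take_nth 0) // filter_rcons -/v Pv size_rcons.
      eapply runs_const; first by clear -W1; lia.
      move=> b /=; split; first exact: filtering_drop.
      by rewrite s24 (take_nth 0) // filter_rcons -/v (negbTE Pv).
    by [].
  - move=> s4 []; rewrite /filtering !take_size => -[st _ low] s24 fr _ _.
    have Pf : seq.filter P L = (greedy_step l t (T, L) u).2.
      rewrite /greedy_step /= Tt -[L in map _ L]take_size -/(cnt _).
      rewrite leqNgt -/rej; case: (boolP rej) => rj; apply: eq_filter => v.
        by rewrite /P rj; move: (adj_query_le1 u v); case: adj_query => [|[|]].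
      rewrite /P (negbTE rj); move: (adj_query_le1 u v).
      by case: adj_query => [|[|]].
    rewrite Pf in st s24.
    eapply (@runs_arith _ _ _ _ (size (greedy_step l t (T, L) u).2)).
      by rewrite /= s24 fr //= s17 addn0.
      rewrite -Pf; apply: word_lt1; rewrite size_filter.
      by apply: leq_trans (count_size _ _) Ln.
    split=> //=.
    + move=> j jT; rewrite low; first exact: stT3.
      rewrite add0n (leq_trans jT) // -s20 s20.
      apply: leq_trans (leq_addr _ _).
      rewrite /greedy_step /= Tt; case: ifP => _ /=; last exact: ltnW tc.
      by rewrite size_rcons.
    + by rewrite fr.
    + by move=> x /andP[x1 x2]; rewrite low // hi.
by move: LN; rewrite /=; clear; lia.
Qed.

Definition greedy_run (l t : nat) (L R : seq nat) : seq nat * seq nat :=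
  foldl (greedy_step l t) ([::], L) R.

Lemma greedy_step_sub l t TL u : subseq (greedy_step l t TL u).2 TL.2.
Proof.
by rewrite /greedy_step; case: ifP => // _; case: ifP => _; exact: filter_subseq.
Qed.

Lemma greedy_run_sub l t L R : subseq (greedy_run l t L R).2 L.
Proof.
rewrite /greedy_run -{2}[L]/(([::] : seq nat, L).2).
elim: R ([::], L) => //= u R IH TL.
exact: subseq_trans (IH _) (greedy_step_sub _ _ _ _).
Qed.

Lemma greedy_step_size l t TL u :
  size TL.1 <= t -> size (greedy_step l t TL u).1 <= t.
Proof.
by rewrite /greedy_step; case: ifP => // h _; case: ifP => _; rewrite ?size_rcons // ltnW.
Qed.

Lemma greedy_run_size l t L R : size (greedy_run l t L R).1 <= t.
Proof.
rewrite /greedy_run; have : size ([::] : seq nat, L).1 <= t by [].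
by elim: R ([::], L) => //= u R IH TL h; apply/IH/greedy_step_size.
Qed.

Lemma greedy_run_rcons l t L R u :
  greedy_run l t L (rcons R u) = greedy_step l t (greedy_run l t L R) u.
Proof. by rewrite /greedy_run -cats1 foldl_cat. Qed.

Lemma runs_greedy s l t (R L : seq nat) N :
  reg s 0 = n -> reg s 1 = 1 -> reg s 17 = 0 -> reg s 6 = l -> reg s 7 = t ->
  reg s 29 = n + n -> reg s 19 = size L -> size R = l -> l <= n -> t <= n ->
  size L <= N -> N <= n -> (forall i, nth 0 R i < n) -> (forall v, v \in L -> v < n) ->
  stored (ram s) n R -> stored (ram s) (n + n) L ->
  runs greedy s (l * (N * 40 + 60) + 10) (fun s' =>
    let TL := greedy_run l t L R in
    [/\ stored (ram s') 0 TL.1, stored (ram s') (n + n) TL.2,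
     reg s' 20 = size TL.1 & reg s' 19 = size TL.2]).
Proof.
move=> r0 r1 r17 r6 r7 r29 r19 Rl ln tn LN Nn Rlt Llt stR stL; rewrite /greedy.
have W1 : 1 < W by apply: word_lt1; lia.
eapply runs_weaken.
  eapply runs_seq; eapply runs_const; first by clear -W1; lia.
  eapply (@runs_for _ _ _ _ 8 _ _ _ l (N * 40 + 55) (fun i s' =>
    let TL := greedy_run l t L (take i R) in
    [/\ [/\ stored (ram s') 0 TL.1, stored (ram s') (n + n) TL.2,
     reg s' 20 = size TL.1 & reg s' 19 = size TL.2],
     forall x, n <= x < n + n -> ram s' x = ram s x &
     [/\ reg s' 0 = n, reg s' 17 = 0, reg s' 6 = l, reg s' 7 = t &
      reg s' 29 = n + n]])) => //.
  - by apply: word_lt1.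
  - by move=> b; rewrite take0.
  - move=> i s' il; rewrite (take_nth 0) ?Rl // greedy_run_rcons.
    set TL := greedy_run _ _ _ _; set u := nth 0 R i.
    move=> [[st1 st2 s20 s19] mid [s0 s17 s6 s7 s29]] s8 s1 _ _ _.
    have TLt : size TL.1 <= t by apply: greedy_run_size.
    have TLL : subseq TL.2 L by apply: greedy_run_sub.
    eapply runs_weaken.
      eapply runs_seq; eapply (@runs_arith _ _ _ _ (size TL.1 < t)).
        by rewrite /= s20 s7.
        exact: word_ltb.
      eapply runs_if => /=; case: (boolP (size TL.1 < t)) => // Tt _.
        have h := @runs_greedy_body (put s' 14 true) l t u i TL.1 TL.2 N
          s0 s1 s17 s6 s7 s29 s8 s19 s20 (leq_trans il ln).
        apply: runs_post (runs_frame (h _ _ ln tn Tt _ Nn _ st1 st2)) _.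
        + by rewrite /= mid ?stR ?Rl // leq_addr ltn_add2l (leq_trans il).
        + exact: Rlt.
        + exact: leq_trans (size_subseq TLL) LN.
        + by move=> v /(mem_subseq TLL); apply: Llt.
        + move=> s3 [[]]; rewrite -surjective_pairing => st3 st4 s3_20 s3_19 mid3 fr _ _ b.
          split; first by split.
            by move=> x hx; rewrite -mid // mid3.
          by split; rewrite /= fr.
      eapply runs_const; first by clear -W1; lia.
      by move=> b; rewrite /greedy_step (negbTE Tt).
    by clear; lia.
  - by move=> s' []; rewrite -Rl take_size.
by rewrite !mulnDr; clear; lia.
Qed.

(** For reading a cell whose content is unknown. *)
Lemma runs_read_any x y s k (Q : state -> Prop) : 0 < k ->
  Q (put s x (ram s (reg s y) %% W)) -> runs (Read x y) s k Q.
Proof.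
move=> k0 q; exists (put s x (ram s (reg s y) %% W)), 1; split=> //.
exact: (BigAtom G W tape s (c := Read x y)).
Qed.

(** When fewer than t columns are alive, the copying loop reads past their end
    and only the first side is meaningful. *)
Lemma runs_output s t (T L : seq nat) :
  reg s 0 = n -> reg s 1 = 1 -> reg s 17 = 0 -> reg s 7 = t ->
  reg s 29 = n + n -> size T <= t -> t <= n -> (forall v, v \in L -> v < n) ->
  stored (ram s) 0 T -> stored (ram s) (n + n) L ->
  runs output s (t * 20 + 10) (fun s' =>
    [/\ reg s' 0 = t, stored (ram s') 0 T &
     t <= size L -> stored (ram s') t (take t L)]).
Proof.
move=> r0 r1 r17 r7 r29 Tt tn Llt stT stL; rewrite /output.
have W1 : 1 < W by apply: word_lt1; lia.
have big3 j : j <= n -> n + n + j < W.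
  move=> jn; apply: (word_lt (i := 3)) => //; rewrite !expnS expn0; clear -n2 jn; nia.
eapply runs_weaken.
  eapply runs_seq.
  eapply (@runs_for _ _ _ _ 9 _ _ _ t 7 (fun j s' =>
    [/\ forall i, i < j -> i < size L -> ram s' (t + i) = nth 0 L i,
     forall x, x < t -> ram s' x = ram s x &
     forall x, n + n <= x -> ram s' x = ram s x])) => //.
  - by apply: word_lt1.
  - move=> j s' jt [cp lo hi] s9 s1 fr _ _.
    have jn := leq_trans jt tn.
    eapply runs_weaken.
      eapply runs_seq; eapply (@runs_arith _ _ _ _ (n + n + j)).
        by rewrite /= fr //= r29 s9.
        by apply: big3; apply: ltnW.
      eapply runs_seq; apply: (@runs_read_any _ _ _ 1) => //=.
      eapply runs_seq; eapply (@runs_arith _ _ _ _ (t + j)).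
        by rewrite /= fr //= r7 s9.
        by apply: word_lt2; clear -n2 jn tn; nia.
      eapply runs_write => //= b; split=> //.
      + move=> i; rewrite ltnS leq_eqVlt eqn_add2l => /orP[/eqP->|ij] iL.
          rewrite eqxx hi ?leq_addr // stL // modn_small //.
          by apply: word_lt1; apply: ltnW; apply: Llt; apply: mem_nth.
        by rewrite ltn_eqF // cp.
      + by move=> x xt; rewrite ltn_eqF ?lo // (leq_trans xt) ?leq_addr.
      + move=> x xn; rewrite gtn_eqF ?hi //; apply: leq_trans xn.
        by rewrite -addnS leq_add.
    by [].
  - move=> s' [cp lo hi] fr _ _.
    eapply (@runs_arith _ _ _ _ t).
      by rewrite /= !fr //= r7 r17 addn0.
      by apply: word_lt1.
    split=> //=.
    + by move=> i iT; rewrite lo ?stT // add0n (leq_trans iT).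
    + move=> tL i; rewrite size_take_min (minn_idPl tL) => it.
      by rewrite cp ?nth_take // (leq_trans it).
by clear; lia.
Qed.

(** The second side is promised only if at least t columns are alive. *)
Definition returned (t : nat) (TL : seq nat * seq nat) (s : state) : Prop :=
  [/\ reg s 0 = t, stored (ram s) 0 TL.1 &
   t <= size TL.2 -> stored (ram s) t (take t TL.2)].

Definition good_columns (t : nat) (R C : seq nat) : seq nat :=
  [seq v <- C | t <= hits R v].

Lemma runs_extraction s l t (R C : seq nat) :
  reg s 0 = n -> reg s 1 = 1 -> reg s 17 = 0 -> reg s 6 = l -> reg s 7 = t ->
  reg s 29 = n + n -> reg s 18 = size C -> size R = l -> l <= n -> t <= n ->
  size C <= n -> (forall i, nth 0 R i < n) -> (forall i, nth 0 C i < n) ->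
  stored (ram s) n R -> stored (ram s) (n + n) C ->
  runs extraction s (size C * l * 52 + size C * 50 + l * 60 + t * 20 + 50)
    (returned t (greedy_run l t (good_columns t R C) R)).
Proof.
move=> r0 r1 r17 r6 r7 r29 r18 Rl ln tn Cn Rlt Clt stR stC; rewrite /extraction.
set L := good_columns t R C.
have Llt v : v \in L -> v < n.
  by rewrite mem_filter => /andP[_ /(nthP 0)[i _ <-]].
have LC : size L <= size C by rewrite size_filter count_size.
eapply runs_weaken.
  eapply runs_seq.
  have h1 := runs_prefilter r0 r1 r6 r7 r29 r18 Rl ln Cn Rlt Clt stR stC.
  apply: runs_post (runs_frame h1) _ => s1 [[stL s19 lo] fr1 _ _].
  eapply runs_seq.
  have stR1 : stored (ram s1) n R.
    by move=> i iR; rewrite lo ?stR // ltn_add2l (leq_trans iR) // Rl.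
  have h2 := @runs_greedy s1 l t R L (size C).
  apply: runs_post (runs_frame (h2 _ _ _ _ _ _ s19 Rl ln tn LC Cn Rlt Llt stR1 stL)) _;
    rewrite ?fr1 // => s2 [[st1 st2 s20 s219] fr2 _ _].
  have h3 := @runs_output s2 t (greedy_run l t L R).1 (greedy_run l t L R).2.
  apply: h3; rewrite ?fr2 //= ?fr1 //.
    exact: greedy_run_size.
  by move=> v /(mem_subseq (greedy_run_sub _ _ _ _)); apply: Llt.
by rewrite !mulnDr !mulnA [l * size C]mulnC mulnAC; clear; lia.
Qed.

Lemma found_bounds a b m l t : found a b m l t -> a <= b ->
  [/\ t <= l, l ^ 4 <= n & l <= n].
Proof.
move=> [m0 fm _ lt] ab; case: eqP lt => [_ [-> ->]|/eqP m1 [-> ->]]; first by [].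
have /feasible_size[l0 l4] : feasible n a b m by apply: fm; rewrite leqnn andbT; move: m0 m1; clear; lia.
split=> //.
  rewrite /side_of; apply: leq_trans (leq_subr _ _) _.
  have [->|b0] := posnP b; first by rewrite divn0.
  by rewrite -[leqRHS](mulnK _ b0) leq_div2r // leq_mul.
by apply: leq_trans l4; rewrite -{1}[size_of _ _ _]expn1 leq_pexp2l.
Qed.

Definition initial : state := State (upd (fun=> 0) 0 (n %% W)) (fun=> 0) 0.

Definition sampled_edges : nat := sumn (map pair_adj (words tape 0 n)).
Definition sampled_rows (l : nat) : seq nat := [seq w %% n | w <- words tape n l].
Definition sampled_columns (l : nat) : seq nat :=
  column_sample l (words tape (n + l) (n %/ l)).

Lemma runs_prologue :
  runs prologue initial 3 (fun s => [/\ reg s 0 = n, reg s 1 = 1, reg s 29 = n + n,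
    (forall r, r \notin [:: 0; 1; 29] -> reg s r = 0) & pos s = 0]).
Proof.
have nn : n + n < W by apply: word_lt2; clear -n2; nia.
eapply runs_weaken.
  eapply runs_seq; eapply runs_const; first by apply: word_lt1; lia.
  eapply (@runs_arith _ _ _ _ (n + n)) => //=.
    by rewrite modn_small // word_lt1.
  split=> //=; first by rewrite modn_small // word_lt1.
  move=> r; rewrite !inE !negb_or => /and3P[h1 h2 h3].
  by rewrite (negbTE h1) (negbTE h2) (negbTE h3).
by [].
Qed.

(** The tape is consumed in three consecutive blocks of lengths n, l and n/l.
    The bound is linear in n because the cost l of a column is multiplied by
    the number n/l of columns only. *)
Lemma runs_randomized : runs randomized_program initial (1000 * n) (fun s =>
  exists m l t, found sampled_edges n m l t /\
    returned t (greedy_run l t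
      (good_columns t (sampled_rows l) (sampled_columns l)) (sampled_rows l)) s).
Proof.
rewrite /randomized_program.
apply: (@runs_weaken _ _ _ _ _ _ (3 + (30 * n + (150 * n + (30 * n + (30 * n + 400 * n).+1).+1).+1).+1).+1);
  last by clear -n2; lia.
have en : sampled_edges <= n.
  apply: leq_trans (sumn_le1 _ _) _; last by rewrite size_words.
  by move=> w; apply: adj_query_le1.
apply: runs_seq; apply: runs_post runs_prologue _ => s1 [s1_0 s1_1 s1_29 s1_z s1_p].
apply: runs_seq.
apply: runs_post (runs_frame (runs_sampled_density s1_0 s1_1 _)) _; first exact: s1_z.
rewrite s1_p => s2 [[s2_3 s2_4 s2_p] fr2 _ _].
apply: runs_seq.
apply: runs_post (runs_frame (@runs_search s2 sampled_edges n _ _ _ s2_3 s2_4 _ _ en _)) _;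
  rewrite ?fr2 // ?s1_z //; first by rewrite leq_pmulr // ltnW.
move=> s3 [[m fd] fr3 po3 _]; set l := reg s3 6 in fd; set t := reg s3 7 in fd.
have [q0 q1 q17 q29] : [/\ reg s3 0 = n, reg s3 1 = 1, reg s3 17 = 0 & reg s3 29 = n + n].
  by split; rewrite fr3 // fr2 // s1_z.
have [tl l4 ln] := found_bounds fd en.
apply: runs_seq.
apply: runs_post (runs_frame (@runs_random_rows s3 l _ _ erefl ln)) _ => //.
rewrite po3 // s2_p => s4 [[st4 po4] fr4 _ _].
apply: runs_seq.
apply: runs_post (runs_frame (@runs_random_columns s4 l _ _ _ _)) _;
  rewrite ?fr4 //.
rewrite po4 => s5 [[st5 lo5 s5_18] fr5 _ _].
have h := @runs_extraction s5 l t (sampled_rows l) (sampled_columns l).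
have nl : n %/ l * l <= n by apply: leq_trunc_div.
have szC : size (sampled_columns l) = n %/ l by rewrite size_mkseq size_words.
have szR : size (sampled_rows l) = l by rewrite size_map size_words.
apply: runs_weaken.
  apply: runs_post; last first.
    move=> s6 ret; exists m, l, t; split; [exact: fd|exact: ret].
  apply: h; rewrite ?szC // ?fr5 // ?fr4 //.
  - exact: leq_trans tl ln.
  - exact: leq_div.
  - move=> i; have [il|il] := ltnP i l; last by rewrite nth_default ?szR //; lia.
    by rewrite (nth_map 0) ?size_words // ltn_mod; lia.
  - move=> i; have [il|il] := ltnP i (n %/ l); last by rewrite nth_default ?szC //; lia.
    rewrite nth_mkseq ?size_words // /sampled_column.
    have l0 : 0 < l by move: il; case: (l) => //; rewrite divn0.
    apply: (@leq_trans (l + i * l)); first by rewrite ltn_add2r ltn_mod.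
    by rewrite -mulSn (leq_trans _ nl) // leq_mul2r il orbT.
  - move=> i il; rewrite lo5 ?st4 // ltn_add2l (leq_trans il) //.
    by rewrite szR.
rewrite szC; have := leq_div n l; move: nl ln (leq_trans tl ln) n2; clear; lia.
Qed.

(** The bound c on l controls the running time. It is a hypothesis here since
    it comes from the analysis of the search. *)
Lemma runs_deterministic c :
  (forall m l t, found degree_sum (n * n) m l t ->
     l <= size [seq v <- iota 0 n | is_dense l t v] /\ l <= c) ->
  runs deterministic_program initial (n * (60 * c + 500)) (fun s =>
  exists m l t, found degree_sum (n * n) m l t /\
    let R := take l [seq v <- iota 0 n | is_dense l t v] in
    returned t (greedy_run l t (good_columns t R (iota 0 n)) R) s).
Proof.
move=> Hc; rewrite /deterministic_program.
apply: (@runs_weaken _ _ _ _ _ _ (3 + (30 * n + (150 * n + (40 * n + (30 * n + n * (60 * c + 200)).+1).+1).+1).+1).+1);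
  last by rewrite !mulnDr; clear -n2; lia.
have en : degree_sum <= n * n.
  apply: leq_trans (sumn_le _ (@degree_query_le)) _; by rewrite size_iota.
apply: runs_seq; apply: runs_post runs_prologue _ => s1 [s1_0 s1_1 s1_29 s1_z s1_p].
apply: runs_seq.
apply: runs_post (runs_frame (runs_exact_density s1_0 s1_1 _)) _; first exact: s1_z.
move=> s2 [[s2_3 s2_4] fr2 _ _].
apply: runs_seq.
apply: runs_post (runs_frame (@runs_search s2 degree_sum (n * n) _ _ _ s2_3 s2_4 _ _ en _)) _;
  rewrite ?fr2 // ?s1_z //.
move=> s3 [[m fd] fr3 po3 _]; set l := reg s3 6 in fd; set t := reg s3 7 in fd.
have [q0 q1 q17 q29] : [/\ reg s3 0 = n, reg s3 1 = 1, reg s3 17 = 0 & reg s3 29 = n + n].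
  by split; rewrite fr3 // fr2 // s1_z.
have [tl l4 ln] := found_bounds fd en.
have [ld lc] := Hc _ _ _ fd.
have tn : t < n.
  have [l2|l2] := leqP l 1; first by lia.
  apply: leq_trans l4; apply: leq_ltn_trans tl _.
  by rewrite -{1}[l]expn1 ltn_exp2l.
apply: runs_seq.
apply: runs_post (runs_frame (@runs_dense_rows s3 l t _ _ erefl erefl ln tn)) _ => //.
move=> s4 [st4 fr4 _ _].
apply: runs_seq.
apply: runs_post (runs_frame (@runs_all_columns s4 _ _ _ _)) _;
  rewrite ?fr4 //.
move=> s5 [[st5 lo5 s5_18] fr5 _ _].
set D := [seq v <- iota 0 n | is_dense l t v] in st4 ld.
have Dn : size D <= n by rewrite size_filter (leq_trans (count_size _ _)) ?size_iota.
have Dlt i : i < size D -> nth 0 D i < n.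
  by move=> /(mem_nth 0); rewrite mem_filter mem_iota => /and3P[].
have szR : size (take l D) = l by rewrite size_takel.
have h := @runs_extraction s5 l t (take l D) (iota 0 n).
apply: runs_weaken.
  apply: runs_post; last first.
    move=> s6 ret; exists m, l, t; split; [exact: fd|exact: ret].
  apply: h; rewrite ?size_iota // ?fr5 // ?fr4 //.
  - exact: leq_trans tl ln.
  - move=> i; have [il|il] := ltnP i l; last by rewrite nth_default ?szR //; lia.
    by rewrite nth_take // Dlt // (leq_trans il).
  - move=> i; have [il|il] := ltnP i n; first by rewrite nth_iota.
    by rewrite nth_default ?size_iota //; lia.
  - move=> i; rewrite szR => il; rewrite lo5; last by rewrite ltn_add2l (leq_trans il).
    by rewrite nth_take // st4 // (leq_trans il).
rewrite size_iota; have := leq_mul (leqnn n) lc.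
rewrite !mulnDr; move: tn ln n2; clear; lia.
Qed.

End Specs.

(** * Correctness of the greedy algorithm *)

Section Greedy.
Variables (n : nat) (G : sgraph n).

Lemma size_adjacent u L :
  size [seq v <- L | adj_query G u v == 1] = sumn [seq adj_query G u v | v <- L].
Proof.
rewrite size_filter; elim: L => //= v L ->; congr addn.
by move: (adj_query_le1 G u v); case: adj_query => [|[|]].
Qed.

Lemma size_nonadjacent u L : size [seq v <- L | adj_query G u v == 0] =
  size L - sumn [seq adj_query G u v | v <- L].
Proof.
rewrite -size_adjacent !size_filter -(count_predC (fun v => adj_query G u v == 1) L).
rewrite addnC addnK; apply: eq_count => v /=.
by move: (adj_query_le1 G u v); case: adj_query => [|[|]].
Qed.

Lemma hits_rcons R u v : hits G (rcons R u) v = hits G R v + adj_query G u v.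
Proof. by rewrite /hits map_rcons sumn_rcons. Qed.

(** The last inequality is the lower bound (t/l)^i (1-t/l)^(j-i) for the
    fraction of live columns after j rows, i of which were taken, with
    denominators cleared. It persists after t rows have been taken, because
    nothing dies any more. The third property holds because a live column is
    adjacent to every taken row and to no discarded one. *)
Lemma greedy_invariant l t L R (TL := greedy_run G l t L R) : t <= l ->
  [/\ subseq TL.1 R,
   forall u v, u \in TL.1 -> v \in TL.2 -> adj_query G u v = 1,
   size TL.1 < t -> forall v, v \in TL.2 -> hits G R v = size TL.1 &
   size L * (t ^ size TL.1 * (l - t) ^ (size R - size TL.1)) <=
     size TL.2 * l ^ size R].
Proof.
rewrite /TL => tl; elim/last_ind: R {TL} => [|R u]; first by split; rewrite //= !muln1.
have := greedy_run_size G l t L R.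
rewrite greedy_run_rcons; case: (greedy_run G l t L R) => T M /=.
move=> Tt [TR adjTM exact pot].
have szT := size_subseq TR.
rewrite /greedy_step /=; case: ltnP => [Tlt|tT].
  rewrite -size_adjacent; set M1 := [seq v <- M | _ == 1].
  have [acc|rej] := leqP (size M * t) (size M1 * l) => /=.
    split.
    - rewrite -!cats1; apply: cat_subseq => //.
    - move=> w v; rewrite mem_rcons inE mem_filter => /orP[/eqP->|wT] /andP[/eqP uv vM] //.
      exact: adjTM.
    - rewrite size_rcons => _ v; rewrite mem_filter => /andP[/eqP uv vM].
      by rewrite hits_rcons uv exact // addn1.
    - rewrite !size_rcons subSS !expnS.
      rewrite -[t * _ * _]mulnA mulnCA.
      apply: leq_trans (_ : t * (size M * l ^ size R) <= _).
        by rewrite leq_mul2l pot orbT.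
      by rewrite mulnA [t * _]mulnC mulnA leq_mul2r acc orbT.
  split=> //.
  - by apply: subseq_trans TR _; apply: subseq_rcons.
  - by move=> w v wT; rewrite mem_filter => /andP[_ vM]; exact: adjTM.
  - move=> _ v; rewrite mem_filter => /andP[/eqP uv vM].
    by rewrite hits_rcons uv exact // addn0.
  - rewrite size_nonadjacent -size_adjacent -/M1 size_rcons subSn // !expnS.
    have {}rej : size M * (l - t) <= (size M - size M1) * l.
      by rewrite mulnBr mulnBl leq_sub2l // ltnW.
    rewrite [(l - t) * _]mulnC !mulnA.
    apply: leq_trans (_ : size M * l ^ size R * (l - t) <= _).
      by rewrite leq_mul2r -mulnA pot orbT.
    by rewrite mulnAC leq_mul2r rej orbT.
split=> //.
- by apply: subseq_trans TR _; apply: subseq_rcons.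
- by rewrite ltnNge tT.
- rewrite size_rcons subSn // !expnS [(l - t) * _]mulnC [l * _]mulnC !mulnA.
  by apply: leq_mul (leq_subr _ _); rewrite -mulnA.
Qed.

(** Some columns are still alive in the end, by the invariant and t < l. Had
    fewer than t rows been taken, they would have fewer than t neighbours among
    the rows. *)
Lemma greedy_correct l t L R (TL := greedy_run G l t L R) :
  size R = l -> t < l -> 0 < size L -> (forall v, v \in L -> t <= hits G R v) ->
  [/\ size TL.1 = t, subseq TL.1 R, subseq TL.2 L,
   forall u v, u \in TL.1 -> v \in TL.2 -> adj_query G u v = 1 &
   size L * (t ^ t * (l - t) ^ (l - t)) <= size TL.2 * l ^ l].
Proof.
move=> Rl tl L0 Lt; have [TR adjT exact pot] := greedy_invariant L R (ltnW tl).
rewrite -/TL Rl in TR adjT exact pot.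
have ML : subseq TL.2 L by apply: greedy_run_sub.
have Tt : size TL.1 <= t by apply: greedy_run_size.
have eqT : size TL.1 = t.
  apply/eqP; rewrite eqn_leq Tt leqNgt; apply/negP => lt.
  have M0 : 0 < size TL.2.
    rewrite lt0n; apply/negP => /eqP M0; move: pot; rewrite M0 mul0n leqNgt.
    by rewrite !muln_gt0 L0 !expn_gt0 subn_gt0 tl (leq_ltn_trans _ lt).
  have v0 := mem_nth 0 M0.
  have := Lt _ (mem_subseq ML v0); rewrite exact // leqNgt lt //.
by split=> //; move: pot; rewrite eqT.
Qed.

(** * Counting *)

Lemma iter_scale_bound k r l x :
  iter k (fun x => x * r %/ l) x * l ^ k <= x * r ^ k.
Proof.
elim: k => [|k IH]; first by rewrite !expn0.
rewrite iterS expnS mulnA expnSr mulnA.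
apply: leq_trans (_ : iter k (fun x => x * r %/ l) x * r * l ^ k <= _).
  by rewrite leq_mul2r leq_trunc_div orbT.
by rewrite mulnAC leq_mul2r IH orbT.
Qed.

(** Positivity of the weight gives l^4 2^(l h2(t/l)) <= n in integers, because
    all roundings are downwards. *)
Lemma weight_bound l t : t <= l -> 0 < weight n l t ->
  l ^ 4 * l ^ l <= n * (t ^ t * (l - t) ^ (l - t)).
Proof.
rewrite /weight => tl; set x0 := n %/ l %/ l %/ l %/ l.
set x1 := iter t _ x0; set x2 := iter (l - t) _ x1 => x2_gt0.
have h0 : x0 * l ^ 4 <= n.
  have -> : l ^ 4 = l * (l * (l * l)) by rewrite !expnS expn0 muln1.
  by rewrite /x0 -!divnMA leq_trunc_div.
have h1 : x1 * l ^ t <= x0 * t ^ t by apply: iter_scale_bound.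
have h2 : x2 * l ^ (l - t) <= x1 * (l - t) ^ (l - t) by apply: iter_scale_bound.
have {}h2 : l ^ (l - t) <= x1 * (l - t) ^ (l - t).
  by apply: leq_trans h2; rewrite leq_pmull.
have -> : l ^ l = l ^ t * l ^ (l - t) by rewrite -expnD subnKC.
apply: leq_trans (_ : l ^ 4 * (x0 * t ^ t * (l - t) ^ (l - t)) <= _).
  rewrite leq_mul2l; apply/orP; right.
  apply: leq_trans (_ : l ^ t * (x1 * (l - t) ^ (l - t)) <= _).
    by rewrite leq_mul2l h2 orbT.
  by rewrite mulnA [l ^ t * _]mulnC leq_mul2r h1 orbT.
by rewrite -[x0 * _ * _]mulnA mulnA [l ^ 4 * _]mulnC leq_mul2r h0 orbT.
Qed.

Lemma sum_adj_query u : u < n ->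
  sumn [seq adj_query G u v | v <- iota 0 n] = degree_query G u.
Proof.
move=> un; rewrite sumnE big_map -[n in iota 0 n]subn0 -/(index_iota 0 n) big_mkord.
rewrite /degree_query insubT /degree -sum1_card [RHS]big_mkcond /=.
apply: eq_bigr => v _; rewrite /adj_query insubT valK inE.
by case: adj.
Qed.

Lemma sum_hits R : (forall u, u \in R -> u < n) ->
  sumn [seq hits G R v | v <- iota 0 n] = sumn [seq degree_query G u | u <- R].
Proof.
elim: R => [_|u R IH Rn] /=.
  by elim: (iota 0 n) => //= v s ->.
rewrite -IH; last by move=> w wR; apply: Rn; rewrite inE wR orbT.
rewrite -sum_adj_query; last by apply: Rn; rewrite inE eqxx.
rewrite /hits /=; elim: (iota 0 n) => //= v s ->; lia.
Qed.

(** Averaging: the columns receive at least (t+1) n neighbours in all, of which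
    the bad ones account for at most t n and each good one for at most l. *)
Lemma many_good_columns l t R : size R = l -> (forall u, u \in R -> u < n) ->
  t.+1 * n <= sumn [seq degree_query G u | u <- R] ->
  n <= l * size (good_columns G t R (iota 0 n)).
Proof.
move=> Rl Rn; rewrite -sum_hits //.
have hl v : hits G R v <= l by rewrite -Rl; apply: hits_le.
suff : forall s, sumn [seq hits G R v | v <- s] <=
    t * size s + l * size [seq v <- s | t <= hits G R v].
  move=> /(_ (iota 0 n)); rewrite size_iota => h1 h2.
  by have := leq_trans h2 h1; rewrite mulSn addnC [t * n]mulnC leq_add2l.
elim=> //= v s IH; case: (leqP t (hits G R v)) => tv /=.
  by rewrite !mulnS; have := hl v; lia.
by rewrite mulnS; lia.
Qed.

(** Averaging over the vertices, as for columns: a vertex that is not dense has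
    degree below (t+1) n / l, and a dense one at most n. *)
Lemma many_dense_rows l t k :
  (t + k).+1 * (n * n) <= degree_sum G * l ->
  n * k <= size [seq v <- iota 0 n | is_dense G l t v] * l.
Proof.
rewrite /degree_sum.
suff h : forall s, sumn [seq degree_query G v | v <- s] * l <=
    size s * (t.+1 * n) + n * l * size [seq v <- s | is_dense G l t v].
  move=> h1; have := leq_trans h1 (h _); rewrite size_iota.
  have -> : (t + k).+1 * (n * n) = n * (t.+1 * n) + n * (n * k) by lia.
  rewrite leq_add2l -mulnA; have [n0|n0] := posnP n.
    by move=> _; rewrite [X in X * k]n0.
  by rewrite leq_pmul2l // [l * _]mulnC.
elim=> //= v s; have := degree_query_le G v; rewrite /is_dense.
move: (t.+1 * n) (degree_query G v) => X d dn.
set S := sumn _; set D := size [seq _ <- _ | _] => IH.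
rewrite mulnDl mulSn; case: (leqP X (d * l)) => dX /=; rewrite -/D; last first.
  by move: IH (ltnW dX); clear; lia.
by rewrite mulnS; move: IH (leq_mul dn (leqnn l)); clear; lia.
Qed.

(** * Bicliques in the memory of the machine *)

Lemma card_listed (L : seq nat) : uniq L -> (forall v, v \in L -> v < n) ->
  #|[set v : 'I_n | (v : nat) \in L]| = size L.
Proof.
move=> uL Ln; rewrite cardsE.
have -> : #|[pred v : 'I_n | (v : nat) \in L]| = #|(pmap insub L : seq 'I_n)|.
  by apply: eq_card => v; rewrite inE mem_pmap_sub.
rewrite (card_uniqP (pmap_sub_uniq _ uL)) size_pmap_sub.
by apply/eqP; rewrite -all_count; apply/allP.
Qed.

Lemma listed_stored (f : nat -> nat) base L : stored f base L ->
  listed n f base (size L) = [set v : 'I_n | (v : nat) \in L].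
Proof.
move=> st; rewrite /listed; suff -> : [seq f i | i <- iota base (size L)] = L by [].
apply: (@eq_from_nth _ 0); rewrite size_map size_iota // => i iL.
by rewrite (nth_map 0) ?size_iota // nth_iota // st.
Qed.

Lemma adj_query_ord (a b : 'I_n) : adj_query G a b = adj G a b.
Proof. by rewrite /adj_query !valK. Qed.

(** The last but one hypothesis says that the fraction of the columns in L that
    the greedy algorithm is sure to keep amounts to at least t columns. The two
    sides are disjoint since no vertex is adjacent to itself. *)
Lemma returned_biclique l t (L R : seq nat) s :
  size R = l -> t < l -> uniq R -> uniq L ->
  (forall v, v \in R -> v < n) -> (forall v, v \in L -> v < n) ->
  0 < size L -> (forall v, v \in L -> t <= hits G R v) ->
  t * l ^ l <= size L * (t ^ t * (l - t) ^ (l - t)) ->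
  returned t (greedy_run G l t L R) s ->
  returns_biclique G ([::], s).
Proof.
move=> Rl tl uR uL Rn Ln L0 Lt big [s0 st1 st2].
have [Tt TR ML adjT pot] := greedy_correct Rl tl L0 Lt.
set TL := greedy_run G l t L R in s0 st1 st2 Tt TR ML adjT pot.
have tM : t <= size TL.2.
  have := leq_trans big pot; rewrite leq_pmul2r // expn_gt0.
  by rewrite (leq_ltn_trans _ tl).
rewrite /returns_biclique /out_size s0 /=.
have -> : listed n (ram s) 0 t = [set v : 'I_n | (v : nat) \in TL.1].
  by rewrite -Tt listed_stored.
have -> : listed n (ram s) t t = [set v : 'I_n | (v : nat) \in take t TL.2].
  by have := listed_stored (st2 tM); rewrite size_takel.
have adjAB (a b : 'I_n) : (a : nat) \in TL.1 -> (b : nat) \in take t TL.2 -> adj G a b.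
  move=> aT /mem_take bM; have := adjT _ _ aT bM; rewrite adj_query_ord.
  by case: adj.
apply/and4P; split.
- rewrite card_listed ?Tt ?(subseq_uniq TR) // => v /(mem_subseq TR); exact: Rn.
- rewrite card_listed ?size_takel //; first by rewrite take_uniq // (subseq_uniq ML).
  by move=> v /mem_take /(mem_subseq ML); apply: Ln.
- apply/pred0P => v /=; rewrite !inE; apply/negP => /andP[vT vM].
  by have := adjAB _ _ vT vM; rewrite adj_irr.
- by apply/forall_inP => a; rewrite inE => aT; apply/forall_inP => b; rewrite inE => bM;
    apply: adjAB.
Qed.

(** * The levels of the search *)

(** The constant 32 comes from m^3 >= 8 and al (1-al) <= 1/4. The last
    inequality makes the truncated subtraction in t a true one. *)
Lemma level_bounds a b m (l := size_of a b m) (t := side_of a b m) :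
  2 <= m -> 0 < a * (b - a) ->
  [/\ 32 <= l, m <= l, t < l, t = l * a %/ b - m * m & m * m < l * a %/ b].
Proof.
rewrite /t /l => m2 d0.
have [a0 ba0] : 0 < a /\ 0 < b - a by move: d0; rewrite muln_gt0 => /andP.
have ab : a <= b by move: ba0; rewrite subn_gt0; apply: ltnW.
have b0 : 0 < b by apply: leq_trans a0 ab.
have m8 : 8 <= m * m * m by exact: (leq_mul (leq_mul m2 m2) m2).
have bb : 4 * (a * (b - a)) <= b * b.
  by have [] := nat_AGM2 a (b - a); rewrite subnKC // mulnn.
have l32 : 32 <= size_of a b m.
  rewrite /size_of leq_divRL // -(mulnA (m * m * m)).
  by rewrite (_ : 32 = 8 * 4) // -mulnA leq_mul.
have lam : m * m < size_of a b m * a %/ b.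
  have hl : m * m * m * b * b < (size_of a b m).+1 * (a * (b - a)).
    by rewrite /size_of; apply: ltn_ceil.
  rewrite leq_divRL //; move: hl; set z := size_of a b m => hl.
  have hl2 : m * m * m * b * (b - a) < z.+1 * a * (b - a).
    rewrite -(mulnA z.+1); apply: leq_ltn_trans hl.
    by rewrite leq_mul2l leq_subr orbT.
  move: hl2; rewrite ltn_pmul2r // mulSn => hl2.
  have m3 : (m * m).+2 * b <= m * m * m * b.
    rewrite leq_mul2r; apply/orP; right; move: m2; clear; nia.
  move: m3; rewrite !mulSn; move: ab hl2; clear; lia.
split=> //; first by apply: size_of_ge; apply: leq_trans l32.
rewrite /side_of; apply: leq_trans (_ : (size_of a b m * a %/ b) <= _).
  rewrite ltn_subrL (leq_ltn_trans _ lam) // andbT muln_gt0 andbb.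
  exact: leq_trans m2.
by rewrite -[leqRHS](mulnK _ b0) leq_div2r // leq_mul.
Qed.

Lemma found_level a b m l t : found n a b m l t -> 2 <= m -> a <= b ->
  [/\ 32 <= l, m <= l, t < l, t = l * a %/ b - m * m &
   [/\ m * m < l * a %/ b, 0 < a * (b - a) & 0 < weight n l t]].
Proof.
move=> [_ fm _ lt] m2 ab; have m1 : (m == 1) = false by rewrite gtn_eqF.
rewrite m1 in lt; case: lt => -> ->.
have feas : feasible n a b m by apply: fm; rewrite m2 leqnn.
have [l0 _] := feasible_size feas.
have d0 : 0 < a * (b - a).
  by rewrite lt0n; apply/negP => /eqP d0; move: l0; rewrite /size_of d0 divn0.
by have [] := level_bounds m2 d0.
Qed.

(** The weight guarantees l^4 surviving columns out of n. Starting with c >= n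
    / (8 l^2) columns leaves l^2 / 8 of them, and this is at least 4 l > t. *)
Lemma enough_columns a b m l t c : found n a b m l t -> 2 <= m -> a <= b ->
  n <= 8 * (l * l) * c -> 0 < n -> t * l ^ l <= c * (t ^ t * (l - t) ^ (l - t)).
Proof.
move=> fd m2 ab nc n0; have [l32 _ tl _ [_ _ wt]] := found_level fd m2 ab.
have wb := weight_bound (ltnW tl) wt.
set P := t ^ t * _ in wb *.
have h : l ^ 4 * l ^ l <= 8 * (l * l) * (c * P).
  by apply: leq_trans wb _; rewrite mulnA leq_mul2r nc orbT.
have l2 : 0 < 8 * (l * l) by rewrite !muln_gt0; lia.
rewrite -(leq_pmul2l l2); apply: leq_trans h; rewrite mulnA leq_mul2r.
apply/orP; right; have -> : l ^ 4 = l * l * (l * l) by rewrite !expnS expn0 muln1 !mulnA.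
rewrite -[8 * _ * t]mulnA mulnCA leq_mul2l; apply/orP; right.
by apply: leq_mul; lia.
Qed.

(** The rows must be distinct and enough of the columns good; good columns have
    the required number of neighbours by definition. *)
Lemma sampled_biclique a b m l t (R C : seq nat) s :
  found n a b m l t -> 2 <= m -> a <= b -> 0 < n -> size R = l -> uniq R -> uniq C ->
  (forall v, v \in R -> v < n) -> (forall v, v \in C -> v < n) ->
  n <= 8 * (l * l) * size (good_columns G t R C) ->
  returned t (greedy_run G l t (good_columns G t R C) R) s ->
  returns_biclique G ([::], s).
Proof.
move=> fd m2 ab n0 Rl uR uC Rn Cn nS.
have [l32 _ tl _ _] := found_level fd m2 ab.
apply: returned_biclique => //.
- exact: filter_uniq.
- by move=> v; rewrite mem_filter => /andP[_]; exact: Cn.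
- by rewrite lt0n; apply/negP => /eqP S0; move: nS; rewrite S0 muln0 leqNgt n0.
- by move=> v; rewrite mem_filter => /andP[].
- exact: enough_columns fd m2 ab nS n0.
Qed.

(** The number t falls short of the average number al l of neighbours among l
    vertices by m^2. So there are at least (m^2 - 1) n / l dense vertices,
    which is at least l because l^2 <= n. *)
Lemma dense_rows_exist m l t :
  found n (degree_sum G) (n * n) m l t -> 2 <= m -> degree_sum G <= n * n -> 0 < n ->
  l <= size [seq v <- iota 0 n | is_dense G l t v].
Proof.
move=> fd m2 ab n0; have [l32 _ tl tE [lam d0 _]] := found_level fd m2 ab.
have [_ l4 _] := found_bounds fd ab.
set D := size _.
have m4 : 4 <= m * m by exact: (leq_mul m2 m2).
have h : n * (m * m).-1 <= D * l.
  apply: many_dense_rows.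
  have -> : (t + (m * m).-1).+1 = l * degree_sum G %/ (n * n).
    by move: m4 lam tE; clear; lia.
  by apply: leq_trans (leq_trunc_div _ _) _; rewrite mulnC.
have l0 : 0 < l by lia.
rewrite -(leq_pmul2r l0); apply: leq_trans h.
apply: (@leq_trans n); last by rewrite leq_pmulr //; move: m4; clear; lia.
by apply: leq_trans l4; rewrite mulnn leq_pexp2l.
Qed.

(** All n vertices serve as columns here, and at least n / l of them are good
    because each row has degree at least (t+1) n / l. *)
Lemma dense_biclique m l t s (R := take l [seq v <- iota 0 n | is_dense G l t v]) :
  found n (degree_sum G) (n * n) m l t -> 2 <= m -> degree_sum G <= n * n -> 0 < n ->
  returned t (greedy_run G l t (good_columns G t R (iota 0 n)) R) s ->
  returns_biclique G ([::], s).
Proof.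
move=> fd m2 ab n0; have ld := dense_rows_exist fd m2 ab n0.
have [l32 _ tl tE _] := found_level fd m2 ab.
have Rl : size R = l by rewrite size_takel.
have Rn v : v \in R -> v < n.
  by move=> /mem_take; rewrite mem_filter mem_iota => /and3P[].
have nS : n <= l * size (good_columns G t R (iota 0 n)).
  apply: many_good_columns => //.
  have l0 : 0 < l by move: l32; clear; lia.
  have h r : all (is_dense G l t) r ->
      t.+1 * n * size r <= sumn [seq degree_query G u | u <- r] * l.
    elim: r => [|v r IH] /=; first by rewrite muln0.
    by move=> /andP[dv /IH]; rewrite mulnS mulnDl; apply: leq_add.
  rewrite -(leq_pmul2r l0) -{1}Rl; apply: h.
  by apply/allP => v /mem_take; rewrite mem_filter => /andP[].
apply: (sampled_biclique fd m2 ab n0 Rl _ (iota_uniq _ _) Rn).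
- by rewrite take_uniq // filter_uniq // iota_uniq.
- by move=> v; rewrite mem_iota.
- by apply: leq_trans nS _; rewrite leq_mul2r; apply/orP; right; move: l32; clear; nia.
Qed.

End Greedy.

Local Open Scope ring_scope.

(** * Entropy *)

Section Entropy.
Variable R : realType.
Implicit Types (q g e x : R).

(** The binary entropy in nats: h2 up to the factor ln 2. *)
Definition entropy (x : R) : R := - x * ln x - (1 - x) * ln (1 - x).

Lemma lnB x y : 0 < x -> 0 < y -> ln (x / y) = ln x - ln y :> R.
Proof. by move=> x0 y0; rewrite lnM ?posrE ?invr_gt0 // lnV ?posrE. Qed.

Lemma ln_le_sub1 x : 0 < x -> ln x <= x - 1.
Proof.
move=> x0; rewrite -[in ln x](subrK 1 x) addrC.
by apply: le_ln1Dx; lra.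
Qed.

(** Nonnegativity of the relative entropy of q with respect to g, from ln x <=
    x - 1. *)
Lemma gibbs q g : 0 < q < 1 -> 0 < g < 1 ->
  entropy q <= - q * ln g - (1 - q) * ln (1 - g).
Proof.
move=> /andP[q0 q1] /andP[g0 g1]; rewrite /entropy.
have key x y : 0 < x -> 0 < y -> x * ln y - x * ln x <= y - x.
  move=> x0 y0; rewrite -mulrBr -lnB //.
  have := ln_le_sub1 (divr_gt0 y0 x0); rewrite -(ler_pM2l x0) => h.
  by apply: le_trans h _; rewrite mulrBr mulr1 mulrCA divff ?gt_eqF // mulr1.
have := key q g q0 g0; have := key (1 - q) (1 - g); lra.
Qed.

Lemma lnNge0 x : 0 < x < 1 -> 0 <= - ln x.
Proof. by move=> /andP[x0 x1]; rewrite oppr_ge0 ln_le0 // ltW. Qed.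

Lemma entropy_ge0 x : 0 < x < 1 -> 0 <= entropy x.
Proof.
move=> /andP[x0 x1]; rewrite /entropy.
have h1 : 0 <= - ln x by apply: lnNge0; rewrite x0.
have h2 : 0 <= - ln (1 - x) by apply: lnNge0; lra.
by nra.
Qed.

(** The term - x ln x alone suffices, as - ln x >= 1 - x. *)
Lemma entropy_ge x : 0 < x < 1 -> x * (1 - x) <= entropy x.
Proof.
move=> /andP[x0 x1]; rewrite /entropy.
have h1 := ln_le_sub1 x0.
have h2 : ln (1 - x) <= 0 by rewrite ln_le0; lra.
by nra.
Qed.

Lemma entropy_gt0 x : 0 < x < 1 -> 0 < entropy x.
Proof.
move=> x01; apply: lt_le_trans (entropy_ge x01).
by move: x01 => /andP[? ?]; apply: mulr_gt0; lra.
Qed.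

(** Gibbs' inequality against the uniform distribution. *)
Lemma entropy_le_ln2 x : 0 < x < 1 -> entropy x <= ln 2.
Proof.
move=> x01; have := @gibbs x 2^-1 x01.
have -> : 1 - 2^-1 = 2^-1 :> R by lra.
rewrite lnV ?posrE // => /(_ _); lra.
Qed.

(** Each of the two terms is bounded by x (1-x) times 1 plus a logarithm, using
    1 - 1/y <= ln y. *)
Lemma entropy_le x : 0 < x < 1 ->
  entropy x <= x * (1 - x) * (2 - ln (x * (1 - x))).
Proof.
move=> /andP[x0 x1]; rewrite /entropy.
have key (y : R) : 0 < y -> y < 1 -> - y * ln y <= y * (1 - y) * (1 - ln y).
  move=> y0 y1; have := @ln_le_sub1 y^-1; rewrite invr_gt0 => /(_ y0).
  rewrite lnV ?posrE // -(ler_pM2l y0) mulrBr mulfV ?gt_eqF // => h.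
  have y1' : 0 <= 1 - y by lra.
  have := ler_wpM2l y1' h.
  have l0 : 0 <= - ln y by apply: lnNge0; rewrite y0.
  by nra.
have h1 := key x x0 x1.
have h2 : - (1 - x) * ln (1 - x) <= (1 - x) * (1 - (1 - x)) * (1 - ln (1 - x)).
  by apply: key; lra.
by rewrite lnM ?posrE //; lra.
Qed.

(** Measuring the error against the variance g (1-g) controls the relative
    errors of q and of 1-q at the same time (closeP), as the two terms of the
    entropy require. *)
Definition close e q g : Prop := `|q - g| <= e * (g * (1 - g)).

Lemma closeP e q g : 0 <= e -> 0 < g < 1 -> close e q g ->
  [/\ (1 - e) * g <= q, q <= (1 + e) * g,
   (1 - e) * (1 - g) <= 1 - q & 1 - q <= (1 + e) * (1 - g)].
Proof.
move=> e0 /andP[g0 g1]; rewrite /close ler_norml => /andP[h1 h2].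
have k1 : e * (g * (1 - g)) <= e * g by nra.
have k2 : e * (g * (1 - g)) <= e * (1 - g) by nra.
by split; lra.
Qed.

(** By Gibbs' inequality the entropy of q is at most the cross entropy, which
    is linear in q; there q and 1-q can be replaced with g and 1-g. *)
Lemma close_entropy_le e q g : 0 <= e -> 0 < g < 1 -> 0 < q < 1 -> close e q g ->
  entropy q <= (1 + e) * entropy g.
Proof.
move=> e0 g01 q01 c; have [_ k1 _ k2] := closeP e0 g01 c.
apply: le_trans (gibbs q01 g01) _; rewrite /entropy.
have := lnNge0 g01; have /lnNge0 : 0 < 1 - g < 1 by lra.
by nra.
Qed.

(** Gibbs' inequality again, with the roles of q and g exchanged. *)
Lemma close_entropy_ge e q g : 0 <= e -> 0 < g < 1 -> 0 < q < 1 -> close e q g ->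
  (1 - e) * entropy g <= entropy q.
Proof.
move=> e0 g01 q01 c; have [k1 _ k2 _] := closeP e0 g01 c.
have [e1|e1] := leP 1 e.
  have := entropy_ge0 g01; have := entropy_ge0 q01; nra.
have := gibbs g01 q01; rewrite -(ler_pM2l (_ : 0 < 1 - e)); last by lra.
move=> h; apply: le_trans h _; rewrite /entropy.
have := lnNge0 q01; have /lnNge0 : 0 < 1 - q < 1 by lra.
by nra.
Qed.

(** The variance of a is at most (1 + e2)^2 <= 4 times that of g. *)
Lemma close_trans e1 e2 q a g : 0 <= e1 -> 0 <= e2 -> 0 < g < 1 -> e2 <= 1 ->
  close e1 q a -> close e2 a g -> close (4 * e1 + e2) q g.
Proof.
move=> e10 e20 g01 e21 c1 c2; have [_ k1 _ k2] := closeP e20 g01 c2.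
rewrite /close -(subrKA a); apply: le_trans (ler_normD _ _) _.
rewrite mulrDl; apply: lerD => //; apply: le_trans c1 _.
move: g01 => /andP[g0 g1].
rewrite [4 * _]mulrC -mulrA ler_wpM2l //.
have [a0|a0] := leP a 0; first by nra.
have [a1|a1] := leP 1 a; first by nra.
have : a * (1 - a) <= (1 + e2) * g * ((1 + e2) * (1 - g)) by apply: ler_pM; lra.
have s : (1 + e2) * (1 + e2) <= 4 by nra.
have p : 0 <= g * (1 - g) by nra.
by have := ler_wpM2r p s; lra.
Qed.

Lemma close_variance e a g : 0 <= e <= 2^-1 -> 0 < g < 1 -> close e a g ->
  0 < a < 1 /\ g * (1 - g) <= 4 * (a * (1 - a)).
Proof.
move=> /andP[e0 e1] g01 c; have [k1 _ k3 _] := closeP e0 g01 c.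
have /andP[g0 g1] := g01.
have a0 : 0 < a by apply: lt_le_trans k1; apply: mulr_gt0; lra.
have a1 : 0 < 1 - a by apply: lt_le_trans k3; apply: mulr_gt0; lra.
split; first by rewrite a0; lra.
have h : (1 - e) * g * ((1 - e) * (1 - g)) <= a * (1 - a).
  by apply: ler_pM => //; apply: mulr_ge0; lra.
have p0 : 0 < g * (1 - g) by rewrite mulr_gt0 // subr_gt0.
have h2 : 1 <= 4 * ((1 - e) * (1 - e)) by nra.
have := ler_wpM2r (ltW p0) h2; lra.
Qed.

(** The constant 9 is 4 * 2 + 1, from close_trans. *)
Lemma close_weaken e e1 q a g : 0 < e <= 18^-1 -> 0 <= e1 <= 2 * e -> 0 < g < 1 ->
  close e1 q a -> close e a g -> close (9 * e) q g.
Proof.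
move=> /andP[e0 e18] /andP[e10 e1e] g01 c ce; have /andP[g0 g1] := g01.
have el1 : e <= 1 by lra.
have := close_trans e10 (ltW e0) g01 el1 c ce.
rewrite /close => h; apply: le_trans h _; rewrite ler_wpM2r //; last by lra.
by apply: mulr_ge0; lra.
Qed.

(** In the application q = t/l, L = ln n and Z = l entropy g, so that q Z /
    entropy g is t and g L / entropy g is the expected size. This lemma and the
    next one collect the relative errors into the single constant 36. *)
Lemma estimate_low e q g L Z : 0 < e <= 18^-1 -> 0 < g -> 0 < L -> 0 <= Z ->
  (1 - 9 * e) * g <= q -> (1 - e) * L <= Z * (1 + 5 * e) * (1 + 9 * e) ->
  (1 - 36 * e) * (g * L) <= q * Z.
Proof.
move=> /andP[e0 e18] g0 L0 Z0 c1 lo.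
have lo1 : (1 - 36 * e) * L <= (1 - 9 * e) * Z.
  pose c := (1 + 5 * e) * (1 + 9 * e).
  have c0 : 0 < c by apply: mulr_gt0; lra.
  have hc : (1 - 36 * e) * c <= (1 - 9 * e) * (1 - e) by rewrite /c; nra.
  rewrite -(ler_pM2r c0).
  have := ler_wpM2r (ltW L0) hc.
  have e91 : 0 <= 1 - 9 * e by lra.
  by have := ler_wpM2l e91 lo; rewrite /c; clear; lra.
have := ler_wpM2l (ltW g0) lo1; have := ler_wpM2r Z0 c1; clear; lra.
Qed.

Lemma estimate_high e q g L Z : 0 < e <= 18^-1 -> 0 < g -> 0 < L -> 0 <= Z ->
  q <= (1 + 9 * e) * g -> (1 - 9 * e) * Z <= L ->
  q * Z <= (1 + 36 * e) * (g * L).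
Proof.
move=> /andP[e0 e18] g0 L0 Z0 c2 lH.
have hi : (1 + 9 * e) * Z <= (1 + 36 * e) * L.
  have hc : 1 + 9 * e <= (1 + 36 * e) * (1 - 9 * e) by nra.
  have e36 : 0 <= 1 + 36 * e by lra.
  by have := ler_wpM2r Z0 hc; have := ler_wpM2l e36 lH; clear; lra.
have := ler_wpM2l (ltW g0) hi; have := ler_wpM2r Z0 c2; clear; lra.
Qed.

End Entropy.

(** * The weight of a level *)

Section Levels.
Variable R : realType.
Local Notation ln := (@ln R).
Local Notation "n %:R" := (n%:R : R).

(** The number l entropy (t/l), in a form without quotients. *)
Definition nat_entropy (l t : nat) : R :=
  l%:R * ln l%:R - t%:R * ln t%:R - (l - t)%:R * ln (l - t)%:R.

Lemma nat_entropyE l t : (0 < t < l)%N ->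
  nat_entropy l t = l%:R * entropy (t%:R / l%:R : R).
Proof.
move=> /andP[t0 tl]; have l0 : (0 < l)%N by apply: leq_trans tl.
have l0R : 0 < l%:R :> R by rewrite ltr0n.
have t0R : 0 < t%:R :> R by rewrite ltr0n.
have d0R : 0 < (l - t)%:R :> R by rewrite ltr0n subn_gt0.
have lne : l%:R != 0 :> R by rewrite gt_eqF.
have e : 1 - t%:R / l%:R = (l - t)%:R / l%:R :> R.
  by rewrite natrB ?(ltnW tl) // mulrBl divff.
rewrite /entropy e !lnB // /nat_entropy {1}(_ : l%:R = t%:R + (l - t)%:R).
  by field.
by rewrite -natrD subnKC // ltnW.
Qed.

Lemma ln_weights (n l t : nat) : (0 < t < l)%N -> (0 < n)%N ->
  ln (n%:R * (t%:R ^+ t * (l - t)%:R ^+ (l - t))) - ln (l%:R ^+ l) =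
  ln n%:R - nat_entropy l t.
Proof.
move=> /andP[t0 tl] n0; have l0 : (0 < l)%N by apply: leq_trans tl.
have l0R : 0 < l%:R :> R by rewrite ltr0n.
have t0R : 0 < t%:R :> R by rewrite ltr0n.
have d0R : 0 < (l - t)%:R :> R by rewrite ltr0n subn_gt0.
have n0R : 0 < n%:R :> R by rewrite ltr0n.
rewrite !lnM ?posrE ?mulr_gt0 ?exprn_gt0 // !lnXn ?posrE //.
by rewrite /nat_entropy !mulr_natl; ring.
Qed.

(** A positive weight means that 2^(l h2(t/l)) is at most n. *)
Lemma weight_entropy (n l t : nat) : (0 < t < l)%N -> (0 < weight n l t)%N ->
  nat_entropy l t <= ln n%:R.
Proof.
move=> tl w0; have /andP[t0 tl'] := tl; have l0 : (0 < l)%N by apply: leq_trans tl'.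
have wb := weight_bound (ltnW tl') w0.
have n0 : (0 < n)%N.
  rewrite lt0n; apply/negP => /eqP n0; move: wb.
  by rewrite n0 mul0n leqNgt muln_gt0 !expn_gt0 l0.
rewrite -subr_ge0 -(ln_weights tl n0) subr_ge0 ler_ln ?posrE.
- rewrite -!natrX -!natrM ler_nat; apply: leq_trans wb.
  by rewrite leq_pmull // expn_gt0 l0.
- by rewrite exprn_gt0 // ltr0n.
- by rewrite !mulr_gt0 ?exprn_gt0 ?ltr0n // subn_gt0.
Qed.

Lemma divn_gtr (x l : nat) : (0 < l)%N -> x%:R / l%:R - 1 <= (x %/ l)%:R :> R.
Proof.
move=> l0; rewrite lerBlDr ler_pdivrMr ?ltr0n // natr1 -natrM ler_nat.
by rewrite mulSnr; have := ltn_ceil x l0; rewrite mulSnr => /ltnW.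
Qed.

Lemma iter_scale_ge k r l x : (r <= l)%N -> (0 < l)%N ->
  x%:R * (r%:R / l%:R) ^+ k - k%:R <= (iter k (fun x => x * r %/ l)%N x)%:R :> R.
Proof.
move=> rl l0; elim: k => [|k IH]; first by rewrite expr0 mulr1 subr0.
apply: le_trans (divn_gtr _ l0); rewrite natrM -mulrA.
set rho := r%:R / l%:R in IH *.
have rho0 : 0 <= rho by rewrite divr_ge0.
have rho1 : rho <= 1 by rewrite ler_pdivrMr ?ltr0n // mul1r ler_nat.
have := ler_wpM2r rho0 IH; rewrite mulrBl -mulrA -exprSr -natr1.
have : k%:R * rho <= k%:R by rewrite ler_piMr.
by lra.
Qed.

(** The rounding errors of the weight are at most one unit for each of the l +
    1 divisions, if the first four count as one. So weight 0 implies that (n /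
    l^4) 2^(-l h2(t/l)) is at most l + 1, which is a polynomial loss. *)
Lemma weight0_entropy (n l t : nat) : (0 < t < l)%N -> (0 < n)%N ->
  weight n l t = 0%N -> ln n%:R - nat_entropy l t <= 5 * ln l.+1%:R.
Proof.
move=> tl n0 w0; have /andP[t0 tl'] := tl; have l0 : (0 < l)%N by apply: leq_trans tl'.
have l0R : 0 < l%:R :> R by rewrite ltr0n.
set p := t%:R / l%:R : R; set q := (l - t)%:R / l%:R : R.
have p01 : 0 < p <= 1.
  by rewrite divr_gt0 ?ltr0n //= ler_pdivrMr // mul1r ler_nat ltnW.
have q01 : 0 < q <= 1.
  by rewrite divr_gt0 ?ltr0n ?subn_gt0 //= ler_pdivrMr // mul1r ler_nat leq_subr.
have [/andP[p0 p1] /andP[q0 q1]] := (p01, q01).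
have pk k : 0 < p ^+ k <= 1 by rewrite exprn_gt0 // exprn_ile1 // ltW.
have qk k : 0 < q ^+ k <= 1 by rewrite exprn_gt0 // exprn_ile1 // ltW.
set x0 := (n %/ l %/ l %/ l %/ l)%N.
have x0E : n%:R / l%:R ^+ 4 - 1 <= x0%:R :> R.
  have -> : x0 = (n %/ (l ^ 4))%N.
    by rewrite /x0 -!divnMA !expnS expn0 muln1.
  by rewrite -natrX; apply: divn_gtr; rewrite expn_gt0 l0.
have h1 := iter_scale_ge t x0 (ltnW tl') l0.
set x1 := iter t _ x0 in h1.
have h2 := iter_scale_ge (l - t) x1 (leq_subr t l) l0.
move: w0; rewrite /weight -/x0 -/x1 => w0; rewrite w0 in h2.
have hP : n%:R / l%:R ^+ 4 * (p ^+ t * q ^+ (l - t)) <= l.+1%:R.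
  have /andP[pt0 pt1] := pk t; have /andP[qt0 qt1] := qk (l - t)%N.
  have e1 : n%:R / l%:R ^+ 4 * p ^+ t <= x1%:R + t%:R + 1.
    have := ler_wpM2r (ltW pt0) x0E; rewrite mulrBl mul1r -/p in h1 *; lra.
  have e2 : (x1%:R + t%:R + 1) * q ^+ (l - t) <= l.+1%:R.
    have ll : l.+1%:R = t%:R + (l - t)%:R + 1 :> R by rewrite -natrD subnKC ?natr1 // ltnW.
    have : (t%:R + 1) * q ^+ (l - t) <= t%:R + 1 by rewrite ler_piMr.
    by rewrite ll -/q in h2 *; lra.
  by apply: le_trans e2; rewrite mulrA ler_wpM2r // ltW.
have t0R : 0 < t%:R :> R by rewrite ltr0n.
have d0R : 0 < (l - t)%:R :> R by rewrite ltr0n subn_gt0.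
have n0R : 0 < n%:R :> R by rewrite ltr0n.
rewrite -ln_weights // -lnB ?mulr_gt0 ?exprn_gt0 //.
have -> : 5 * ln l.+1%:R = ln (l.+1%:R ^+ 5) by rewrite lnXn ?posrE // mulr_natl.
have PE : p ^+ t * q ^+ (l - t) =
    t%:R ^+ t * (l - t)%:R ^+ (l - t) / l%:R ^+ l.
  have -> : l%:R ^+ l = l%:R ^+ t * l%:R ^+ (l - t) :> R.
    by rewrite -exprD subnKC // ltnW.
  by rewrite !expr_div_n invfM mulrACA.
rewrite ler_ln ?posrE ?divr_gt0 ?mulr_gt0 ?exprn_gt0 //.
rewrite -mulrA -PE; move: hP; rewrite mulrAC ler_pdivrMr ?exprn_gt0 // => hP.
apply: le_trans hP _; rewrite [l.+1%:R ^+ 5]exprS ler_pM2l ?ltr0n //.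
by rewrite lerXn2r ?nnegrE // ler_nat.
Qed.

Lemma frac01 (u v : nat) : (0 < u < v)%N -> 0 < (u%:R / v%:R : R) < 1.
Proof.
move=> /andP[u0 uv]; have v0 : (0 < v)%N by apply: leq_trans uv.
by rewrite divr_gt0 ?ltr0n //= ltr_pdivrMr ?ltr0n // mul1r ltr_nat.
Qed.

(** The relation of l and t to al is exact up to rounding; subtracting m^2 from
    al l moves t/l by m^2 / l, about al (1-al) / m. *)
Lemma level_real a b m (l := size_of a b m) (t := side_of a b m)
    (al := a%:R / b%:R : R) : (2 <= m)%N -> (0 < a * (b - a))%N ->
  [/\ 0 < al < 1, l%:R * (al * (1 - al)) <= m%:R ^+ 3,
   m%:R ^+ 3 <= (l%:R + 1) * (al * (1 - al)), (0 < t < l)%N &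
   close (2 / m%:R) (t%:R / l%:R) al].
Proof.
move=> m2 d0; have [l32 ml tl tE lam] := level_bounds m2 d0.
rewrite -/l -/t in l32 ml tl tE lam.
have [a0 ba0] : (0 < a)%N /\ (0 < b - a)%N by move: d0; rewrite muln_gt0 => /andP.
have ab : (a < b)%N by rewrite -subn_gt0.
have a0R : 0 < a%:R :> R by rewrite ltr0n.
have b0R : 0 < b%:R :> R by rewrite ltr0n (leq_trans _ ab).
have d0R : 0 < (b - a)%:R :> R by rewrite ltr0n.
have al1 : 1 - al = (b - a)%:R / b%:R.
  by rewrite natrB ?(ltnW ab) // mulrBl divff // gt_eqF.
have al0 : 0 < al by rewrite divr_gt0.
have al10 : 0 < 1 - al by rewrite al1 divr_gt0.
have sE : al * (1 - al) = (a * (b - a))%:R / (b * b)%:R.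
  by rewrite al1 mulrACA -invfM !natrM.
have bb0 : 0 < (b * b)%:R :> R by rewrite natrM mulr_gt0.
have F1 : l%:R * (al * (1 - al)) <= m%:R ^+ 3.
  rewrite sE mulrA ler_pdivrMr // -natrX -!natrM ler_nat.
  apply: leq_trans (leq_trunc_div _ _) _.
  by rewrite !expnS expn0 muln1 !mulnA.
have F2 : m%:R ^+ 3 <= (l%:R + 1) * (al * (1 - al)).
  rewrite sE mulrA ler_pdivlMr // natr1 -natrX -!natrM ler_nat.
  have := ltn_ceil (m * m * m * b * b) d0; rewrite -/(size_of a b m) -/l => /ltnW.
  by rewrite !expnS expn0 muln1 !mulnA.
have l0R : 0 < l%:R :> R by rewrite ltr0n (leq_trans _ l32).
have tlo : t%:R + m%:R ^+ 2 <= l%:R * al.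
  rewrite mulrA ler_pdivlMr // -natrX -natrD -!natrM ler_nat.
  have -> : (t + m ^ 2 = l * a %/ b)%N by rewrite expnS expn1 tE subnK // ltnW.
  exact: leq_trunc_div.
have thi : l%:R * al <= t%:R + m%:R ^+ 2 + 1.
  rewrite mulrA ler_pdivrMr // -natrX -natrD natr1 -!natrM ler_nat.
  have -> : (t + m ^ 2 = l * a %/ b)%N by rewrite expnS expn1 tE subnK // ltnW.
  by apply: ltnW; apply: ltn_ceil; apply: leq_trans ab.
have m2R : 2 <= m%:R :> R by rewrite (ler_nat _ 2).
split=> //; first by apply/andP; split; lra.
- by rewrite tl andbT tE subn_gt0.
- rewrite /close distrC ger0_norm; last first.
    rewrite subr_ge0 ler_pdivrMr //; have : 0 <= m%:R ^+ 2 :> R by exact: sqr_ge0.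
    by lra.
  have s4 : al * (1 - al) <= 4^-1.
    by have := sqr_ge0 (al - 2^-1); rewrite expr2; lra.
  set s := al * (1 - al) in F1 F2 s4 *.
  have lt : l%:R * (t%:R / l%:R) = t%:R :> R by rewrite mulrC divfK // gt_eqF.
  rewrite -(ler_pM2l l0R) mulrBr lt.
  have -> : l%:R * (2 / m%:R * s) = (2 * (l%:R * s)) / m%:R by rewrite mulrAC; ring.
  rewrite ler_pdivlMr; last by lra.
  apply: (@le_trans _ _ ((m%:R ^+ 2 + 1) * m%:R)).
    by rewrite ler_pM2r; lra.
  have : 1 <= m%:R ^+ 3 - m%:R :> R.
    rewrite exprS expr2; set y := m%:R : R in m2R *; nra.
  rewrite !exprS expr0 in F2 *; lra.
Qed.

(** If the search stopped below level K, the level m+1 <= K would have weight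
    0. There l is at most of the order K^3 / (g (1-g)), while its product with
    the entropy, which is about g (1-g) (2+D), is O(K^3 (2+D)); so
    weight0_entropy would bound ln n by the left-hand side of the last
    hypothesis. *)
Lemma search_level n a b m l t (K : nat) (g e : R) (D := - ln (g * (1 - g))) :
  found n a b m l t -> (a <= b)%N -> (0 < n)%N -> 0 < g < 1 -> 0 <= e <= 2^-1 ->
  close e (a%:R / b%:R) g ->
  12 * K%:R ^+ 3 * (2 + D) + 5 * (ln (5 * K%:R ^+ 3) + D) < ln n%:R -> (K <= m)%N.
Proof.
move=> [m0 _ nf _] ab n0 g01 /andP[e0 e1] ce big; rewrite leqNgt; apply/negP => mK.
have /andP[g0 g1] := g01.
have e01 : 0 <= e <= 2^-1 by rewrite e0.
have [/andP[al0 al1] s4] := close_variance e01 g01 ce.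
set al := a%:R / b%:R in ce al0 al1 s4.
have d0 : (0 < a * (b - a))%N.
  rewrite muln_gt0; apply/andP; split.
    by rewrite lt0n; apply/negP => /eqP a0; move: al0; rewrite /al a0 mul0r ltxx.
  rewrite subn_gt0 ltn_neqAle ab andbT; apply/negP => /eqP abE; move: al0 al1.
  rewrite /al abE; have [->|b0] := posnP b; first by rewrite mul0r ltxx.
  by rewrite divff ?ltxx // pnatr_eq0 -lt0n.
have m2 : (2 <= m.+1)%N by [].
have [al01 F1 F2 tl cq] := level_real m2 d0.
rewrite -/al in al01 F1 F2 cq.
move: nf; rewrite /feasible -eqn0Ngt => /eqP /(weight0_entropy tl n0).
rewrite nat_entropyE //; set l' := size_of a b m.+1 in F1 F2 tl cq *.
set q := (side_of a b m.+1)%:R / l'%:R in cq *; move=> key.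
have l0 : 0 < l'%:R :> R by rewrite ltr0n; case/andP: tl => /ltn_trans; apply.
have q01 : 0 < q < 1 by apply: frac01.
have m2R : 2 <= m.+1%:R :> R by rewrite (ler_nat _ 2).
have my : 2 / m.+1%:R <= 1 :> R by rewrite ler_pdivrMr ?mul1r //; lra.
have my0 : 0 <= 2 / m.+1%:R :> R by rewrite divr_ge0.
have Ha0 := entropy_ge0 al01; have Hg0 := entropy_ge0 g01.
have Hq : entropy q <= 2 * entropy al.
  apply: le_trans (close_entropy_le my0 al01 q01 cq) _.
  by rewrite ler_wpM2r // -lerBrDl; apply: le_trans my _; clear; lra.
have Ha : entropy al <= 2^-1 * 3 * entropy g.
  apply: le_trans (close_entropy_le e0 g01 al01 ce) _.
  by rewrite ler_wpM2r //; move: e1; clear; lra.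
have Hg := entropy_le g01; pose p := g * (1 - g); rewrite -/p in Hg s4.
have DE : D = - ln p by [].
have p0 : 0 < p by rewrite mulr_gt0 // subr_gt0.
have p1 : p <= 1 by rewrite /p; move: g0 g1; clear; nra.
have mK3 : m.+1%:R ^+ 3 <= K%:R ^+ 3 :> R.
  by rewrite lerXn2r ?nnegrE // ler_nat.
have lp : l'%:R * p <= 4 * K%:R ^+ 3.
  by have := ler_wpM2l (ltW l0) s4; move: F1 mK3; clear; lra.
have D0 : 0 <= D by rewrite DE oppr_ge0 ln_le0.
have Hq3 : entropy q <= 3 * (p * (2 + D)).
  by rewrite -DE in Hg; move: Hq Ha Hg; clear; lra.
have e1' : l'%:R * entropy q <= 12 * K%:R ^+ 3 * (2 + D).
  have D2 : 0 <= 2 + D by rewrite addr_ge0.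
  have := ler_wpM2r D2 lp; have := ler_wpM2l (ltW l0) Hq3; clear; lra.
have K1 : 1 <= K%:R ^+ 3 :> R.
  by rewrite exprn_ege1 // ler1n (leq_trans _ mK).
have l1 : l'.+1%:R <= 5 * K%:R ^+ 3 / p.
  by rewrite ler_pdivlMr // -natr1 mulrDl mul1r; move: lp p1 K1; clear; lra.
have e2 : ln l'.+1%:R <= ln (5 * K%:R ^+ 3) + D.
  rewrite DE -lnB ?mulr_gt0 ?subr_gt0 ?exprn_gt0 ?ltr0n ?(leq_trans _ mK) //.
  rewrite ler_ln ?posrE ?divr_gt0 ?mulr_gt0 ?subr_gt0 ?exprn_gt0 ?ltr0n ?(leq_trans _ mK) //.
by move: key e1' e2 big; clear; lra.
Qed.

(** Level m has positive weight, so l H(t/l) <= ln n; level m+1 has weight 0,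
    so l' H(t'/l') >= ln n - 5 ln (l'+1) for its parameters l' and t'. Here l'
    <= (1+e)^4 l since (m+1)^3 / m^3 is close to 1, and both entropies are
    close to H(g) because t/l and t'/l' are close to g. Hence l H(g) is ln n up
    to a factor 1 + O(e), and so is t H(g) compared with g ln n. The last two
    hypotheses say that n is large compared with K and with 1/(g (1-g)). *)
Lemma search_estimate n a b m l t (K : nat) (g e : R) (D := - ln (g * (1 - g)))
    (X := g * ln n%:R / entropy g) :
  found n a b m l t -> (a <= b)%N -> (0 < n)%N -> 0 < g < 1 -> 0 < e <= 18^-1 ->
  close e (a%:R / b%:R) g -> e^-1 <= K%:R ->
  12 * K%:R ^+ 3 * (2 + D) + 5 * (ln (5 * K%:R ^+ 3) + D) < ln n%:R ->
  5 * (ln (6 * ln n%:R) + D) <= e * ln n%:R ->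
  [/\ (K <= m)%N, `|t%:R - X| <= 36 * e * X & l%:R * entropy g <= 2 * ln n%:R].
Proof.
move=> fd ab n0 g01 /andP[e0 e18] ce eK big1 big2.
have ee : 0 <= e <= 2^-1 by lra.
have Km := search_level fd ab n0 g01 ee ce big1.
have K18 : 18 <= K%:R :> R.
  apply: le_trans eK; rewrite -[leLHS]invrK lef_pV2 ?posrE //.
have m2 : (2 <= m)%N.
  by apply: leq_trans Km; rewrite -(ler_nat R); lra.
have [l32 ml tl' _ [_ d0 wt]] := found_level fd m2 ab.
have [_ _ nf] := fd; rewrite gtn_eqF // => -[lE tE].
have [al01 F1 F2 tl cq] := level_real m2 d0.
have m3 : (2 <= m.+1)%N by apply: ltnW.
have [_ G1 G2 tl1 cq1] := level_real m3 d0.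
rewrite -lE -tE in F1 F2 tl cq; set al := a%:R / b%:R in ce al01 F1 F2 cq G1 G2 cq1.
(* Primes mark the parameters of the infeasible level m+1. *)
set l' := size_of a b m.+1 in G1 G2 tl1 cq1; set t' := side_of a b m.+1 in tl1 cq1.
have We := weight_entropy tl wt.
move: nf; rewrite /feasible -eqn0Ngt => /eqP /(weight0_entropy tl1 n0).
rewrite -/l' -/t' !nat_entropyE // in We *; set q' := t'%:R / _ in cq1 *.
set q := t%:R / _ in cq We; move=> We'.
have mR : e^-1 <= m%:R by apply: le_trans eK _; rewrite ler_nat.
have m0R : 0 < m%:R :> R by rewrite ltr0n ltnW.
have ym : m%:R^-1 <= e by rewrite -[leRHS]invrK lef_pV2 ?posrE ?invr_gt0.
have y0 : 0 < m%:R^-1 :> R by rewrite invr_gt0.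
have ym1 : m.+1%:R^-1 <= m%:R^-1 :> R by rewrite lef_pV2 ?posrE ?ltr0n // ler_nat.
have y1 : 0 < m.+1%:R^-1 :> R by rewrite invr_gt0 ltr0n.
have e018 : 0 < e <= 18^-1 by rewrite e0.
have {}cq : close (9 * e) q g.
  by apply: close_weaken e018 _ g01 cq ce; rewrite divr_ge0 //= ler_pM2l.
have {}cq1 : close (9 * e) q' g.
  apply: close_weaken e018 _ g01 cq1 ce; rewrite divr_ge0 //= ler_pM2l //.
  exact: le_trans ym1 ym.
have q01 := frac01 tl; have q01' := frac01 tl1; rewrite -/q -/q' in q01 q01'.
have e9 : 0 <= 9 * e by rewrite mulr_ge0 // ltW.
have e91 : 2^-1 <= 1 - 9 * e by move: e18; clear; lra.
have Hq := close_entropy_ge e9 g01 q01 cq.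
have Hq' := close_entropy_le e9 g01 q01' cq1.
have [c1 c2 _ _] := closeP e9 g01 cq.
have l0 : 0 < l%:R :> R by rewrite ltr0n (leq_trans _ l32).
have l0' : 0 < l'%:R :> R by rewrite ltr0n; case/andP: tl1 => /ltn_trans; apply.
set H := entropy g in X Hq Hq' *; set L := ln n%:R in X big1 big2 We We' *.
have H0 : 0 < H by apply: entropy_gt0.
have Hp : g * (1 - g) <= H by apply: entropy_ge.
have tq : t%:R = q * l%:R by rewrite divfK // gt_eqF.
have lH0 : 0 < l%:R * H by rewrite mulr_gt0.
have lH : (1 - 9 * e) * (l%:R * H) <= L.
  by apply: le_trans We; rewrite mulrCA ler_wpM2l // ltW.
have lH2 : l%:R * H <= 2 * L.
  by have := ler_wpM2r (ltW lH0) e91; move: lH; clear; lra.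
have /andP[g0 g1] := g01; have p0 : 0 < g * (1 - g) by rewrite mulr_gt0 // subr_gt0.
have L0 : 0 < L by move: lH2 lH0; clear; lra.
(* Three factors 1 + e come from (m+1)^3 / m^3, the fourth one from the
   rounding of l. *)
have l'l : l'%:R <= l%:R * (1 + e) ^+ 4.
  have h1 : l'%:R * m%:R ^+ 3 <= (l%:R + 1) * m.+1%:R ^+ 3 :> R.
    have s0 : 0 < al * (1 - al).
      by case/andP: al01 => h1 h2; rewrite mulr_gt0 // subr_gt0.
    rewrite -(ler_pM2r s0); apply: (@le_trans _ _ (m.+1%:R ^+ 3 * m%:R ^+ 3)).
      by rewrite mulrAC ler_wpM2r // exprn_ge0.
    by rewrite [leLHS]mulrC [leRHS]mulrAC ler_wpM2r // exprn_ge0.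
  have me : 1 <= m%:R * e by rewrite mulrC -ler_pdivrMl // mulr1.
  have h2 : m.+1%:R <= m%:R * (1 + e) by rewrite -natr1 mulrDr mulr1 lerD2l.
  have h3 : l%:R + 1 <= l%:R * (1 + e).
    rewrite mulrDr mulr1 lerD2l; apply: le_trans me _.
    by rewrite ler_wpM2r ?ler_nat // ltW.
  have m30 : 0 < m%:R ^+ 3 :> R by rewrite exprn_gt0.
  rewrite -(ler_pM2r m30); apply: le_trans h1 _.
  have -> : l%:R * (1 + e) ^+ 4 * m%:R ^+ 3 = l%:R * (1 + e) * (m%:R * (1 + e)) ^+ 3.
    by ring.
  apply: ler_pM => //.
  by rewrite lerXn2r ?nnegrE // mulr_ge0 // addr_ge0 // ltW.
have e4 : (1 + e) ^+ 4 <= 1 + 5 * e.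
  by rewrite !exprS expr0 mulr1; move: e0 e18; clear; nra.
have {}l'l : l'%:R <= l%:R * (1 + 5 * e).
  by apply: le_trans l'l _; rewrite ler_wpM2l // ltW.
(* By l H(g) <= 2 L and g (1-g) <= H(g), the number l is at most 2 L / (g
   (1-g)), hence l' + 1 is at most 6 L / (g (1-g)). *)
have ln' : 5 * ln l'.+1%:R <= e * L.
  apply: le_trans big2; rewrite ler_pM2l //.
  rewrite /D -lnB ?mulr_gt0 ?subr_gt0 //.
  rewrite ler_ln ?posrE ?divr_gt0 ?mulr_gt0 ?subr_gt0 ?ltr0n //.
  rewrite ler_pdivlMr //; apply: (@le_trans _ _ (3 * l%:R * (g * (1 - g)))).
    rewrite ler_wpM2r ?(ltW p0) // -natr1.
    have e5 : 1 + 5 * e <= 2 by move: e18; clear; lra.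
    have := ler_wpM2l (ltW l0) e5.
    have : 1 <= l%:R :> R by rewrite ler1n (leq_trans _ l32).
    by move: l'l; clear; lra.
  by have := ler_wpM2l (ltW l0) Hp; move: lH2; clear; lra.
have XE : X * H = g * L by rewrite /X divfK // gt_eqF.
have tH : t%:R * H = q * (l%:R * H) by rewrite tq mulrA.
split=> //; rewrite ler_norml; apply/andP; split.
- rewrite -(ler_pM2r H0) mulNr mulrBl -[36 * e * X * H]mulrA XE tH.
  have lo : (1 - e) * L <= l%:R * H * (1 + 5 * e) * (1 + 9 * e).
    have := ler_wpM2l (ltW l0') Hq'.
    have Hq0 : 0 <= (1 + 9 * e) * H by apply: mulr_ge0; [exact: addr_ge0|exact: ltW].
    by have := ler_wpM2r Hq0 l'l; move: We' ln'; clear; lra.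
  by have := estimate_low e018 g0 L0 (ltW lH0) c1 lo; clear; lra.
- rewrite -(ler_pM2r H0) mulrBl -[36 * e * X * H]mulrA XE tH.
  by have := estimate_high e018 g0 L0 (ltW lH0) c2 lH; clear; lra.
Qed.

End Levels.

(** * Limits *)

Section Limits.
Local Open Scope classical_set_scope.

Lemma near_ooP (P : nat -> Prop) :
  (\forall n \near \oo, P n) <-> exists N, forall n, (N <= n)%N -> P n.
Proof.
split=> [[N _ h]|[N h]]; first by exists N => n Nn; apply: h.
by exists N.
Qed.

Variable R : realType.

Lemma ln_nat_large (A : R) : \forall n \near \oo, A <= ln n%:R.
Proof.
have [N h] := (near_ooP _).1 (nbhs_infty_ger (expR A)).
apply/near_ooP; exists N => n /h nA.
by rewrite -ler_expR lnK // posrE (lt_le_trans (expR_gt0 A)).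
Qed.

Lemma ln_le_linear (c x : R) : 0 < c -> 0 < x -> ln x <= c * x - ln c.
Proof.
move=> c0 x0; have := ln_le_sub1 (mulr_gt0 c0 x0).
by rewrite lnM ?posrE //; lra.
Qed.

Variable gamma : nat -> R.
Hypothesis dense : density_condition gamma.
Local Notation g := gamma.
Local Notation L n := (ln (n%:R : R)).
Local Notation D n := (- ln (g n * (1 - g n))).

(** The condition on the density gives ln (1/(g (1-g))) = o(ln n). *)
Lemma near_density (d : R) : 0 < d ->
  \forall n \near \oo, 0 < g n < 1 /\ D n <= d * L n.
Proof.
move=> d0; have [g01 [e [e0 ge]]] := dense.
have /cvgrPdist_le /(_ (d / 2)) := e0; rewrite divr_gt0 // => /(_ isT) ed.
near=> n.
have gn : 0 < g n < 1 by near: n.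
have /andP[g0 g1] := gn.
have g1' : 0 < 1 - g n by rewrite subr_gt0.
have en : `|0 - e n| <= d / 2 by near: n.
have L1 : 1 <= L n by near: n; exact: ln_nat_large.
have eqn : Num.max (g n)^-1 (1 - g n)^-1 = n%:R `^ e n by near: n.
have n0 : 0 < n%:R :> R.
  by rewrite ltr0n lt0n; apply/negP => /eqP n0; move: L1; rewrite n0 ln0 // ler10.
have bound x : 0 < x -> x^-1 <= n%:R `^ e n -> - ln x <= d / 2 * L n.
  move=> x0 h; rewrite -lnV ?posrE //; apply: (@le_trans _ _ (e n * L n)).
    by rewrite -ln_powR ler_ln ?posrE ?invr_gt0 ?powR_gt0.
  rewrite ler_wpM2r //; first by apply: le_trans L1.
  by move: en; rewrite sub0r normrN; apply: le_trans; apply: ler_norm.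
have h1 : - ln (g n) <= d / 2 * L n by apply: bound => //; rewrite -eqn le_max lexx.
have h2 : - ln (1 - g n) <= d / 2 * L n.
  by apply: bound => //; rewrite -eqn le_max lexx orbT.
by split=> //; rewrite lnM ?posrE //; lra.
Unshelve. all: by end_near.
Qed.

Definition scale_of (n : nat) : R := g n * L n / entropy (g n).

(** This is n^(-1/4): large enough for the sample of n pairs to be this precise
    with high probability, and small compared with g (1-g), which is n^(-o(1)).
    *)
Definition deviation (n : nat) : R := expR (- (L n / 4)).

(** The outcome of the search is as desired for every estimate a/b of the
    density with an error of at most twice the deviation. One deviation is for
    the sampling, the other one for the difference between the density and the
    probability that a random pair is adjacent. *)
Definition accurate (n : nat) (e : R) : Prop :=
  [/\ 0 < g n < 1, (0 < n)%N & forall a b m l t, (a <= b)%N ->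
   `|a%:R / b%:R - g n| <= 2 * deviation n -> found n a b m l t ->
   [/\ e^-1 <= m%:R, `|t%:R - scale_of n| <= e * scale_of n &
    l%:R * entropy (g n) <= 2 * L n]].

(** For fixed e the hypotheses of search_estimate hold eventually: its
    left-hand sides are linear in D = o(ln n) and in ln (ln n). *)
Lemma near_accurate (e : R) : 0 < e -> \forall n \near \oo, accurate n e.
Proof.
move=> e0; pose h : R := Num.min (e / 36) 18^-1.
have h0 : 0 < h by rewrite lt_min divr_gt0 //= invr_gt0.
have he : h <= e / 36 by rewrite ge_min lexx.
have h18 : h <= 18^-1 by rewrite ge_min lexx orbT.
have [K hK] : exists K : nat, h^-1 <= K%:R.
  by have [K hK] := (near_ooP _).1 (nbhs_infty_ger h^-1); exists K; apply: hK.
pose c : R := 12 * K%:R ^+ 3 + 5.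
have K0 : 0 <= K%:R ^+ 3 :> R by rewrite exprn_ge0.
have c0 : 0 < c by rewrite /c; lra.
(* The error h absorbs the constant 36 of search_estimate; the density enters
   only through D n, which is at most a small multiple of ln n. *)
near=> n.
have [gn Dn] : 0 < g n < 1 /\ D n <= Num.min (4^-1 / c) (h / 20) * L n.
  by near: n; apply: near_density; rewrite lt_min !divr_gt0 //= invr_gt0.
have L1 : 1 <= L n by near: n; exact: ln_nat_large.
have L0 : 0 <= L n by apply: le_trans L1.
have L2 : 24 * K%:R ^+ 3 + 5 * ln (5 * K%:R ^+ 3) + 1 <= 4^-1 * L n.
  have : 4 * (24 * K%:R ^+ 3 + 5 * ln (5 * K%:R ^+ 3) + 1) <= L n.
    by near: n; exact: ln_nat_large.
  by clear; lra.
have L3 : 2 * (5 * (ln 6 - ln (h / 20))) <= h * L n.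
  have : (2 * (5 * (ln 6 - ln (h / 20)))) / h <= L n by near: n; exact: ln_nat_large.
  by rewrite ler_pdivrMr // (mulrC h (ln n%:R)).
have L4 : 8 * (ln 2 - ln h) <= L n by near: n; exact: ln_nat_large.
have D1 : c * D n <= 4^-1 * L n.
  have : D n <= 4^-1 / c * L n.
    by apply: le_trans Dn _; rewrite ler_wpM2r // ge_min lexx.
  by rewrite mulrAC ler_pdivlMr // mulrC.
have D2 : D n <= h / 20 * L n.
  by apply: le_trans Dn _; rewrite ler_wpM2r // ge_min lexx orbT.
have /andP[g0 g1] := gn.
have p0 : 0 < g n * (1 - g n) by rewrite mulr_gt0 // subr_gt0.
have n0 : (0 < n)%N.
  by rewrite lt0n; apply/negP => /eqP n0; move: L1; rewrite n0 ln0 // ler10.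
have dev : 2 * deviation n <= h * (g n * (1 - g n)).
  rewrite -ler_ln ?posrE ?mulr_gt0 ?expR_gt0 ?subr_gt0 //.
  rewrite lnM ?posrE ?expR_gt0 // [X in _ <= X]lnM ?posrE // expRK.
  have : h / 20 * L n <= 18^-1 / 20 * L n by rewrite ler_wpM2r // ler_pM2r // invr_gt0.
  by move: D2 L4 L0; clear; lra.
split=> // a b m l t ab abg fd.
have ce : close h (a%:R / b%:R) (g n) by apply: le_trans dev.
have h01 : 0 < h <= 18^-1 by rewrite h0.
have big1 : 12 * K%:R ^+ 3 * (2 + D n) + 5 * (ln (5 * K%:R ^+ 3) + D n) < L n.
  by move: D1 L2 L1; rewrite /c; clear; lra.
have big2 : 5 * (ln (6 * L n) + D n) <= h * L n.
  have l6 : ln (6 * L n) <= ln 6 + (h / 20 * L n - ln (h / 20)).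
    rewrite lnM ?posrE // ?(lt_le_trans ltr01) // lerD2l; apply: ln_le_linear; first by rewrite divr_gt0.
    exact: lt_le_trans L1.
  by move: l6 D2 L3; clear; lra.
have [Km tX lH] := search_estimate fd ab n0 gn h01 ce hK big1 big2.
have X0 : 0 <= scale_of n.
  rewrite /scale_of divr_ge0 ?mulr_ge0 ?(ltW g0) //.
  by apply: ltW; apply: entropy_gt0.
split=> //.
- apply: (@le_trans _ _ h^-1); last by apply: le_trans hK _; rewrite ler_nat.
  by rewrite lef_pV2 ?posrE //; move: he e0; clear; lra.
- by apply: le_trans tX _; rewrite ler_wpM2r //; move: he; clear; lra.
Unshelve. all: by end_near.
Qed.

(** If P n (1/(j+1)) holds from N j on, take for j the largest number up to n
    with N j <= n. *)
Lemma diagonal_sequence (P : nat -> R -> Prop) :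
  (forall e, 0 < e -> \forall n \near \oo, P n e) ->
  exists eps : nat -> R, [/\ forall n, 0 < eps n, eps @ \oo --> (0 : R) &
    \forall n \near \oo, P n (eps n)].
Proof.
move=> H; have /choice[N hN] : forall j : nat, exists N, forall n, (N <= n)%N -> P n j.+1%:R^-1.
  by move=> j; apply/near_ooP; apply: H; rewrite invr_gt0 ltr0n.
pose J n : nat := \max_(j < n.+1 | (N j <= n)%N) j.
exists (fun n => (J n).+1%:R^-1); split.
- by move=> n; rewrite invr_gt0 ltr0n.
- apply/cvgrPdist_le => e e0; apply/near_ooP.
  have [j hj] := (near_ooP _).1 (nbhs_infty_ger e^-1); exists (maxn j (N j)) => n; rewrite geq_max => /andP[jn Njn].
  have jJ : (j <= J n)%N.
    have jn1 : (j < n.+1)%N by [].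
    exact: (leq_bigmax_cond (Ordinal jn1) (F := fun i : 'I_n.+1 => nat_of_ord i)).
  rewrite sub0r normrN gtr0_norm ?invr_gt0 ?ltr0n //.
  rewrite -[leRHS]invrK lef_pV2 ?posrE ?invr_gt0 ?ltr0n //.
  by apply: le_trans (hj _ (leqnn j)) _; rewrite ler_nat leqW.
- apply/near_ooP; exists (N 0%N) => n Nn; apply: hN.
  have A0 : (0 < #|[pred j : 'I_n.+1 | (N j <= n)%N]|)%N.
    by apply/card_gt0P; exists ord0.
  have [j jA] := eq_bigmax_cond (fun i : 'I_n.+1 => nat_of_ord i) A0.
  rewrite /J => ->; exact: jA.
Qed.

Lemma ln2_gt0 : 0 < ln 2 :> R.
Proof. by rewrite ln_gt0 // ltr1n. Qed.

Lemma h2E x : h2 x = entropy x / ln 2 :> R.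
Proof. by rewrite /h2 /entropy /lg; field; rewrite gt_eqF // ln2_gt0. Qed.

Lemma biclique_scaleE n : biclique_scale gamma n = scale_of n.
Proof.
rewrite /biclique_scale /scale_of h2E /lg invfM invrK mulrACA -mulrA.
by rewrite divfK ?gt_eqF ?ln2_gt0 // mulrA mulrAC.
Qed.

Lemma time_scaleE n : time_scale gamma n = n%:R * L n / entropy (g n).
Proof.
by rewrite /time_scale h2E /lg invfM invrK mulrACA divfK ?gt_eqF ?ln2_gt0 // mulrAC.
Qed.

(** Taking logarithms, the claim is that ln (ln n / H(g)) = o(ln n); and 1/H(g)
    is at most 1/(g (1-g)). *)
Lemma time_scale_n_pow : n_pow 1 (time_scale gamma).
Proof.
exists (fun n => ln (time_scale gamma n) / L n); split; last first.
  near=> n.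
  have [gn _] : 0 < g n < 1 /\ D n <= 1 * L n by near: n; exact: near_density.
  have L1 : 1 <= L n by near: n; exact: ln_nat_large.
  have L0 : 0 < L n by lra.
  have n0 : 0 < n%:R :> R.
    by rewrite ltr0n lt0n; apply/negP => /eqP n0; move: L1; rewrite n0 ln0 // ler10.
  have ts : 0 < time_scale gamma n.
    by rewrite time_scaleE divr_gt0 ?mulr_gt0 // entropy_gt0.
  by rewrite /powR gt_eqF // divfK ?gt_eqF // lnK.
apply/cvgrPdist_le => d d0; near=> n.
have [gn Dn] : 0 < g n < 1 /\ D n <= d / 4 * L n.
  by near: n; apply: near_density; rewrite divr_gt0.
have L1 : 1 <= L n by near: n; exact: ln_nat_large.
have L2 : - ln (d / 4) / (d / 4) <= L n by near: n; exact: ln_nat_large.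
have L0 : 0 < L n by lra.
have n0 : 0 < n%:R :> R.
  by rewrite ltr0n lt0n; apply/negP => /eqP n0; move: L1; rewrite n0 ln0 // ler10.
have H0 := entropy_gt0 gn.
have d4 : 0 < d / 4 by rewrite divr_gt0.
have lnH1 : ln (entropy (g n)) <= 0.
  rewrite ln_le0 //; apply: le_trans (entropy_le_ln2 gn) _.
  by have := @ln_le_sub1 R 2; rewrite ltr0n => /(_ isT); lra.
have lnH2 : - ln (entropy (g n)) <= D n.
  have /andP[g0 g1] := gn.
  have p0 : 0 < g n * (1 - g n) by rewrite mulr_gt0 // subr_gt0.
  by rewrite lerN2 ler_ln ?posrE //; apply: entropy_ge.
have lnL1 : 0 <= ln (L n) by rewrite ln_ge0.
have lnL2 : ln (L n) <= d / 2 * L n.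
  have := ln_le_linear d4 L0; move: L2; rewrite ler_pdivrMr //; lra.
rewrite time_scaleE lnB ?mulr_gt0 // lnM ?posrE // -addrA mulrDl divff ?gt_eqF //.
rewrite opprD addrA subrr sub0r normrN normrM [X in _ * X]ger0_norm; last first.
  by rewrite invr_ge0 ltW.
rewrite ler_pdivrMr // ler_norml; apply/andP; split; last by lra.
by have := mulr_gt0 d0 L0; lra.
Unshelve. all: by end_near.
Qed.

End Limits.

(** * Expectation over a tape of random words *)

Section Expectation.
Variables (R : realType) (W : nat).
Hypothesis W0 : (0 < W)%N.

Definition avg (N : nat) (f : nat -> R) : R := N%:R^-1 * \sum_(i < N) f i.

(** The expectation over T independent uniform words, one word at a time: this
    form makes conditioning on an initial segment of the tape immediate
    (expect_cat). *)
Fixpoint expect (T : nat) (f : seq nat -> R) : R :=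
  match T with
  | 0 => f [::]
  | T'.+1 => avg W (fun i => expect T' (fun s => f (i :: s)))
  end.

Definition tape_of (T : nat) (s : seq nat) : bool :=
  (size s == T) && all (fun w => w < W)%N s.

Lemma avg_le N f g : (forall i, (i < N)%N -> f i <= g i) -> avg N f <= avg N g.
Proof.
move=> fg; rewrite ler_wpM2l ?invr_ge0 //; apply: ler_sum => i _; exact: fg.
Qed.

Lemma avg_ext N f g : (forall i, (i < N)%N -> f i = g i) -> avg N f = avg N g.
Proof. by move=> fg; congr (_ * _); apply: eq_bigr => i _; apply: fg. Qed.

Lemma avg_cst N c : (0 < N)%N -> avg N (fun=> c) = c.
Proof.
move=> N0; rewrite /avg sumr_const card_ord -[c *+ N]mulr_natl mulrA mulVf ?mul1r //.
by rewrite pnatr_eq0 -lt0n.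
Qed.

Lemma avgD N f g : avg N (fun i => f i + g i) = avg N f + avg N g.
Proof. by rewrite /avg big_split mulrDr. Qed.

Lemma avgZ N c f : avg N (fun i => c * f i) = c * avg N f.
Proof. by rewrite /avg -mulr_sumr mulrCA. Qed.

Lemma expect_le T f g : (forall s, tape_of T s -> f s <= g s) ->
  expect T f <= expect T g.
Proof.
elim: T f g => [|T IH] f g fg /=; first exact: fg.
apply: avg_le => i iW; apply: IH => s /andP[sT sW]; apply: fg.
by rewrite /tape_of /= iW eqSS sT.
Qed.

Lemma expect_ext T f g : (forall s, tape_of T s -> f s = g s) ->
  expect T f = expect T g.
Proof. by move=> fg; apply: le_anti; rewrite !expect_le // => s /fg ->. Qed.

Lemma expect_cst T c : expect T (fun=> c) = c.
Proof. by elim: T => //= T ->; rewrite avg_cst. Qed.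

Lemma expectD T f g :
  expect T (fun s => f s + g s) = expect T f + expect T g.
Proof.
elim: T f g => //= T IH f g; rewrite -avgD; apply: avg_ext => i _; exact: IH.
Qed.

Lemma expectZ T c f : expect T (fun s => c * f s) = c * expect T f.
Proof.
elim: T f => //= T IH f; rewrite -avgZ; apply: avg_ext => i _; exact: IH.
Qed.

Lemma expect_cat A B f :
  expect (A + B) f = expect A (fun u => expect B (fun v => f (u ++ v))).
Proof. by elim: A f => //= A IH f; apply: avg_ext => i _; apply: IH. Qed.

Lemma expect_avg T N (f : nat -> seq nat -> R) :
  avg N (fun i => expect T (f i)) = expect T (fun s => avg N (f^~ s)).
Proof.
rewrite /avg expectZ; congr (_ * _).
elim: N => [|N IH]; first by rewrite big_ord0 (expect_ext (g := fun=> 0)) ?expect_cst // => s _; rewrite big_ord0.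
rewrite big_ord_recr /= IH -expectD; apply: expect_ext => s _.
by rewrite big_ord_recr.
Qed.

Lemma expect_ge0 T f : (forall s, tape_of T s -> 0 <= f s) -> 0 <= expect T f.
Proof. by move=> f0; rewrite -(expect_cst T 0); apply: expect_le. Qed.

Lemma Pr_expect T (E : pred (seq nat)) : Pr R W T E = expect T (fun s => (E s)%:R).
Proof.
rewrite /Pr card_tuple card_ord.
have -> : #|[pred w : T.-tuple 'I_W | E (tape_words w)]|%:R =
    \sum_(w : T.-tuple 'I_W) (E (tape_words w))%:R :> R.
  rewrite -sum1_card natr_sum big_mkcond /=; apply: eq_bigr => w _.
  by rewrite inE; case: (E _).
elim: T E => [|T IH] E /=.
  rewrite expn0 divr1 (eq_bigr (fun=> (E [::])%:R)).
    by rewrite sumr_const card_tuple expn0.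
  by move=> w _; rewrite tuple0.
have W0R : W%:R != 0 :> R by rewrite pnatr_eq0 -lt0n.
transitivity (avg W (fun i => \sum_(w : T.-tuple 'I_W) (E (i :: tape_words w))%:R) / (W ^ T)%:R).
  rewrite /avg expnS natrM invfM mulrA [_ / W%:R]mulrC; congr (_ * _ * _).
  rewrite pair_big /=.
  rewrite (reindex (fun p : 'I_W * T.-tuple 'I_W => [tuple of p.1 :: p.2])) /=.
    by apply: eq_bigr.
  exists (fun w : T.+1.-tuple 'I_W => (thead w, [tuple of behead w])).
  - by move=> [i w] _ /=; rewrite theadE; congr (_, _); apply: val_inj.
  - by move=> w _; rewrite -tuple_eta.
rewrite mulrC -avgZ; apply: avg_ext => i _.
by rewrite -IH mulrC.
Qed.

(** The parameter k is the position of the first word of s in the whole tape: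
    the summands may depend on the position. *)
Fixpoint running_sum (h : nat -> nat -> R) (k : nat) (s : seq nat) : R :=
  if s is w :: s' then h k w + running_sum h k.+1 s' else 0.

Lemma expect_running_sum h k T : (forall j, avg W (h j) = 0) ->
  expect T (running_sum h k) = 0.
Proof.
move=> h0; elim: T k => //= T IH k.
rewrite (avg_ext (g := h k)) // => i _.
by rewrite expectD expect_cst IH addr0.
Qed.

(** Additivity of the variance: the mixed terms vanish because the later
    summands are centred. *)
Lemma expect_running_sum2 h k T V : (forall j, avg W (h j) = 0) ->
  (forall j, (k <= j < k + T)%N -> avg W (fun w => h j w ^+ 2) <= V j) ->
  expect T (fun s => running_sum h k s ^+ 2) <= \sum_(k <= j < k + T) V j.
Proof.
move=> h0; elim: T k => [|T IH] k hV; first by rewrite /= addn0 big_geq // expr0n.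
rewrite /= (avg_ext (g := fun i => h k i ^+ 2 +
    expect T (fun s => running_sum h k.+1 s ^+ 2))); last first.
  move=> i _; rewrite (expect_ext (g := fun s => h k i ^+ 2 +
      (2 * h k i * running_sum h k.+1 s + running_sum h k.+1 s ^+ 2))).
    by rewrite !expectD expect_cst expectZ expect_running_sum // mulr0 add0r.
  by move=> s _; ring.
rewrite avgD avg_cst // big_ltn ?addnS ?ltnS ?leq_addr //.
apply: lerD; first by apply: hV; rewrite leqnn addnS ltnS leq_addr.
rewrite -addSn; apply: IH => j /andP[kj jk]; apply: hV.
by rewrite (ltnW kj) -addSnnS.
Qed.

Lemma chebyshev_sum h T V c (B : pred (seq nat)) : (forall j, avg W (h j) = 0) ->
  (forall j, (j < T)%N -> avg W (fun w => h j w ^+ 2) <= V j) -> 0 < c ->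
  (forall s, tape_of T s -> B s -> c <= `|running_sum h 0 s|) ->
  expect T (fun s => (B s)%:R) <= (\sum_(0 <= j < T) V j) / c ^+ 2.
Proof.
move=> h0 hV c0 hB; rewrite ler_pdivlMr ?exprn_gt0 //.
apply: le_trans (_ : expect T (fun s => running_sum h 0 s ^+ 2) <= _); last first.
  by rewrite -[T in leRHS]add0n; apply: expect_running_sum2 => // j /andP[_]; apply: hV.
rewrite mulrC -expectZ; apply: expect_le => s sT.
case: (boolP (B s)) => [Bs|_]; last by rewrite mulr0 sqr_ge0.
rewrite mulr1 -[leRHS]real_normK ?num_real //.
by apply: lerXn2r; rewrite ?nnegrE ?(ltW c0) //; apply: hB.
Qed.

Definition mean (g : nat -> R) : R := avg W g.

Lemma avg_centred (g : nat -> R) : avg W (fun w => g w - mean g) = 0.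
Proof.
by rewrite avgD avg_cst // /mean subrr.
Qed.

(** For values in [0, 1] the square is at most the value itself. *)
Lemma avg_variance (g : nat -> R) : (forall w, (w < W)%N -> 0 <= g w <= 1) ->
  avg W (fun w => (g w - mean g) ^+ 2) <= mean g * (1 - mean g).
Proof.
move=> g01; apply: (@le_trans _ _ (avg W (fun w => g w + (- (2 * mean g) * g w + mean g ^+ 2)))).
  by apply: avg_le => w /g01 /andP[g0 g1]; nra.
by rewrite !avgD avgZ avg_cst // -/(mean g); lra.
Qed.

Lemma mean01 (g : nat -> R) : (forall w, (w < W)%N -> 0 <= g w <= 1) ->
  0 <= mean g <= 1.
Proof.
move=> g01; rewrite -(avg_cst 0 W0) -[1](avg_cst 1 W0).
by rewrite !avg_le // => w /g01 /andP[].
Qed.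

End Expectation.

Section Words.
Variable R : realType.

(** A uniform number below K n splits into a uniform lowest digit in base n and
    an independent uniform quotient. *)
Lemma avg_digits (n K : nat) (f : nat -> nat -> R) : (0 < n)%N -> (0 < K)%N ->
  avg (K * n) (fun w => f (w %% n)%N (w %/ n)%N) =
  avg K (fun q => avg n (fun v => f v q)).
Proof.
move=> n0 K0; rewrite /avg natrM invfM -mulrA; congr (_ * _).
rewrite -(big_mkord xpredT (fun w => f (w %% n)%N (w %/ n)%N)) big_nat_mul.
rewrite -(big_mkord xpredT (fun q => n%:R^-1 * \sum_(i < n) f i q)) mulr_sumr.
apply: eq_bigr => q _; congr (_ * _).
rewrite -{1}[(q * n)%N]add0n big_addn mulSn addnK big_mkord.
apply: eq_bigr => v _; rewrite addnC modnMDl modn_small // divnMDl // divn_small //.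
by rewrite addn0.
Qed.

Lemma avg_mod (n k : nat) (f : nat -> R) : (0 < n)%N ->
  avg (n ^ k.+1) (fun w => f (w %% n)%N) = avg n f.
Proof.
move=> n0; rewrite expnSr (avg_digits (fun v _ => f v)) ?expn_gt0 ?n0 //.
by rewrite avg_cst // expn_gt0 n0.
Qed.

End Words.

Section RunningSums.
Variable R : realType.

Lemma running_sumB (g : nat -> nat -> R) (mu : nat -> R) k s :
  running_sum (fun j w => g j w - mu j) k s =
  running_sum g k s - \sum_(k <= j < k + size s) mu j.
Proof.
elim: s k => [|w s IH] k /=; first by rewrite addn0 big_geq // subr0.
rewrite IH [in RHS]big_ltn ?addnS ?ltnS ?leq_addr // -addSn.
by ring.
Qed.

Lemma running_sum_nat (f : nat -> nat) k s :
  running_sum (fun _ w => (f w)%:R) k s = (sumn (map f s))%:R :> R.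
Proof. by elim: s k => //= w s IH k; rewrite IH natrD. Qed.

Lemma running_sumZ c (g : nat -> nat -> R) k s :
  running_sum (fun j w => c * g j w) k s = c * running_sum g k s.
Proof. by elim: s k => [|w s IH] k /=; rewrite ?mulr0 // IH mulrDr. Qed.

End RunningSums.

(** * The bad events of the randomised algorithm *)

Section BadEvents.
Variables (R : realType) (n : nat) (G : sgraph n).
Hypothesis n0 : (0 < n)%N.
Local Notation W := (n ^ 10)%N.

(** The probability that two independent uniform vertices, possibly equal, are
    adjacent. *)
Definition edge_prob : R := (degree_sum G)%:R / (n%:R * n%:R).

Let W0 : (0 < W)%N. Proof. by rewrite expn_gt0 n0. Qed.
Let n0R : 0 < n%:R :> R. Proof. by rewrite ltr0n. Qed.

Lemma degree_sumE : (degree_sum G)%:R =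
  \sum_(u < n) \sum_(v < n) (adj_query G u v)%:R :> R.
Proof.
rewrite /degree_sum sumnE big_map -[n in iota 0 n]subn0 -/(index_iota 0 n) big_mkord.
rewrite natr_sum; apply: eq_bigr => u _; rewrite -sum_adj_query //.
by rewrite sumnE big_map -[n in iota 0 n]subn0 -/(index_iota 0 n) big_mkord natr_sum.
Qed.

Lemma mean_pair : mean W (fun w => (pair_adj G w)%:R) = edge_prob.
Proof.
rewrite /mean /pair_adj.
have -> : W = (n ^ 9 * n)%N by rewrite expnSr.
rewrite (avg_digits (fun v q => (adj_query G v (q %% n))%:R : R)) ?expn_gt0 ?n0 //.
rewrite (avg_mod _ (fun u => avg n (fun v => (adj_query G v u)%:R))) //.
rewrite /edge_prob degree_sumE /avg -mulr_sumr mulrA -invfM mulrC; congr (_ / _).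
by rewrite exchange_big.
Qed.

Lemma mean_degree : mean W (fun w => (degree_query G (w %% n))%:R / n%:R) = edge_prob.
Proof.
rewrite /mean (avg_mod _ (fun u => (degree_query G u)%:R / n%:R)) //.
rewrite /avg -mulr_suml mulrC -mulrA -invfM; congr (_ / _).
rewrite /degree_sum sumnE big_map -[n in iota 0 n]subn0 -/(index_iota 0 n) big_mkord.
by rewrite natr_sum.
Qed.

(** Chebyshev's inequality for n indicators of variance at most 1. *)
Lemma bad_density (d : R) : 0 < d ->
  expect W n (fun u => (d < `|(sumn (map (pair_adj G) u))%:R / n%:R - edge_prob|)%R%:R)
    <= (n%:R * d ^+ 2)^-1.
Proof.
move=> d0; pose g w : R := (pair_adj G w)%:R.
have g01 w : (w < W)%N -> 0 <= g w <= 1.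
  by rewrite /g ler0n lern1 adj_query_le1.
have c0 : 0 < n%:R * d by rewrite mulr_gt0.
apply: le_trans (@chebyshev_sum R W W0 (fun _ w => g w - mean W g) n (fun=> 1) _ _ _ _ c0 _) _.
- by move=> j; apply: avg_centred.
- move=> j _; apply: le_trans (avg_variance W0 g01) _.
  by have /andP[m0 m1] := mean01 W0 g01; nra.
- move=> s /andP[/eqP sn _] /ltW h.
  rewrite running_sumB running_sum_nat sn add0n sumr_const_nat subn0 mean_pair.
  rewrite -(ler_pM2l n0R) in h; apply: le_trans h _.
  rewrite -{1}(gtr0_norm n0R) -normrM mulrBr mulrCA divff ?gt_eqF // mulr1.
  by rewrite mulr_natl.
have nz : n%:R != 0 :> R by rewrite gt_eqF.
have dz : d != 0 by rewrite gt_eqF.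
rewrite sumr_const_nat subn0 le_eqVlt; apply/orP; left; apply/eqP.
by field; rewrite ?nz ?dz.
Qed.

(** The degree of a random vertex, divided by n, has mean edge_prob and takes
    values in [0, 1], so its variance is at most p (1-p). This form, rather
    than a constant bound, matters for densities close to 0 or 1. *)
Lemma bad_rows (l t : nat) (c : R) : 0 < c -> c <= l%:R * edge_prob - t.+1%:R ->
  expect W l (fun r =>
    (sumn [seq degree_query G u | u <- [seq w %% n | w <- r]] < t.+1 * n)%N%:R)
  <= l%:R * (edge_prob * (1 - edge_prob)) / c ^+ 2.
Proof.
move=> c0 hc; pose g w : R := (degree_query G (w %% n))%:R / n%:R.
have g01 w : (w < W)%N -> 0 <= g w <= 1.
  by rewrite /g divr_ge0 //= ler_pdivrMr // mul1r ler_nat degree_query_le.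
apply: le_trans (@chebyshev_sum R W W0 (fun _ w => g w - mean W g) l
  (fun=> mean W g * (1 - mean W g)) c _ _ _ c0 _) _.
- by move=> j; apply: avg_centred.
- by move=> j _; apply: avg_variance.
- move=> s /andP[/eqP sl _]; rewrite -map_comp.
  rewrite running_sumB sl add0n sumr_const_nat subn0 mean_degree.
  have -> : running_sum (fun=> g) 0 s =
      n%:R^-1 * (sumn (map (fun w => degree_query G (w %% n)) s))%:R.
    rewrite -(running_sum_nat R _ 0) -running_sumZ; congr (running_sum _ _ _).
    by apply: funext => j; apply: funext => w; rewrite mulrC.
  move: (sumn _) => S hS; apply: le_trans hc _.
  rewrite distrC; apply: le_trans _ (ler_norm _); rewrite -(mulr_natl edge_prob) lerD2l lerN2.
  by rewrite ler_pdivrMl // -natrM ler_nat mulnC ltnW.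
by rewrite sumr_const_nat subn0 mean_degree mulr_natl.
Qed.

(** A new row collides with the previous ones with probability at most l/n. *)
Lemma bad_collisions (l : nat) :
  expect W l (fun r => (~~ uniq [seq (w %% n)%N | w <- r])%:R) <= (l * l)%:R / n%:R :> R.
Proof.
elim: l => [|l IH] /=; first by rewrite mul0n mul0r.
apply: (@le_trans _ _ (expect W l (fun s => avg W (fun i =>
   ((i %% n)%N \in [seq (w %% n)%N | w <- s])%:R +
   (~~ uniq [seq (w %% n)%N | w <- s])%:R)))).
  rewrite -expect_avg //; apply: avg_le => i _; apply: expect_le => s _.
  by rewrite negb_and negbK; case: (_ \in _); case: uniq => //=; lra.
apply: (@le_trans _ _ (expect W l (fun s => l%:R / n%:R +
   (~~ uniq [seq (w %% n)%N | w <- s])%:R))).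
  apply: expect_le => s /andP[/eqP sl _]; rewrite avgD avg_cst // lerD2r.
  rewrite (avg_mod _ (fun i => (i \in [seq (w %% n)%N | w <- s])%:R)) //.
  rewrite /avg mulrC ler_pM2r ?invr_gt0 // -natr_sum ler_nat.
  apply: (@leq_trans (size [seq (w %% n)%N | w <- s])); last by rewrite size_map sl.
  rewrite -(big_mkord xpredT (fun i => nat_of_bool (i \in _))) /=.
  elim: [seq _ | _ <- s] => [|x r IHr] /=; first by rewrite big1.
  apply: (@leq_trans (\sum_(0 <= i < n) ((i == x) + (i \in r)))%N).
    by apply: leq_sum => i _; rewrite inE; case: eqP; case: (i \in r).
  rewrite big_split /= -[(size r).+1]add1n leq_add //.
  rewrite -big_mkcond /= big_mkord; case: (ltnP x n) => xn.
    by rewrite (big_pred1 (Ordinal xn)).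
  by rewrite big_pred0 // => i; rewrite ltn_eqF // (leq_trans _ xn).
rewrite expectD expect_cst //.
apply: le_trans (lerD (lexx _) IH) _.
rewrite -mulrDl ler_pM2r ?invr_gt0 // -natrD ler_nat; lia.
Qed.

Lemma size_filter_mkseq (P : pred nat) (f : nat -> nat) M :
  (size [seq v <- mkseq f M | P v])%:R = \sum_(0 <= j < M) (P (f j))%:R :> R.
Proof.
elim: M => [|M IH]; first by rewrite big_geq.
rewrite big_nat_recr // -IH {1}/mkseq iota0S map_rcons filter_rcons /=.
by case: (P (f M)); rewrite ?size_rcons ?addr0 // natr1.
Qed.

Lemma running_sum_nth (g : nat -> nat -> R) k s :
  running_sum g k s = \sum_(0 <= j < size s) g (k + j)%N (nth 0%N s j).
Proof.
elim: s k => [|w s IH] k /=; first by rewrite big_geq.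
rewrite IH [RHS]big_nat_recl //= addn0; congr (_ + _).
by apply: eq_bigr => j _; rewrite addSnnS.
Qed.

(** The number of words need not be a multiple of l, so residues modulo l are
    only almost uniform; words below the last multiple of l, at least half of
    all, are enough. *)
Lemma mean_residue (l : nat) (P : pred nat) : (0 < l)%N -> (2 * l <= W)%N ->
  (\sum_(r < l) (P r)%:R) / (2 * l%:R) <= mean W (fun w => (P (w %% l))%N%:R) :> R.
Proof.
move=> l0 lW; set K := (W %/ l)%N; have l0R : 0 < l%:R :> R by rewrite ltr0n.
have K0 : (0 < K)%N by rewrite divn_gt0 //; lia.
have h : \sum_(w < K * l) (P (w %% l)%N)%:R = K%:R * \sum_(r < l) (P r)%:R :> R.
  have := avg_digits (fun v _ => (P v)%:R : R) l0 K0.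
  rewrite avg_cst // /avg natrM invfM -mulrA.
  move=> /(congr1 (fun x => K%:R * (l%:R * x))).
  rewrite [l%:R * (K%:R^-1 * _)]mulrCA !mulVKf ?gt_eqF ?ltr0n //.
have sub : \sum_(w < K * l) (P (w %% l)%N)%:R <= \sum_(w < W) (P (w %% l)%N)%:R :> R.
  rewrite -!(big_mkord xpredT (fun w => (P (w %% l)%N)%:R)).
  rewrite [leRHS](big_cat_nat (leq0n (K * l)) (leq_trunc_div W l)) /=.
  by rewrite lerDl sumr_ge0.
rewrite /mean /avg; apply: le_trans (_ : W%:R^-1 * (K%:R * \sum_(r < l) (P r)%:R) <= _).
  rewrite mulrA mulrC ler_wpM2r ?sumr_ge0 //.
  rewrite [leRHS]mulrC ler_pdivlMr ?ltr0n // ler_pdivrMl ?mulr_gt0 //.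
  rewrite -!natrM ler_nat; have := ltn_ceil W l0; rewrite -/K mulSn; lia.
by rewrite ler_pM2l ?invr_gt0 ?ltr0n // -h.
Qed.

(** At least n/l vertices are good, all but l of them lie in complete blocks,
    and each is drawn with probability at least 1/(2l). So the expected number
    mu of good sampled columns is at least n / (4 l^2). The variance is at most
    mu, and half the mean is missed with probability at most 4/mu by
    Chebyshev's inequality. *)
Lemma bad_columns (l t : nat) (S : seq nat) :
  (32 <= l)%N -> (l ^ 4 <= n)%N -> (n <= l * size (good_columns G t S (iota 0 n)))%N ->
  expect W (n %/ l) (fun c =>
    (8 * (l * l) * size (good_columns G t S (column_sample l c)) < n)%N%:R)
  <= 16 / l%:R :> R.
Proof.
move=> l32 l4 good; set M := (n %/ l)%N.
have l0 : (0 < l)%N by lia.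
have l0R : 0 < l%:R :> R by rewrite ltr0n.
have l2n : (l * l * (l * l) <= n)%N.
  by move: l4; rewrite !expnS expn0 muln1 !mulnA.
have ll2 : (2 * (l * l) <= n)%N.
  by apply: leq_trans l2n; rewrite leq_mul2r; apply/orP; right; move: l32; clear; nia.
have l3n : (l * (l * l) <= n)%N.
  by apply: leq_trans l2n; rewrite leq_mul2r leq_pmulr ?orbT.
pose P v := (t <= hits G S v)%N.
pose g j w : R := (P (sampled_column l j w))%:R.
have g01 j w : (w < W)%N -> 0 <= g j w <= 1 by rewrite /g ler0n lern1 leq_b1.
pose mu := \sum_(0 <= j < M) mean W (g j).
have mu_low : n%:R / (4 * (l * l)%:R) <= mu.
  have lW : (2 * l <= W)%N.
    apply: leq_trans (_ : n <= _)%N.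
      by apply: leq_trans ll2; rewrite leq_mul2l leq_pmulr.
    by rewrite -{1}[n]expn1 leq_pexp2l.
  have h1 : (\sum_(0 <= v < M * l) (P v)%:R) / (2 * l%:R) <= mu.
    rewrite big_nat_mul mulr_suml; apply: ler_sum => j _.
    apply: le_trans (mean_residue (fun r => P (r + j * l)%N) l0 lW).
    rewrite -{1}[(j * l)%N]add0n big_addn mulSn addnK big_mkord.
    by rewrite ler_pM2r ?invr_gt0 ?mulr_gt0.
  have h2 : n%:R / l%:R - l%:R <= \sum_(0 <= v < M * l) (P v)%:R :> R.
    have tot : n%:R / l%:R <= \sum_(0 <= v < n) (P v)%:R :> R.
      rewrite -(size_filter_mkseq P id n) /mkseq map_id ler_pdivrMr //.
      by rewrite -natrM ler_nat mulnC.
    have := tot; rewrite (big_cat_nat (leq0n (M * l)) (leq_trunc_div n l)) /=.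
    have : \sum_(M * l <= v < n) (P v)%:R <= l%:R :> R.
      apply: (@le_trans _ _ (\sum_(M * l <= v < n) 1)).
        by apply: ler_sum => v _; rewrite lern1 leq_b1.
      rewrite sumr_const_nat ler_nat leq_subLR; have := ltn_ceil n l0.
      by rewrite -/M mulSn addnC => /ltnW.
    by lra.
  apply: le_trans h1; rewrite ler_pdivlMr ?mulr_gt0 //; apply: le_trans h2.
  have -> : n%:R / (4 * (l * l)%:R) * (2 * l%:R) = 2^-1 * (n%:R / l%:R) :> R.
    by rewrite natrM; field; rewrite gt_eqF.
  suff : 2 * l%:R <= n%:R / l%:R :> R by lra.
  by rewrite ler_pdivlMr // -mulrA -!natrM ler_nat.
have mu0 : 0 < mu.
  by apply: lt_le_trans mu_low; rewrite divr_gt0 ?mulr_gt0 // ltr0n muln_gt0 l0.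
have c0 : 0 < mu / 2 by rewrite divr_gt0.
apply: le_trans (@chebyshev_sum R W W0 (fun j w => g j w - mean W (g j)) M
  (fun j => mean W (g j)) (mu / 2) _ _ _ c0 _) _.
- by move=> j; apply: avg_centred.
- move=> j _; apply: le_trans (avg_variance W0 (g01 j)) _.
  by have /andP[m0 m1] := mean01 W0 (g01 j); nra.
- move=> s /andP[/eqP sM _]; rewrite running_sumB sM add0n -/mu running_sum_nth sM.
  rewrite /good_columns /column_sample sM => hS.
  have := size_filter_mkseq P (fun j => sampled_column l j (nth 0%N s j)) M.
  rewrite /P => E; rewrite (eq_bigr (fun j => (t <= hits G S (sampled_column l j (nth 0%N s j)))%N%:R)) //.
  rewrite -E distrC; apply: le_trans (ler_norm _); move: hS; set z := size _ => hS.
  suff : z%:R <= mu / 2 by lra.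
  have : n%:R / (4 * (l * l)%:R) <= mu by [].
  have : z%:R <= n%:R / (4 * (l * l)%:R) / 2 :> R.
    have -> : n%:R / (4 * (l * l)%:R) / 2 = n%:R / (8 * (l * l))%:R :> R.
      by rewrite !natrM; field; rewrite gt_eqF.
    by rewrite ler_pdivlMr ?ltr0n ?muln_gt0 ?l0 // -natrM ler_nat mulnC ltnW.
  by lra.
rewrite -/mu.
have -> : mu / (mu / 2) ^+ 2 = 4 / mu by field; rewrite gt_eqF.
rewrite ler_pdivrMr // mulrAC ler_pdivlMr //.
apply: (@le_trans _ _ (16 * (n%:R / (4 * (l * l)%:R)))); last by rewrite ler_pM2l.
rewrite mulrA ler_pdivlMr ?mulr_gt0 ?ltr0n ?muln_gt0 ?l0 //.
by rewrite -!natrM ler_nat; move: l3n; clear; lia.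
Qed.

End BadEvents.

(** * Density and degrees *)

Section Density.
Variables (R : realType) (n : nat) (G : sgraph n).

Lemma handshake : degree_sum G = (2 * #|edges G|)%N.
Proof.
have -> : degree_sum G = (\sum_(u < n) \sum_(v < n) adj G u v)%N.
  rewrite /degree_sum sumnE big_map -[n in iota 0 n]subn0 -/(index_iota 0 n) big_mkord.
  apply: eq_bigr => u _; rewrite -sum_adj_query //.
  rewrite sumnE big_map -[n in iota 0 n]subn0 -/(index_iota 0 n) big_mkord.
  by apply: eq_bigr => v _; rewrite adj_query_ord.
have -> : #|edges G| = (\sum_(u < n) \sum_(v < n) ((u < v) && adj G u v))%N.
  rewrite -sum1_card pair_big big_mkcond /=; apply: eq_bigr => -[u v] _.
  by rewrite inE /=; case: (_ && _).
rewrite mul2n -addnn [X in (_ + X)%N]exchange_big -big_split /=; apply: eq_bigr => u _.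
rewrite -big_split /=; apply: eq_bigr => v _; rewrite [adj G v u]adj_sym.
case: (ltngtP u v) => [_|_|/val_inj ->]; rewrite ?adj_irr //=.
by rewrite addn0.
Qed.

Lemma edge_prob_density : (0 < n)%N -> edge_prob R G = density R G * (n.-1%:R / n%:R).
Proof.
move=> n0; rewrite /edge_prob /density handshake natrM.
have [n1|n1] := leqP n 1.
  have -> : edges G = finset.set0.
    apply/setP => -[u v]; rewrite !inE /=; apply/negbTE; rewrite negb_and -leqNgt.
    by apply/orP; left; have := ltn_ord u; have := ltn_ord v; lia.
  by rewrite cards0 mulr0 !mul0r.
have := mul_bin_diag n 1; rewrite bin1 => /(congr1 (fun k => k%:R : R)).
rewrite !natrM => eC.
have n0R : n%:R != 0 :> R by rewrite pnatr_eq0 -lt0n.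
have c0 : 'C(n, 2)%:R != 0 :> R by rewrite pnatr_eq0 -lt0n bin_gt0.
have p0 : n.-1%:R != 0 :> R by rewrite pnatr_eq0 -lt0n; lia.
have -> : 'C(n, 2)%:R = n%:R * n.-1%:R / 2 :> R by rewrite eC mulrAC divff ?mul1r.
by field; rewrite ?p0 ?n0R.
Qed.

(** The two differ by the factor (n-1)/n, which accounts for pairs of equal
    vertices. *)
Lemma edge_prob_close : (0 < n)%N -> 0 <= density R G <= 1 ->
  `|edge_prob R G - density R G| <= n%:R^-1.
Proof.
move=> n0 /andP[g0 g1]; have n0R : 0 < n%:R :> R by rewrite ltr0n.
rewrite edge_prob_density //.
have -> : n.-1%:R / n%:R = 1 - n%:R^-1 :> R.
  have -> : n.-1%:R = n%:R - 1 :> R by rewrite -{2}(prednK n0) -natr1 addrK.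
  by rewrite mulrBl mul1r divff // gt_eqF.
rewrite mulrBr mulr1 addrC addKr normrN normrM [X in _ * X]gtr0_norm ?invr_gt0 //.
by rewrite ger0_norm // ler_piMl // invr_ge0 ltW.
Qed.

End Density.

(** * Complete runs *)

Section Runs.
Variables (n : nat) (G : sgraph n).

(** A halted machine stays put, so an upper bound on the running time can be
    used as the number of steps. *)
Lemma runs_run W tape p T (Q : state -> Prop) :
  runs G W tape p (initial n W) T Q ->
  exists s, run G W tape p T = ([::], s) /\ Q s.
Proof.
move=> [s [k [kT b q]]]; exists s; split=> //.
have stop j : iter j (step G W tape) ([::], s) = ([::], s).
  by elim: j => //= j ->.
rewrite /run -(subnK kT) iterD.
have -> : init n W p = ([:: p], initial n W) by [].
by rewrite (big_step_sound b) stop.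
Qed.

(** This identifies the outcomes of the search on all tapes that start with the
    same sample of pairs. *)
Lemma found_unique a b m l t m' l' t' :
  found n a b m l t -> found n a b m' l' t' -> [/\ m = m', l = l' & t = t'].
Proof.
move=> [m0 f nf lt] [m0' f' nf' lt'].
have mm : m = m'.
  have [h|h|//] := ltngtP m m'.
    by move: nf; rewrite f' // h andbT ltnS.
  by move: nf'; rewrite f // h andbT ltnS.
subst m'; move: lt lt'; case: ifP => _ [-> ->] [-> ->]; by split.
Qed.

Lemma words_cat (x y z : seq nat) : words (x ++ y ++ z) (size x) (size y) = y.
Proof.
apply: (@eq_from_nth _ 0%N); rewrite size_words // => i iy.
by rewrite nth_mkseq // nth_cat ltnNge leq_addr /= addKn nth_cat iy.
Qed.

Lemma column_sample_lt l c v : (size c <= n %/ l)%N -> v \in column_sample l c ->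
  (v < n)%N.
Proof.
move=> cl /(nthP 0%N)[j]; rewrite size_mkseq => jc; rewrite nth_mkseq // => <-.
have jn : (j < n %/ l)%N by apply: leq_trans cl.
have l0 : (0 < l)%N by case: (l) jn => //; rewrite divn0.
rewrite /sampled_column; apply: (@leq_trans (l + j * l)).
  by rewrite ltn_add2r ltn_mod.
by rewrite -mulSn (leq_trans _ (leq_trunc_div n l)) // leq_mul2r jn orbT.
Qed.

(** The block of a column is its quotient by l. *)
Lemma column_sample_uniq l c : (0 < l)%N -> uniq (column_sample l c).
Proof.
move=> l0; apply: mkseq_uniq => i j; rewrite /sampled_column => /(congr1 (fun x => x %/ l)%N).
by rewrite ![(_ %% _ + _)%N]addnC !divnMDl // !divn_small ?ltn_mod // !addn0.
Qed.

End Runs.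

(** * Analysis of the two programs *)

Section Main.
Variables (R : realType) (G : forall n, sgraph n).
Local Notation gamma := (fun n => density R (G n)).
Local Notation X := (biclique_scale gamma).
Local Notation W n := (n ^ 10)%N.

Lemma inv_le_deviation n : (0 < n)%N -> n%:R^-1 <= deviation R n.
Proof.
move=> n0; have n0R : 0 < n%:R :> R by rewrite ltr0n.
have L0 : 0 <= ln (n%:R : R) by rewrite ln_ge0 // ler1n.
rewrite /deviation -{1}[n%:R](lnK (_ : n%:R \in Num.pos)) ?posrE //.
by rewrite -expRN ler_expR; lra.
Qed.

Lemma deviation4 n : (0 < n)%N -> deviation R n ^+ 4 = n%:R^-1.
Proof.
move=> n0; have n0R : 0 < n%:R :> R by rewrite ltr0n.
rewrite /deviation -expRM_natl -{2}[n%:R](lnK (_ : n%:R \in Num.pos)) ?posrE //.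
by rewrite -expRN; congr expR; field.
Qed.

Lemma accurate_edge_prob n e : accurate gamma n e ->
  `|edge_prob R (G n) - gamma n| <= deviation R n.
Proof.
move=> [/andP[g0 g1] n0 _]; apply: le_trans (inv_le_deviation n0).
by apply: edge_prob_close => //; rewrite !ltW.
Qed.

Lemma good_returned n e m l t s a b : accurate gamma n e -> (a <= b)%N ->
  `|a%:R / b%:R - gamma n| <= 2 * deviation R n -> found n a b m l t ->
  reg s 0 = t -> returns_biclique (G n) ([::], s) ->
  good_output (G n) (X n) e ([::], s).
Proof.
move=> [_ _ acc] ab abg fd s0 rb; have [_ tX _] := acc _ _ _ _ _ ab abg fd.
by rewrite /good_output rb /out_size s0 /= biclique_scaleE.
Qed.

Lemma accurate_m2 e (m : nat) : 0 < e <= 2^-1 -> e^-1 <= m%:R :> R -> (2 <= m)%N.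
Proof.
move=> /andP[e0 e1] em; rewrite -(ler_nat R); apply: le_trans em.
by rewrite -[leLHS]invrK lef_pV2 ?posrE // invr_gt0.
Qed.

Lemma degree_sum_le n : (degree_sum (G n) <= n * n)%N.
Proof. by apply: leq_trans (sumn_le _ (@degree_query_le n (G n))) _; rewrite size_iota. Qed.

(** The running time is O(n l), and l is at most 2 ln n / H(gamma) by the
    analysis of the search. *)
Lemma deterministic_run n e : (2 <= n)%N -> 0 < e <= 2^-1 -> 1 <= ln n%:R :> R ->
  accurate gamma n e ->
  exists T : nat, [/\ T%:R <= 1000 * time_scale gamma n :> R,
    halts_within (G n) (W n) [::] deterministic_program T &
    good_output (G n) (X n) e (run (G n) (W n) [::] deterministic_program T)].
Proof.
move=> n2 e01 L1 acc; have [g01 n0 hacc] := acc.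
have abE : (degree_sum (G n))%:R / (n * n)%:R = edge_prob R (G n) :> R.
  by rewrite /edge_prob natrM.
have dev0 : 0 < deviation R n by apply: expR_gt0.
have abg : `|(degree_sum (G n))%:R / (n * n)%:R - gamma n| <= 2 * deviation R n.
  by rewrite abE; have := accurate_edge_prob acc; lra.
have ab := degree_sum_le n.
have H0 := entropy_gt0 g01.
have H1 : entropy (gamma n) <= 1.
  apply: le_trans (entropy_le_ln2 g01) _.
  by have := @ln_le_sub1 R 2; rewrite ltr0n => /(_ isT); lra.
set H := entropy _ in H0 H1; set L := ln n%:R in L1.
have LH : 1 <= L / H by rewrite ler_pdivlMr // mul1r (le_trans H1).
pose c := Num.Def.trunc (2 * (L / H)).
have n9 : (n ^ 9 < W n)%N by rewrite ltn_exp2l.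
have Hc m l t : found n (degree_sum (G n)) (n * n) m l t ->
    (l <= size [seq v <- iota 0 n | is_dense (G n) l t v])%N /\ (l <= c)%N.
  move=> fd; have [em _ lH] := hacc _ _ _ _ _ ab abg fd.
  have m2 := accurate_m2 e01 em.
  split; first exact: dense_rows_exist fd m2 ab n0.
  have lc : l%:R <= 2 * (L / H) by rewrite mulrA ler_pdivlMr.
  by have := le_truncn lc; rewrite natrK.
have [s [rn [m [l [t [fd ret]]]]]] := runs_run (runs_deterministic [::] n2 n9 Hc).
have [em _ _] := hacc _ _ _ _ _ ab abg fd.
have m2 := accurate_m2 e01 em.
exists (n * (60 * c + 500))%N; rewrite /halts_within rn; split=> //.
  rewrite time_scaleE -/H -/L natrM natrD natrM -mulrA mulrCA ler_pM2l ?ltr0n //.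
  have : c%:R <= 2 * (L / H) by rewrite truncn_le mulr_ge0 //; lra.
  by lra.
have rb := dense_biclique fd m2 ab n0 ret.
by apply: (good_returned acc ab abg fd _ rb); case: ret.
Qed.

Definition bad_output n e (tape : seq nat) : bool :=
  ~~ good_output (G n) (X n) e
       (run (G n) (W n) tape randomized_program (1000 * n)).

Lemma tape_nth n (tape : seq nat) : (0 < n)%N -> all (fun w => w < W n)%N tape ->
  forall i, (nth 0%N tape i < W n)%N.
Proof.
move=> n0 /allP tW i; have [it|it] := ltnP i (size tape); first by apply/tW/mem_nth.
by rewrite nth_default // expn_gt0 n0.
Qed.

Lemma randomized_halts n tape : (2 <= n)%N -> all (fun w => w < W n)%N tape ->
  halts_within (G n) (W n) tape randomized_program (1000 * n).
Proof.
move=> n2 tW; have n9 : (n ^ 9 < W n)%N by rewrite ltn_exp2l.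
have [s [rn _]] := runs_run (runs_randomized (G n) n2 n9 (tape_nth (ltnW n2) tW)).
by rewrite /halts_within rn.
Qed.

(** The sample u of pairs fixes l and t. Given an accurate u, only rows of
    small total degree, repeated rows or too few good columns can prevent
    success; conditionally on u these have probability at most 8/m, l^2/n <=
    1/l and 16/l, and both 1/m and 1/l are at most e. *)
Lemma bad_output_conditional n e m l t u : (2 <= n)%N -> 0 < e <= 2^-1 ->
  accurate gamma n e -> tape_of (W n) n u ->
  let a := sumn (map (pair_adj (G n)) u) in
  `|a%:R / n%:R - edge_prob R (G n)| <= deviation R n ->
  found n a n m l t ->
  expect (W n) (999 * n) (fun v => (bad_output n e (u ++ v))%:R) <= 25 * e :> R.
Proof.
move=> n2 e01 acc /andP[/eqP un uW] a aE fd.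
have [g01 n0 hacc] := acc.
have W0 : (0 < W n)%N by rewrite expn_gt0 n0.
have n9 : (n ^ 9 < W n)%N by rewrite ltn_exp2l.
have n0R : 0 < n%:R :> R by rewrite ltr0n.
have ab : (a <= n)%N.
  by rewrite -[leqRHS]un; apply: sumn_le1 => w; apply: adj_query_le1.
have dev0 : 0 < deviation R n by apply: expR_gt0.
have abg : `|a%:R / n%:R - gamma n| <= 2 * deviation R n.
  rewrite -(subrKA (edge_prob R (G n))); apply: le_trans (ler_normD _ _) _.
  by have := accurate_edge_prob acc; lra.
have [em _ _] := hacc _ _ _ _ _ ab abg fd.
have m2 := accurate_m2 e01 em.
have [l32 ml tl tE [lam d0 _]] := found_level fd m2 ab.
have [_ l4 ln] := found_bounds fd ab.
have m0R : 0 < m%:R :> R by rewrite ltr0n ltnW.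
have l0R : 0 < l%:R :> R by rewrite ltr0n (leq_trans _ l32).
have me : m%:R^-1 <= e.
  by rewrite -[leRHS]invrK lef_pV2 ?posrE ?invr_gt0 //; case/andP: e01.
have le : l%:R^-1 <= e.
  by apply: le_trans me; rewrite lef_pV2 ?posrE // ler_nat.
set M := (n %/ l)%N; have Mn : (M <= n)%N by apply: leq_div.
(* After the pairs, the tape consists of the rows, the columns and an unread
   rest. *)
have splitT : (999 * n = l + (M + (999 * n - l - M)))%N.
  by move: Mn ln; clear; lia.
pose B1 (r : seq nat) := (sumn [seq degree_query (G n) x | x <- [seq w %% n | w <- r]] < t.+1 * n)%N.
pose B2 (r : seq nat) := ~~ uniq [seq (w %% n)%N | w <- r].
rewrite splitT expect_cat.
apply: (@le_trans _ _ (expect (W n) l (fun r => (B1 r)%:R + ((B2 r)%:R + 16 / l%:R)))).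
  apply: expect_le => r /andP[/eqP rl rW].
  have l16 : 0 <= 16 / l%:R :> R by rewrite divr_ge0.
  have [b1|nb1] := boolP (B1 r).
    apply: (@le_trans _ _ 1); last first.
      by rewrite lerDl addr_ge0.
    rewrite -[leRHS](expect_cst W0 (M + (999 * n - l - M))); apply: expect_le => v _.
    by rewrite lern1 leq_b1.
  rewrite add0r expect_cat.
  pose S := [seq (w %% n)%N | w <- r].
  have Sn x : x \in S -> (x < n)%N by move=> /mapP[w _ ->]; rewrite ltn_mod.
  have Sl : size S = l by rewrite size_map.
  have good : (n <= l * size (good_columns (G n) t S (iota 0 n)))%N.
    by apply: many_good_columns => //; rewrite leqNgt.
  pose B3 c := (8 * (l * l) * size (good_columns (G n) t S (column_sample l c)) < n)%N.
  apply: (@le_trans _ _ (expect (W n) M (fun c => (B2 r)%:R + (B3 c)%:R))); last first.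
    by rewrite expectD expect_cst // lerD2l; apply: bad_columns.
  apply: expect_le => c /andP[/eqP cM cW].
  rewrite -[leRHS](expect_cst W0 (999 * n - l - M)); apply: expect_le => z /andP[_ zW].
  have [b2|nb2] := boolP (B2 r).
    by apply: (@le_trans _ _ 1); rewrite ?lern1 ?leq_b1 // lerDl.
  have [b3|nb3] := boolP (B3 c); first by rewrite add0r lern1 leq_b1.
  rewrite addr0 ler_nat leqn0 eqb0 negbK.
  set tape := u ++ r ++ c ++ z.
  have tW : forall i, (nth 0%N tape i < W n)%N.
    by apply: tape_nth => //; rewrite !all_cat uW rW cW zW.
  have [s [rn [m' [l' [t' [fd' ret]]]]]] := runs_run (runs_randomized (G n) n2 n9 tW).
  have e1 : sampled_edges (G n) tape = a.
    rewrite /sampled_edges /a; congr (sumn (map _ _)).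
    by have := words_cat [::] u (r ++ c ++ z); rewrite /= un.
  rewrite e1 in fd'; have [_ l'E t'E] := found_unique fd' fd; subst l' t'.
  have e2 : sampled_rows n tape l = S.
    by have := words_cat u r (c ++ z); rewrite un rl /sampled_rows => ->.
  have e3 : sampled_columns n tape l = column_sample l c.
    have := words_cat (u ++ r) c z.
    by rewrite size_cat un rl cM -catA /sampled_columns => ->.
  rewrite e2 e3 in ret; rewrite rn.
  have rb : returns_biclique (G n) ([::], s).
    apply: (sampled_biclique fd m2 ab n0 Sl) ret.
    - by move: nb2; rewrite negbK.
    - by apply: column_sample_uniq; apply: leq_trans l32.
    - exact: Sn.
    - by move=> v; apply: column_sample_lt; rewrite cM.
    - by rewrite leqNgt.
  by apply: (good_returned acc ab abg fd _ rb); case: ret.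
rewrite !expectD expect_cst //.
have b2 : expect (W n) l (fun r => (B2 r)%:R) <= e.
  apply: le_trans (bad_collisions R n0 l) _; apply: le_trans le.
  rewrite ler_pdivrMr // mulrC ler_pdivlMr // -natrM ler_nat.
  apply: leq_trans l4; have -> : (l * l * l = l ^ 3)%N.
    by rewrite !expnS expn0 muln1 mulnA.
  by rewrite leq_pexp2l // (leq_trans _ l32).
have b3 : 16 / l%:R <= 16 * e by rewrite ler_pM2l.
(* The margin m^2 in t leaves c = m^2 / 2 after the errors of al, and the
   variance of the total degree divided by n is at most 2 m^3. *)
have b1 : expect (W n) l (fun r => (B1 r)%:R) <= 8 * e.
  have [al01 F1 _ _ _] := level_real R m2 d0.
  set al := a%:R / n%:R in aE al01 F1.
  have lE : l = size_of a n m.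
    by have [_ _ _] := fd; rewrite gtn_eqF // => -[].
  rewrite -lE in F1.
  have ldev : l%:R * deviation R n <= 1.
    have : (l%:R * deviation R n) ^+ 4 <= 1.
      rewrite exprMn deviation4 // -natrX ler_pdivrMr // mul1r ler_nat //.
    rewrite expr_le1 //; first by rewrite mulr_ge0 // ltW.
  set p := edge_prob R (G n) in aE.
  have lp : l%:R * `|al - p| <= 1.
    by apply: le_trans ldev; rewrite ler_wpM2l // ltW.
  have m2R : 2 <= m%:R :> R by rewrite (ler_nat _ 2).
  have ltm : t%:R + m%:R ^+ 2 <= l%:R * al.
    rewrite mulrA ler_pdivlMr // -natrX -natrD -!natrM ler_nat.
    have -> : (t + m ^ 2 = l * a %/ n)%N by rewrite expnS expn1 tE subnK // ltnW.
    exact: leq_trunc_div.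
  have c0 : 0 < m%:R ^+ 2 / 2 :> R by rewrite divr_gt0 ?exprn_gt0.
  have hc : m%:R ^+ 2 / 2 <= l%:R * p - t.+1%:R.
    have h := ler_wpM2l (ltW l0R) (ler_norm (al - p)).
    have m4 : 4 <= m%:R ^+ 2 :> R by rewrite expr2; move: m2R; clear; nra.
    have -> : t.+1%:R = t%:R + 1 :> R by rewrite natr1.
    by move: h lp ltm m4; clear; lra.
  apply: le_trans (bad_rows n0 c0 hc) _.
  have var : l%:R * (p * (1 - p)) <= 2 * m%:R ^+ 3.
    have h : p * (1 - p) - al * (1 - al) <= `|al - p|.
      have -> : p * (1 - p) - al * (1 - al) = (al - p) * (al + p - 1) by ring.
      apply: le_trans (ler_norm _) _; rewrite normrM ler_piMr // ler_norml.
      have p1 : 0 <= p <= 1.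
        rewrite /p /edge_prob -natrM divr_ge0 //= ler_pdivrMr ?ltr0n ?muln_gt0 ?n0 //.
        by rewrite mul1r ler_nat degree_sum_le.
      by move: p1 al01; clear; lra.
    have := ler_wpM2l (ltW l0R) h.
    have m8 : 1 <= m%:R ^+ 3 :> R by rewrite exprn_ege1 // ler1n ltnW.
    by move: F1 lp m8; clear; lra.
  rewrite ler_pdivrMr ?exprn_gt0 //; apply: le_trans var _.
  have -> : (m%:R ^+ 2 / 2) ^+ 2 = m%:R ^+ 3 * (m%:R / 4) :> R by field.
  have m30 : 0 <= m%:R ^+ 3 :> R by rewrite exprn_ge0.
  have em1 : 1 <= e * m%:R by rewrite -ler_pdivrMr // mul1r.
  by have := ler_wpM2l m30 em1; clear; lra.
by move: b1 b2 b3; clear; lra.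
Qed.

(** The probability of an inaccurate sample of pairs is at most n^(-1/2), the
    square of the deviation. *)
Lemma bad_output_unlikely n e : (2 <= n)%N -> 0 < e <= 2^-1 -> accurate gamma n e ->
  expect (W n) (1000 * n) (fun tape => (bad_output n e tape)%:R) <=
    deviation R n ^+ 2 + 25 * e.
Proof.
move=> n2 e01 acc; have [g01 n0 hacc] := acc.
have W0 : (0 < W n)%N by rewrite expn_gt0 n0.
have n9 : (n ^ 9 < W n)%N by rewrite ltn_exp2l.
have n0R : 0 < n%:R :> R by rewrite ltr0n.
have dev0 : 0 < deviation R n by apply: expR_gt0.
have -> : (1000 * n = n + 999 * n)%N by lia.
rewrite expect_cat.
pose A (u : seq nat) := deviation R n <
  `|(sumn (map (pair_adj (G n)) u))%:R / n%:R - edge_prob R (G n)|.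
apply: (@le_trans _ _ (expect (W n) n (fun u => (A u)%:R + 25 * e))); last first.
  rewrite expectD expect_cst // lerD2r; apply: le_trans (bad_density (G n) n0 dev0) _.
  rewrite invfM -deviation4 // ler_pdivrMr ?exprn_gt0 //.
  by rewrite -exprD.
apply: expect_le => u uT.
have [Au|nAu] := boolP (A u).
  apply: (@le_trans _ _ 1); last by rewrite lerDl mulr_ge0 //; case/andP: e01 => /ltW.
  rewrite -[leRHS](expect_cst W0 (999 * n)); apply: expect_le => v _.
  by rewrite lern1 leq_b1.
rewrite add0r; have /andP[/eqP un uW] := uT.
have tW := tape_nth n0 uW.
have [s [_ [m [l [t [fd _]]]]]] := runs_run (runs_randomized (G n) n2 n9 tW).
have e1 : sampled_edges (G n) u = sumn (map (pair_adj (G n)) u).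
  rewrite /sampled_edges; congr (sumn (map _ _)).
  by have := words_cat [::] u [::]; rewrite /= cats0 un.
rewrite e1 in fd.
by apply: bad_output_conditional fd => //; rewrite leNgt.
Qed.

Local Open Scope classical_set_scope.
Hypothesis dense : density_condition gamma.

Lemma accurate_sequence : exists eps : nat -> R,
  [/\ forall n, 0 < eps n, eps @ \oo --> (0 : R) &
   \forall n \near \oo, [/\ (2 <= n)%N, 0 < eps n <= 2^-1, 1 <= ln n%:R :> R &
     accurate gamma n (eps n)]].
Proof.
have [eps [e0 elim acc]] := diagonal_sequence (near_accurate dense).
exists eps; split=> //; near=> n.
have en : `|0 - eps n| <= 2^-1.
  by near: n; move/cvgrPdist_le: elim; apply; rewrite invr_gt0.
split; [near: n; exact: nbhs_infty_ge| |near: n; exact: ln_nat_large|by near: n].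
by rewrite e0 /=; move: en; rewrite sub0r normrN gtr0_norm.
Unshelve. all: by end_near.
Qed.

Lemma deterministic_part : exists (T : nat -> nat) (eps : nat -> R),
  [/\ \forall n \near \oo, (T n)%:R <= 1000 * time_scale gamma n,
   \forall n \near \oo, halts_within (G n) (W n) [::] deterministic_program (T n),
   eps @ \oo --> (0 : R) &
   \forall n \near \oo, good_output (G n) (X n) (eps n)
     (run (G n) (W n) [::] deterministic_program (T n))].
Proof.
have [eps [e0 elim acc]] := accurate_sequence.
have [N hN] := (near_ooP _).1 acc.
have /choice[T hT] : forall n, exists T : nat, (N <= n)%N ->
    [/\ T%:R <= 1000 * time_scale gamma n :> R,
     halts_within (G n) (W n) [::] deterministic_program T &
     good_output (G n) (X n) (eps n) (run (G n) (W n) [::] deterministic_program T)].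
  move=> n; have [Nn|nN] := leqP N n; last by exists 0%N; lia.
  have [n2 e01 L1 an] := hN n Nn.
  by have [T hT] := deterministic_run n2 e01 L1 an; exists T.
exists T, eps; split=> //; apply/near_ooP; exists N => n /hT [] //.
Qed.

(** The entropy is at most ln 2 <= 1, so the time scale allows for a linear
    number of steps. *)
Lemma linear_le_time_scale n : 0 < gamma n < 1 -> 1 <= ln n%:R :> R ->
  n%:R <= time_scale gamma n.
Proof.
move=> g01 L1; have H0 := entropy_gt0 g01.
have H1 : entropy (gamma n) <= 1.
  apply: le_trans (entropy_le_ln2 g01) _.
  by have := @ln_le_sub1 R 2; rewrite ltr0n => /(_ isT); lra.
rewrite time_scaleE -mulrA ler_peMr // ler_pdivlMr // mul1r.
exact: le_trans L1.
Qed.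

Lemma randomized_part : exists (T : nat -> nat) (eps : nat -> R),
  [/\ \forall n \near \oo, (T n)%:R <= 1000 * time_scale gamma n,
   \forall n \near \oo, forall w : (T n).-tuple 'I_(n ^ 10),
     halts_within (G n) (n ^ 10) (tape_words w) randomized_program (T n),
   eps @ \oo --> (0 : R) &
   (fun n => Pr R (n ^ 10) (T n) (fun tape =>
      good_output (G n) (X n) (eps n)
        (run (G n) (n ^ 10) tape randomized_program (T n)))) @ \oo --> (1 : R)].
Proof.
have [eps [e0 elim acc]] := accurate_sequence.
exists (fun n => 1000 * n)%N, eps; split=> //.
- near=> n.
  have [_ _ L1 [g01 _ _]] : [/\ (2 <= n)%N, 0 < eps n <= 2^-1, 1 <= ln n%:R :> R &
     accurate gamma n (eps n)] by near: n.
  have h := linear_le_time_scale g01 L1.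
  have k0 : (0 : R) <= 1000%:R by exact: ler0n.
  by have := ler_wpM2l k0 h; rewrite -natrM.
- near=> n => w; apply: randomized_halts; first by near: n; exact: nbhs_infty_ge.
  by apply/allP => x /mapP[i _ ->]; apply: ltn_ord.
- apply/cvgrPdist_le => d d0; near=> n.
  have [n2 e01 L1 an] : [/\ (2 <= n)%N, 0 < eps n <= 2^-1, 1 <= ln n%:R :> R &
     accurate gamma n (eps n)] by near: n.
  have W0 : (0 < W n)%N by rewrite expn_gt0 (ltn_trans _ n2).
  have bad := bad_output_unlikely n2 e01 an.
  have en : `|0 - eps n| <= d / 50.
    by near: n; move/cvgrPdist_le: elim; apply; rewrite divr_gt0.
  rewrite sub0r normrN gtr0_norm // in en.
  have Ld : - 2 * ln (d / 2) <= ln n%:R by near: n; exact: ln_nat_large.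
  have d2 : 0 < d / 2 by rewrite divr_gt0.
  have dev2 : deviation R n ^+ 2 <= d / 2.
    rewrite -{1}(lnK (_ : d / 2 \in Num.pos)) ?posrE //.
    rewrite /deviation -expRM_natl ler_expR; move: Ld; clear; lra.
  have badE : expect (W n) (1000 * n) (fun tape => (bad_output n (eps n) tape)%:R) =
      1 - Pr R (W n) (1000 * n) (fun tape => good_output (G n) (X n) (eps n)
        (run (G n) (W n) tape randomized_program (1000 * n))) :> R.
    apply/eqP; rewrite eq_sym subr_eq Pr_expect // -expectD; apply/eqP.
    rewrite -[LHS](expect_cst W0 (1000 * n)); apply: expect_ext => s _.
    by rewrite /bad_output; case: good_output; rewrite /= ?addr0 ?add0r.
  rewrite -badE ger0_norm; last by apply: expect_ge0.
  by apply: le_trans bad _; move: dev2 en; clear; lra.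
Unshelve. all: by end_near.
Qed.

End Main.

Local Open Scope classical_set_scope.

Theorem mainTheorem5 (R : realType) :
  (exists (p : cmd) (k : nat) (C : R),
    ~~ uses_deg p /\
    forall G : forall n, sgraph n,
    let gamma := fun n => density R (G n) in
    density_condition gamma ->
    n_pow 1 (time_scale gamma) /\
    exists (T : nat -> nat) (eps : nat -> R),
    [/\ \forall n \near \oo, (T n)%:R <= C * time_scale gamma n,
        \forall n \near \oo, forall w : (T n).-tuple 'I_(n ^ k),
          halts_within (G n) (n ^ k) (tape_words w) p (T n),
        eps @ \oo --> (0 : R) &
        (fun n => Pr R (n ^ k) (T n) (fun tape =>
           good_output (G n) (biclique_scale gamma n) (eps n)
             (run (G n) (n ^ k) tape p (T n)))) @ \oo --> (1 : R)])
  /\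
  (exists (p : cmd) (k : nat) (C : R),
    ~~ uses_rand p /\
    forall G : forall n, sgraph n,
    let gamma := fun n => density R (G n) in
    density_condition gamma ->
    n_pow 1 (time_scale gamma) /\
    exists (T : nat -> nat) (eps : nat -> R),
    [/\ \forall n \near \oo, (T n)%:R <= C * time_scale gamma n,
        \forall n \near \oo, halts_within (G n) (n ^ k) [::] p (T n),
        eps @ \oo --> (0 : R) &
        \forall n \near \oo,
          good_output (G n) (biclique_scale gamma n) (eps n)
            (run (G n) (n ^ k) [::] p (T n))]).
Proof.
split.
- exists randomized_program, 10%N, 1000; split=> // G gamma dense.
  by split; [exact: time_scale_n_pow|exact: randomized_part].
- exists deterministic_program, 10%N, 1000; split=> // G gamma dense.
  by split; [exact: time_scale_n_pow|exact: deterministic_part].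
Qed.
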